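(* There is an absolute constant $C>0$ such that the following holds for all $n\ge 1$, all $\Delta>0$, and all $\epsilon,\delta\in(0,1/2]$. Let $\boldsymbol{H}$ be a known $\Delta$-gapped Hamiltonian on $n$ qubits with ground state $|\psi_0\rangle$, and let $\boldsymbol{A}$ be a Hermitian observable on $n$ qubits with operator norm $\|\boldsymbol{A}\|\le 1$. Given one copy of $|\psi_0\rangle$, the value $\Delta$, black-box access to controlled Heisenberg evolution under $\boldsymbol{H}$, and access to a block-encoding of $\boldsymbol{A}$, there is a quantum measurement protocol that (i) outputs a number $\tilde a$ with $|\tilde a-\langle\psi_0|\boldsymbol{A}|\psi_0\rangle|\le\epsilon$ with probability at least $1-\delta$; (ii) uses total controlled Heisenberg evolution time for $\boldsymbol{H}$ at most $$C\,\frac{\log(1/\delta)\,\big(\log(1/\delta)+\log(1/\epsilon)\big)}{\Delta\,\epsilon};$$ (iii) makes at most $C\,\dfrac{\log(1/\delta)}{\epsilon}$ calls to the block-encoding of $\boldsymbol{A}$; and (iv) returns, on the $n$-qubit system register, a state that is $\delta$-close to $|\psi_0\rangle\langle\psi_0|$ in trace distance.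
   Context: An $n$-qubit Hamiltonian (Hermitian operator on $(\mathbb{C}^2)^{\otimes n}$) $\boldsymbol{H}=\sum_{i=0}^{2^n-1}E_i|\psi_i\rangle\langle\psi_i|$ with $E_0\le E_1\le\cdots\le E_{2^n-1}$ is called $\Delta$-gapped if it has a unique ground state $|\psi_0\rangle$ and $E_1-E_0\ge\Delta$. (Only a lower bound $\Delta$ on the spectral gap is assumed known.) Block-encoding: a unitary $\boldsymbol{V}$ on $b$ ancilla qubits and the $n$ system qubits is a block-encoding of $\boldsymbol{A}$ if $(\langle 0^b|\otimes \boldsymbol{I})\boldsymbol{V}(|0^b\rangle\otimes \boldsymbol{I})=\boldsymbol{A}$. Access to a block-encoding means one may apply $\boldsymbol{V}$ (and its inverse and controlled versions) as a black box; each use is one call. Controlled Heisenberg evolution: the Hamiltonian is accessed only through black-box controlled forward and backward evolution, i.e. unitaries $\sum_{\bar t\in S}e^{\pm i\boldsymbol{H}\bar t}\otimes|\bar t\rangle\langle\bar t|$, where $S=\{-t_02^{k-1},\dots,-t_0,0,t_0,\dots,t_0(2^{k-1}-1)\}$ is a discretized time register of dimension $2^k$ (with $t_0>0$ and $k$ at the protocol's choice), used in the form of (controlled) Heisenberg dynamics $e^{i\boldsymbol{H}t}\boldsymbol{A}e^{-i\boldsymbol{H}t}$. The evolution time of one use is $\max_{\bar t\in S}|\bar t|$, and the total evolution time is the sum over all uses. The protocol may be any quantum circuit with ancilla qubits, gates independent of the black boxes, and measurements. The final state of the system register is obtained by tracing out all ancillas. *)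

(* Defs.v *)
From HB Require Import structures.
From mathcomp Require Import all_boot all_order all_algebra.
From mathcomp Require Import complex.
From mathcomp Require mxtens.
From mathcomp Require Import classical_sets reals exp trigo.

Set Implicit Arguments.
Unset Strict Implicit.
Unset Printing Implicit Defensive.

Import Order.TTheory GRing.Theory Num.Theory.
Local Open Scope ring_scope.
Local Open Scope complex_scope.
Local Open Scope sesquilinear_scope.

(* Only the Kronecker product is taken from mxtens: importing it would clash
   with the conjugate-transpose notation. *)
Notation "A *t B" := (mxtens.tensmx A B)
  (at level 40, left associativity) : ring_scope.

Section LinearAlgebra.
Variable R : realType.
Local Notation C := R[i].

(* Functional calculus for a normal matrix, M = P^-1 diag(x) P. *)
Definition mxfun (d : nat) (f : C -> C) (M : 'M[C]_d) : 'M[C]_d :=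
  invmx (spectralmx M) *m diag_mx (map_mx f (spectral_diag M))
    *m spectralmx M.

(* e^{iHt} for H Hermitian, whose eigenvalues are real. *)
Definition evolution (d : nat) (H : 'M[C]_d) (t : R) : 'M[C]_d :=
  mxfun (fun z => cos (complex.Re z * t) +i* sin (complex.Re z * t)) H.

Definition trace_norm (d : nat) (M : 'M[C]_d) : R :=
  complex.Re (\tr (mxfun sqrtC (M^t* *m M))).

Definition trace_distance (d : nat) (rho sigma : 'M[C]_d) : R :=
  trace_norm (rho - sigma) / 2.

Definition vnorm (d : nat) (v : 'cV[C]_d) : R :=
  complex.Re (sqrtC ((v^t* *m v) 0 0)).

Definition opnorm (d : nat) (A : 'M[C]_d) : R :=
  sup [set vnorm (A *m v) | v in [set v : 'cV[C]_d | vnorm v <= 1]]%classic.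

Definition pure (d : nat) (v : 'cV[C]_d) : 'M[C]_d := v *m v^t*.

(* <psi|A|psi>, which is real for A Hermitian. *)
Definition expectation (d : nat) (A : 'M[C]_d) (psi : 'cV[C]_d) : R :=
  complex.Re ((psi^t* *m A *m psi) 0 0).

(* Trace over the left tensor factor. *)
Definition ptrace (a d : nat) (M : 'M[C]_(a * d)) : 'M[C]_d :=
  \matrix_(i, j) \sum_(k < a)
    M (mxtens.mxtens_index (k, i)) (mxtens.mxtens_index (k, j)).

Definition ket0 (m : nat) : 'cV[C]_(2 ^ m) := \col_i (i == 0%N :> nat)%:R.

(* E and psi are indexed by nat; only the indices below 2 ^ n matter. *)
Definition eigendecomposition (n : nat) (H : 'M[C]_(2 ^ n))
    (E : nat -> R) (psi : nat -> 'cV[C]_(2 ^ n)) : Prop :=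
  [/\ forall i j, (i < 2 ^ n)%N -> (j < 2 ^ n)%N ->
        (psi i)^t* *m psi j = (i == j)%:R%:M,
      forall i j, (i <= j)%N -> (j < 2 ^ n)%N -> E i <= E j
    & H = \sum_(i < 2 ^ n) (E i)%:C *: pure (psi i)].

(* For n >= 1; the strict inequality says that the ground state is unique. *)
Definition gapped (n : nat) (Delta : R) (H : 'M[C]_(2 ^ n))
    (psi0 : 'cV[C]_(2 ^ n)) : Prop :=
  exists (E : nat -> R) (psi : nat -> 'cV[C]_(2 ^ n)),
    [/\ eigendecomposition H E psi, psi 0%N = psi0,
        E 0%N < E 1%N & Delta <= E 1%N - E 0%N].

(* |0^b> (x) I *)
Definition inject0 (b n : nat) : 'M[C]_(2 ^ b * 2 ^ n, 2 ^ n) :=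
  castmx (erefl, mul1n (2 ^ n)%N) (ket0 b *t (1%:M : 'M[C]_(2 ^ n))).

Definition block_encoding (b n : nat) (V : 'M[C]_(2 ^ b * 2 ^ n))
    (A : 'M[C]_(2 ^ n)) : Prop :=
  V \is unitarymx /\ (inject0 b n)^t* *m V *m inject0 b n = A.

End LinearAlgebra.

Section Protocols.
Variable R : realType.
Variables w b n : nat.
Local Notation C := R[i].

(* The register is (w work qubits) (x) (b block-encoding ancillas) (x)
   (n system qubits). *)
Definition operator := 'M[C]_(2 ^ w * (2 ^ b * 2 ^ n)).

(* Qubit q of the work register in basis state j, q = 0 being the last one. *)
Definition qubit (q : 'I_w) (j : 'I_(2 ^ w)) : bool := odd (j %/ 2 ^ q).

(* \sum_j |j><j| (x) f j, controlled by the work register. *)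
Definition select (f : 'I_(2 ^ w) -> 'M[C]_(2 ^ b * 2 ^ n)) : operator :=
  \sum_(j < 2 ^ w) (delta_mx j j : 'M[C]_(2 ^ w)) *t f j.

Definition meas_proj (q : 'I_w) (x : bool) : operator :=
  select (fun j => if qubit q j == x then 1%:M else 0).

(* For i < 2 ^ k: -t0 2^(k-1), ..., -t0, 0, t0, ..., t0 (2^(k-1) - 1). *)
Definition grid_time (t0 : R) (k i : nat) : R :=
  t0 * (i%:R - (2 ^ k.-1)%:R).

Definition max_time (t0 : R) (k : nat) : R :=
  \big[Num.max/0]_(i < 2 ^ k) `|grid_time t0 k i|.

(* Adaptive circuits.  [Call inv ctrl] applies the block-encoding V, or its
   inverse if [inv], controlled by a work qubit if [ctrl] is [Some _].
   [Heisenberg t0 k _ _ inv ctrl] does the same conjugated by controlled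
   evolution, the last k work qubits being the time register; arbitrary gates
   can move any qubits into these positions.  The circuit, including t0 and k,
   does not depend on H or V; finitely many times cannot resolve energies of
   unbounded size, so a circuit can only serve all H below some norm bound. *)
Inductive protocol : Type :=
| Output of R
| Gate (U : operator) of U \is unitarymx & protocol
| Measure of 'I_w & (bool -> protocol)
| Call of bool & option 'I_w & protocol
| Heisenberg (t0 : R) (k : nat) of 0 < t0 & (0 < k <= w)%N
    & bool & option 'I_w & protocol.

Definition call_op (V : 'M[C]_(2 ^ b * 2 ^ n)) (inv : bool)
    (ctrl : option 'I_w) : operator :=
  let V' := if inv then V^t* else V in
  select (fun j =>
    if ctrl is Some q then (if qubit q j then V' else 1%:M) else V').

(* \sum_t |t><t| (x) e^{iHt} if [fwd], and its inverse otherwise. *)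
Definition evolution_op (H : 'M[C]_(2 ^ n)) (t0 : R) (k : nat) (fwd : bool)
    : operator :=
  select (fun j =>
    let t := grid_time t0 k (j %% 2 ^ k) in
    (1%:M : 'M[C]_(2 ^ b)) *t evolution H (if fwd then t else - t)).

Definition heisenberg_op (H : 'M[C]_(2 ^ n)) (V : 'M[C]_(2 ^ b * 2 ^ n))
    (t0 : R) (k : nat) (inv : bool) (ctrl : option 'I_w) : operator :=
  evolution_op H t0 k true *m call_op V inv ctrl *m evolution_op H t0 k false.

(* The leaves reached from rho: the number output, and the unnormalized final
   state, whose trace is the probability of the leaf. *)
Fixpoint run (H : 'M[C]_(2 ^ n)) (V : 'M[C]_(2 ^ b * 2 ^ n))
    (p : protocol) (rho : operator) : seq (R * operator) :=
  match p with
  | Output a => [:: (a, rho)]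
  | Gate U _ p' => run H V p' (U *m rho *m U^t*)
  | Measure q f =>
      run H V (f false) (meas_proj q false *m rho *m (meas_proj q false)^t*)
      ++ run H V (f true) (meas_proj q true *m rho *m (meas_proj q true)^t*)
  | Call inv ctrl p' =>
      let U := call_op V inv ctrl in run H V p' (U *m rho *m U^t*)
  | Heisenberg t0 k _ _ inv ctrl p' =>
      let U := heisenberg_op H V t0 k inv ctrl in
      run H V p' (U *m rho *m U^t*)
  end.

(* Worst case over the measurement outcomes; each Heisenberg conjugation is one
   forward and one backward use of the evolution. *)
Fixpoint evolution_time (p : protocol) : R :=
  match p with
  | Output _ => 0
  | Gate _ _ p' => evolution_time p'
  | Measure _ f => Num.max (evolution_time (f false)) (evolution_time (f true))
  | Call _ _ p' => evolution_time p'
  | Heisenberg t0 k _ _ _ _ p' =>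
      max_time t0 k + max_time t0 k + evolution_time p'
  end.

Fixpoint calls (p : protocol) : nat :=
  match p with
  | Output _ => 0
  | Gate _ _ p' => calls p'
  | Measure _ f => maxn (calls (f false)) (calls (f true))
  | Call _ _ p' => (calls p').+1
  | Heisenberg _ _ _ _ _ _ p' => (calls p').+1
  end.

Definition outcomes (H : 'M[C]_(2 ^ n)) (V : 'M[C]_(2 ^ b * 2 ^ n))
    (p : protocol) (psi : 'cV[C]_(2 ^ n)) : seq (R * operator) :=
  run H V p (pure (ket0 R w *t (ket0 R b *t psi))).

Definition output_probability (H : 'M[C]_(2 ^ n))
    (V : 'M[C]_(2 ^ b * 2 ^ n)) (p : protocol) (psi : 'cV[C]_(2 ^ n))
    (good : pred R) : R :=
  \sum_(x <- outcomes H V p psi | good x.1) complex.Re (\tr x.2).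

Definition system_state (H : 'M[C]_(2 ^ n)) (V : 'M[C]_(2 ^ b * 2 ^ n))
    (p : protocol) (psi : 'cV[C]_(2 ^ n)) : 'M[C]_(2 ^ n) :=
  \sum_(x <- outcomes H V p psi) ptrace (ptrace x.2).

End Protocols.

(* Main.v *)
Require Import Defs.
From HB Require Import structures.
From mathcomp Require Import all_boot all_order all_algebra.
From mathcomp Require Import complex.
From mathcomp Require mxtens.
From mathcomp Require Import classical_sets reals topology normedtype derive realfun sequences exp trigo.
From mathcomp Require Import ring lra.

Import Order.TTheory GRing.Theory Num.Theory.
Local Open Scope ring_scope.
Local Open Scope complex_scope.
Local Open Scope sesquilinear_scope.
Import mxtens.
Import numFieldNormedType.Exports.

Set Implicit Arguments.
Unset Strict Implicit.

(* Averaging e^{iHt} A e^{-iHt} over the times of a register, with weights the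
   m-fold convolution of a uniform distribution of width L ~ 1/(Delta t0),
   suppresses the matrix elements of A out of psi0 by 2^-m, so on psi0 the result
   acts as the scalar a = <psi0|A|psi0>.  With time register, control and flag in
   suitable superpositions u and u', one controlled Heisenberg call W satisfies
   <u'| W |u> psi0 ~ ((a - c) / 16) psi0 for a chosen shift c.

   Alternating the reflections about u and about W^-1 u' then rotates the plane
   spanned by x = u (x) psi0 and its partner by 2 arcsin ((a - c) / 16) per step,
   without disturbing psi0.  Measuring after K steps whether the state is x flips
   between x and its partner with a probability F that depends monotonically on a.
   From a in [l, l + r], K ~ 4 / r steps and O(log(1/delta) + i) trials tell
   a <= l + 2 r / 3 from a >= l + r / 3, where i is the number of stages to go,
   and further trials bring the state back to x.  The interval shrinks by 2/3 per
   stage, so the last stage dominates the cost, O(log(1/delta) / epsilon) calls,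
   each with evolution time O(m / Delta), m ~ log(1/delta) + log(1/epsilon).

   The analysis of the adaptive circuit rests on [failure_norm p v], the square
   root of the total weight of wrong leaves and of leaves that left psi0.  It is a
   seminorm in v dominated by the norm, so the 2^-m errors of the calls add up
   linearly and the circuit can be followed as if every call were exact. *)

(** * Norms and projections *)

Section Norm.
Variable R : realType.
Local Notation C := R[i].

(** Whichever of the two plane states is present, K further steps flip it with the same probability
    F. The flips of a stage are thus binomially distributed, no measurement spoils the next trial,
    and only their parity has to be undone at the end. This needs F bounded below, whence the shift
    c = l - r: it keeps (a - c) / 16 in [r / 16, r / 8] and the total angle in [1/3, 16/15], on the
    increasing branch of sine.

    The circuit is fixed before H is known. The spacing t0 must suit the widest spectrum allowed,
    but the filter length L t0 is of order 1/Delta whatever t0 is, so the norm bound on H influences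
    the size of the registers and not the evolution time.

    Two kinds of error are kept apart. Statistical failures mix like probabilities and are summed
    over the stages with a geometric budget below 4^-Ld. Errors of amplitude are proportional to
    2^-m per call, so 2^-m has to beat the number of calls, which leads to 2^-m of order delta^2
    eps. *)

Lemma Re_sum (I : Type) (r : seq I) (P : pred I) (F : I -> C) :
  complex.Re (\sum_(i <- r | P i) F i) = \sum_(i <- r | P i) complex.Re (F i).
Proof. by apply: (big_morph (@complex.Re R)) => // -[a b] [c d]. Qed.

Lemma adjmxE m n (A : 'M[C]_(m, n)) i j : A^t* i j = conjc (A j i).
Proof. by rewrite !mxE. Qed.

Lemma adjmxM m n p (A : 'M[C]_(m, n)) (B : 'M[C]_(n, p)) :
  (A *m B)^t* = B^t* *m A^t*.
Proof. by rewrite trmx_mul map_mxM. Qed.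

Lemma adjmxD m n (A B : 'M[C]_(m, n)) : (A + B)^t* = A^t* + B^t*.
Proof. by rewrite linearD map_mxD. Qed.

Lemma adjmxN m n (A : 'M[C]_(m, n)) : (- A)^t* = - A^t*.
Proof. by rewrite linearN map_mxN. Qed.

Lemma adjmxB m n (A B : 'M[C]_(m, n)) : (A - B)^t* = A^t* - B^t*.
Proof. by rewrite adjmxD adjmxN. Qed.

Lemma adjmxZ m n (z : C) (A : 'M[C]_(m, n)) : (z *: A)^t* = conjc z *: A^t*.
Proof. by rewrite linearZ map_mxZ. Qed.

Lemma adjmxZr m n (c : R) (A : 'M[C]_(m, n)) : (c%:C *: A)^t* = c%:C *: A^t*.
Proof. by rewrite adjmxZ conjc_real. Qed.

Lemma adjmx1 n : (1%:M : 'M[C]_n)^t* = 1%:M.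
Proof. by rewrite trmx1 map_mx1. Qed.

Lemma adjmx_sum (I : Type) (r : seq I) (P : pred I) m n
    (F : I -> 'M[C]_(m, n)) :
  (\sum_(i <- r | P i) F i)^t* = \sum_(i <- r | P i) (F i)^t*.
Proof. by rewrite linear_sum map_mx_sum. Qed.

Lemma unitaryP_left n (U : 'M[C]_n) : reflect (U^t* *m U = 1%:M) (U \is unitarymx).
Proof. by apply: (iffP unitarymxP) => /mulmx1C. Qed.

(** The real part of the Hermitian product turns complex vectors into a real Euclidean space; this
    suffices for Cauchy-Schwarz, for norms and for orthogonal projections. *)
Definition rdot d (u v : 'cV[C]_d) : R := complex.Re ((u^t* *m v) 0 0).
Definition nsq d (v : 'cV[C]_d) : R := rdot v v.
Definition nrm d (v : 'cV[C]_d) : R := Num.sqrt (nsq v).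

Lemma rdotC d (u v : 'cV[C]_d) : rdot u v = rdot v u.
Proof.
rewrite /rdot -[u in RHS](trmxCK u) -adjmxM adjmxE.
by case: ((_ *m _) _ _).
Qed.

Lemma rdotDr d (u v w : 'cV[C]_d) : rdot u (v + w) = rdot u v + rdot u w.
Proof. by rewrite /rdot mulmxDr mxE raddfD. Qed.

Lemma rdotDl d (u v w : 'cV[C]_d) : rdot (v + w) u = rdot v u + rdot w u.
Proof. by rewrite !(rdotC _ u) rdotDr. Qed.

Lemma rdotZr d (c : R) (u v : 'cV[C]_d) : rdot u (c%:C *: v) = c * rdot u v.
Proof. by rewrite /rdot -scalemxAr mxE; case: ((_ *m _) _ _) => a b /=; ring. Qed.

Lemma rdotZl d (c : R) (u v : 'cV[C]_d) : rdot (c%:C *: v) u = c * rdot v u.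
Proof. by rewrite !(rdotC _ u) rdotZr. Qed.

Lemma nsq_sum d (v : 'cV[C]_d) :
  nsq v = \sum_i (complex.Re (v i 0) ^+ 2 + complex.Im (v i 0) ^+ 2).
Proof.
rewrite /nsq /rdot mxE raddf_sum; apply: eq_bigr => i _.
by rewrite adjmxE; case: (v i 0) => a b /=; ring.
Qed.

Lemma nsq_ge0 d (v : 'cV[C]_d) : 0 <= nsq v.
Proof.
by rewrite nsq_sum sumr_ge0 // => i _; rewrite addr_ge0 // sqr_ge0.
Qed.

Lemma nsqE d (v : 'cV[C]_d) : (v^t* *m v) 0 0 = (nsq v)%:C.
Proof.
rewrite /nsq /rdot; apply/eqP; rewrite eq_complex /= eqxx /=.
have: ((v^t* *m v)^t*) 0 0 = (v^t* *m v) 0 0 by rewrite adjmxM trmxCK.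
rewrite adjmxE; case: ((_ *m _) _ _) => a b [] /= h; apply/eqP; lra.
Qed.

Lemma nsqD d (u v : 'cV[C]_d) : nsq (u + v) = nsq u + 2 * rdot u v + nsq v.
Proof. 
rewrite /nsq rdotDr !rdotDl (rdotC v u).
by move: (rdot u u) (rdot u v) (rdot v v) => a b c; ring.
Qed.

Lemma nsqZ d (c : R) (v : 'cV[C]_d) : nsq (c%:C *: v) = c ^+ 2 * nsq v.
Proof. by rewrite /nsq rdotZr rdotZl; ring. Qed.

Lemma nsqZc d (z : C) (v : 'cV[C]_d) :
  nsq (z *: v) = (complex.Re z ^+ 2 + complex.Im z ^+ 2) * nsq v.
Proof.
rewrite !nsq_sum mulr_sumr; apply: eq_bigr => i _; rewrite mxE.
by case: z => a b; case: (v i 0) => p q /=; ring.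
Qed.

Lemma nsqN d (v : 'cV[C]_d) : nsq (- v) = nsq v.
Proof. by rewrite !nsq_sum; apply: eq_bigr => i _; rewrite mxE; case: (v i 0) => a b /=; rewrite !sqrrN. Qed.

Lemma nsq0 d : nsq (0 : 'cV[C]_d) = 0.
Proof. by rewrite /nsq /rdot mulmx0 mxE. Qed.

Lemma nsq_eq0 d (v : 'cV[C]_d) : nsq v = 0 -> v = 0.
Proof.
rewrite nsq_sum => /eqP; rewrite psumr_eq0 => [/allP h|i _]; last first.
  by rewrite addr_ge0 // sqr_ge0.
apply/colP => i; rewrite mxE; have := h i (mem_index_enum i) => /=.
rewrite paddr_eq0 ?sqr_ge0 // !sqrf_eq0 => /andP[/eqP ha /eqP hb].
by apply/eqP; rewrite eq_complex ha hb /= !eqxx.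
Qed.

Lemma CauchySchwarz_rdot d (u v : 'cV[C]_d) : rdot u v ^+ 2 <= nsq u * nsq v.
Proof.
have [u0|/eqP u0] := eqVneq (nsq u) 0.
  by rewrite (nsq_eq0 u0) /rdot linear0 map_mx0 mul0mx mxE /= expr0n nsq0 mul0r.
have up : 0 < nsq u by rewrite lt_neqAle nsq_ge0 andbT eq_sym; apply/eqP.
have := nsq_ge0 ((nsq u)%:C *: v + (- rdot u v)%:C *: u).
rewrite nsqD !nsqZ rdotZr rdotZl (rdotC v u) => h.
have: 0 <= nsq u * (nsq u * nsq v - rdot u v ^+ 2).
  by apply: le_trans h _; move: (nsq u) (nsq v) (rdot u v) => a b c; rewrite le_eqVlt; apply/orP; left; apply/eqP; ring.
by rewrite (pmulr_rge0 _ up) subr_ge0.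
Qed.

Lemma nrm_ge0 d (v : 'cV[C]_d) : 0 <= nrm v.
Proof. exact: sqrtr_ge0. Qed.

Lemma sqr_nrm d (v : 'cV[C]_d) : nrm v ^+ 2 = nsq v.
Proof. by rewrite sqr_sqrtr // nsq_ge0. Qed.

Lemma rdot_le d (u v : 'cV[C]_d) : `|rdot u v| <= nrm u * nrm v.
Proof.
rewrite -ler_sqr ?nnegrE ?mulr_ge0 ?nrm_ge0 //.
by rewrite real_normK ?num_real // exprMn !sqr_nrm CauchySchwarz_rdot.
Qed.

Lemma nrmD d (u v : 'cV[C]_d) : nrm (u + v) <= nrm u + nrm v.
Proof.
rewrite -ler_sqr ?nnegrE ?addr_ge0 ?nrm_ge0 // sqr_nrm nsqD sqrrD !sqr_nrm.
rewrite lerD2r lerD2l mulr_natl lerMn2r /=.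
exact: le_trans (ler_norm _) (rdot_le _ _).
Qed.

Lemma nrmN d (v : 'cV[C]_d) : nrm (- v) = nrm v.
Proof. by rewrite /nrm nsqN. Qed.

Lemma nrm0 d : nrm (0 : 'cV[C]_d) = 0.
Proof. by rewrite /nrm nsq0 sqrtr0. Qed.

Lemma nrmZ d (c : R) (v : 'cV[C]_d) : nrm (c%:C *: v) = `|c| * nrm v.
Proof. by rewrite /nrm nsqZ sqrtrM ?sqr_ge0 // sqrtr_sqr. Qed.

Lemma rdot_adjmx m n (A : 'M[C]_(m, n)) u v :
  rdot (A^t* *m u) v = rdot u (A *m v).
Proof. by rewrite /rdot (adjmxM (A^t*) u) trmxCK mulmxA. Qed.

Lemma nsq_iso m n (M : 'M[C]_(m, n)) v : M^t* *m M = 1%:M -> nsq (M *m v) = nsq v.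
Proof.
by move=> h; rewrite /nsq /rdot adjmxM mulmxA -[X in X *m v]mulmxA h mulmx1.
Qed.

Lemma nrm_iso m n (M : 'M[C]_(m, n)) v : M^t* *m M = 1%:M -> nrm (M *m v) = nrm v.
Proof. by move=> h; rewrite /nrm nsq_iso. Qed.

Lemma nsq_unitary n (U : 'M[C]_n) v : U \is unitarymx -> nsq (U *m v) = nsq v.
Proof. by move/unitaryP_left; exact: nsq_iso. Qed.

Lemma nrm_unitary n (U : 'M[C]_n) v : U \is unitarymx -> nrm (U *m v) = nrm v.
Proof. by move/unitaryP_left; exact: nrm_iso. Qed.

Definition orthoproj d (P : 'M[C]_d) := P^t* = P /\ P *m P = P.

Lemma orthoproj_rdot d (P : 'M[C]_d) v : orthoproj P ->
  rdot v (P *m v) = nsq (P *m v).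
Proof. by case=> h1 h2; rewrite /nsq -{2}h1 rdot_adjmx mulmxA h2. Qed.

Lemma nsq_orthoproj d (P : 'M[C]_d) v : orthoproj P ->
  nsq v = nsq (P *m v) + nsq (v - P *m v).
Proof.
case=> h1 h2; set a := P *m v; set b := v - a.
have -> : v = a + b by rewrite /b addrC subrK.
rewrite nsqD [rdot _ _](_ : _ = 0) ?mulr0 ?addr0 //.
rewrite /rdot /a /b adjmxM h1 -mulmxA mulmxBr mulmxA h2 subrr mulmx0.
by rewrite mxE.
Qed.

Lemma nrm_orthoproj d (P : 'M[C]_d) v : orthoproj P -> nrm (P *m v) <= nrm v.
Proof.
move=> h; rewrite ler_sqrt ?nsq_ge0 // (nsq_orthoproj v h).
by rewrite lerDl nsq_ge0.
Qed.

Lemma reflection_unitary d (P : 'M[C]_d) : orthoproj P ->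
  (1%:M - 2 *: P) \is unitarymx.
Proof.
case=> h1 h2; apply/unitaryP_left.
rewrite adjmxB adjmx1 adjmxZ conjc_nat h1 mulmxBl mul1mx mulmxBr mulmx1.
rewrite -scalemxAl -scalemxAr h2 scalerA.
apply/matrixP => i j; rewrite !mxE; move: (P i j) ((i == j)%:R) => p q; ring.
Qed.

Lemma unitarymxN d (U : 'M[C]_d) : U \is unitarymx -> - U \is unitarymx.
Proof.
by move/unitaryP_left => h; apply/unitaryP_left; rewrite adjmxN mulNmx mulmxN opprK.
Qed.

End Norm.

(** * The trace norm *)

Section TraceNorm.
Variable R : realType.
Local Notation C := R[i].

Lemma sqrtC_real (x : R) : 0 <= x -> sqrtC (x ^+ 2)%:C = x%:C.
Proof. by move=> h; rewrite rmorphXn /= sqrCK // ler0c. Qed.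

Lemma vnormE d (v : 'cV[C]_d) : vnorm v = nrm v.
Proof. by rewrite /vnorm nsqE -sqr_nrm sqrtC_real // nrm_ge0. Qed.

Lemma pureD d (u v : 'cV[C]_d) :
  pure (u + v) = pure u + (u *m v^t* + v *m u^t* + v *m v^t*).
Proof.
rewrite /pure (adjmxD u v) mulmxDr (mulmxDl u v (u^t*)) (mulmxDl u v (v^t*)).
by move: (u *m u^t*) (v *m u^t*) (u *m v^t*) (v *m v^t*) => a b c e;
  rewrite -!addrA (addrCA b).
Qed.

Lemma pureZ d z (u : 'cV[C]_d) : pure (z *: u) = (z * conjc z) *: pure u.
Proof. by rewrite /pure (adjmxZ z u) -scalemxAl -scalemxAr scalerA. Qed.

Lemma mxtrace_pure d (v : 'cV[C]_d) : \tr (pure v) = (nsq v)%:C.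
Proof. by rewrite /pure mxtrace_mulC /mxtrace big_ord1 nsqE. Qed.

(* A polar decomposition of [M]: [E] is unitary, [F] is a partial isometry and
   [F^* M E] is the diagonal matrix of the singular values. *)
Lemma trace_norm_polar d (M : 'M[C]_d) : exists E F : 'M[C]_d,
  [/\ E \is unitarymx, orthoproj (F *m F^t*)
    & trace_norm M = complex.Re (\tr (F^t* *m M *m E))].
Proof.
set T := M^t* *m M.
have Tn : T \is normalmx.
  by apply/normalmxP; rewrite adjmxM trmxCK.
set P := spectralmx T; have Pu : P \is unitarymx by exact: spectral_unitarymx.
have Pi : invmx P = P^t* by exact: invmx_unitary.
pose E := P^t*.
have Eu : E \is unitarymx by rewrite trmxC_unitary.
have PE : P *m E = 1%:M by apply/unitarymxP.
set mu := spectral_diag T.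
have Td : E^t* *m T *m E = diag_mx mu.
  have /orthomx_spectralP -> := Tn; rewrite -/P Pi trmxCK -/mu.
  by rewrite !mulmxA PE mul1mx -mulmxA PE mulmx1.
pose m i := nrm (M *m col i E).
have muE i : mu 0 i = ((m i) ^+ 2)%:C.
  have -> : mu 0 i = (E^t* *m T *m E) i i by rewrite Td mxE eqxx mulr1n.
  rewrite /m sqr_nrm -nsqE.
  have -> : (M *m col i E)^t* *m (M *m col i E) = (col i E)^t* *m T *m col i E.
    by rewrite adjmxM /T !mulmxA.
  rewrite [LHS]mxE [RHS]mxE; apply: eq_bigr => j _; congr (_ * _).
    rewrite [LHS]mxE [RHS]mxE; apply: eq_bigr => k _; congr (_ * _).
    by rewrite [LHS]adjmxE [RHS]adjmxE [in RHS]mxE.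
  by rewrite [in RHS]mxE.
(* [m i] is the i-th singular value. The convention that 0 has inverse 0 annihilates the columns of
   [F] that belong to vanishing singular values, so [F] is a partial isometry without a case
   distinction. *)
pose nu := \row_i ((m i)^-1)%:C : 'rV[C]_d.
pose S := diag_mx nu.
have Sa : S^t* = S.
  rewrite tr_diag_mx map_diag_mx; congr diag_mx; apply/rowP => i.
  rewrite !mxE; exact: conjc_real.
pose F := M *m E *m S.
have FME : F^t* *m M *m E = S *m diag_mx mu.
  by rewrite /F !adjmxM Sa -Td -!mulmxA.
exists E, F; split=> //.
  split; first by rewrite adjmxM trmxCK.
  have FF : F *m (F^t* *m F) = F.
    have -> : F^t* *m F = S *m diag_mx mu *m S by rewrite -FME /F !mulmxA.
    rewrite /F -!mulmxA; congr (_ *m (_ *m _)).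
    rewrite /S !mulmx_diag; congr diag_mx; apply/rowP => i; rewrite !mxE muE.
    rewrite -!rmorphM /=; congr (_%:C).
    have [->|h] := eqVneq (m i) 0; first by rewrite invr0 mul0r.
    by field.
  by rewrite -mulmxA [F^t* *m _]mulmxA mulmxA FF.
rewrite FME /trace_norm /mxfun -/T -/P -/mu Pi.
rewrite -mulmxA mxtrace_mulC -mulmxA PE mulmx1 /S mulmx_diag !mxtrace_diag.
congr complex.Re; apply: eq_bigr => i _.
rewrite !mxE muE sqrtC_real ?nrm_ge0 // -rmorphM /=; congr (_%:C).
have [->|h] := eqVneq (m i) 0; first by rewrite invr0 mul0r.
by field.
Qed.

(** In the polar form the trace becomes a sum of inner products of F^* v_k with E^* w_k, and neither
    F^* nor E^* increases norms. *)
Lemma trace_norm_sum (I : Type) (r : seq I) d (v w : I -> 'cV[C]_d) :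
  trace_norm (\sum_(k <- r) v k *m (w k)^t*)
    <= \sum_(k <- r) nrm (v k) * nrm (w k).
Proof.
have [E [F [Eu Fp ->]]] := trace_norm_polar (\sum_(k <- r) v k *m (w k)^t*).
rewrite mulmx_sumr mulmx_suml (raddf_sum (@mxtrace _ _)) Re_sum; apply: ler_sum => k _.
have -> : complex.Re (\tr (F^t* *m (v k *m (w k)^t*) *m E))
    = rdot (E^t* *m w k) (F^t* *m v k).
  rewrite /rdot adjmxM trmxCK; congr complex.Re.
  have -> : F^t* *m (v k *m (w k)^t*) *m E = (F^t* *m v k) *m ((w k)^t* *m E).
    by rewrite !mulmxA.
  by rewrite mxtrace_mulC /mxtrace big_ord1.
apply: le_trans (ler_norm _) _; apply: le_trans (rdot_le _ _) _.
have Eu' : E^t* \is unitarymx by rewrite trmxC_unitary.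
rewrite (nrm_unitary _ Eu') mulrC; apply: ler_wpM2r; first exact: nrm_ge0.
rewrite ler_sqrt; last exact: nsq_ge0.
rewrite (nsq_orthoproj (v k) Fp).
have -> : nsq (F^t* *m v k) = nsq (F *m F^t* *m v k).
  by rewrite -(orthoproj_rdot _ Fp) -mulmxA -rdot_adjmx.
by rewrite lerDl nsq_ge0.
Qed.

Lemma ler_sum_CauchySchwarz (I : Type) (r : seq I) (x y : I -> R) :
  (forall i, 0 <= x i) -> (forall i, 0 <= y i) ->
  (\sum_(i <- r) x i * y i) ^+ 2
    <= (\sum_(i <- r) x i ^+ 2) * (\sum_(i <- r) y i ^+ 2).
Proof.
move=> x0 y0; elim: r => [|i r ih]; first by rewrite !big_nil expr0n mulr0.
rewrite !big_cons.
have h1 : 0 <= \sum_(j <- r) x j * y j by rewrite sumr_ge0 // => j _; rewrite mulr_ge0.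
have h2 : 0 <= \sum_(j <- r) x j ^+ 2 by rewrite sumr_ge0 // => j _; rewrite sqr_ge0.
have h3 : 0 <= \sum_(j <- r) y j ^+ 2 by rewrite sumr_ge0 // => j _; rewrite sqr_ge0.
move: (x0 i) (y0 i) ih h1 h2 h3; move: (x i) (y i) (\sum_(j <- r) x j * y j)
  (\sum_(j <- r) x j ^+ 2) (\sum_(j <- r) y j ^+ 2) => a b s p q a0 b0 ih s0 p0 q0.
have h : 2 * (a * b) * s <= a ^+ 2 * q + b ^+ 2 * p.
  have hs : s <= Num.sqrt p * Num.sqrt q.
    by rewrite -sqrtrM // -(ger0_norm s0) -sqrtr_sqr ler_sqrt // mulr_ge0.
  rewrite -(sqr_sqrtr p0) -(sqr_sqrtr q0).
  have := sqr_ge0 (a * Num.sqrt q - b * Num.sqrt p).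
  have : a * b * s <= a * b * (Num.sqrt p * Num.sqrt q) by rewrite ler_wpM2l ?mulr_ge0.
  move: (Num.sqrt p) (Num.sqrt q) => u t; nra.
nra.
Qed.

(** Split v_i = al_i psi + W_i. The parts along psi add up to (1 - B) |psi><psi| with B <= beta^2,
    the terms W_i W_i^* contribute B again, and by Cauchy-Schwarz each of the two families of cross
    terms contributes at most beta. Halving 2 B + 2 beta gives the bound. *)
Lemma trace_distance_pure (I : Type) (r : seq I) d (v : I -> 'cV[C]_d)
    (psi : 'cV[C]_d) (beta : R) :
  nsq psi = 1 -> \sum_(i <- r) nsq (v i) = 1 ->
  \sum_(i <- r) nsq (v i - pure psi *m v i) <= beta ^+ 2 -> 0 <= beta ->
  trace_distance (\sum_(i <- r) pure (v i)) (pure psi) <= beta ^+ 2 + beta.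
Proof.
move=> psi1 v1 hb b0.
have nrm1 : nrm psi = 1 by rewrite /nrm psi1 sqrtr1.
pose al i := (psi^t* *m v i) 0 0.
pose W i := v i - pure psi *m v i.
pose A i := complex.Re (al i) ^+ 2 + complex.Im (al i) ^+ 2.
have Pp : orthoproj (pure psi).
  split; first by rewrite /pure adjmxM trmxCK.
  rewrite /pure mulmxA -[psi *m _ *m psi]mulmxA [psi^t* *m psi]mx11_scalar nsqE.
  by rewrite psi1 mulmx1.
have vE i : v i = al i *: psi + W i.
  rewrite /W addrC /pure -mulmxA [psi^t* *m v i]mx11_scalar -/(al i).
  by rewrite mul_mx_scalar subrK.
have nsqv i : nsq (v i) = A i + nsq (W i).
  rewrite (nsq_orthoproj (v i) Pp) -/(W i); congr (_ + _).
  rewrite /pure -mulmxA [psi^t* *m v i]mx11_scalar -/(al i) mul_mx_scalar.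
  by rewrite nsqZc psi1 mulr1.
set B := \sum_(i <- r) nsq (W i) in hb.
have sA : \sum_(i <- r) A i = 1 - B.
  have : \sum_(i <- r) nsq (v i) = \sum_(i <- r) A i + B.
    by rewrite /B -big_split; apply: eq_bigr => i _; rewrite nsqv.
  by rewrite v1 => ->; rewrite addrK.
have alJ i : al i * conjc (al i) = (A i)%:C.
  by rewrite /A; case: (al i) => a c /=; apply/eqP; rewrite eq_complex /=; apply/andP; split; apply/eqP; ring.
pose u k i := nth 0 [:: al i *: psi; W i; W i] k.
pose u' k i := nth 0 [:: W i; al i *: psi; W i] k.
have pureE i : pure (v i) = (A i)%:C *: pure psi
   + (al i *: psi *m (W i)^t* + W i *m (al i *: psi)^t* + W i *m (W i)^t*).
  by rewrite [in LHS]vE pureD pureZ alJ.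
(* The difference as one sum of rank-one terms: [None] indexes the defect - B |psi><psi|, and
   [Some (i, k)] the three error terms of the i-th vector. *)
pose x (k : option (I * 'I_3)) := if k is Some (i, k) then u k i else (- B%:C) *: psi.
pose y (k : option (I * 'I_3)) := if k is Some (i, k) then u' k i else psi.
pose rr := None :: [seq Some (i, k) | i <- r, k <- enum 'I_3].
have E1 : \sum_(i <- r) pure (v i) - pure psi = \sum_(k <- rr) x k *m (y k)^t*.
  rewrite /rr big_cons big_allpairs_dep /= (eq_bigr _ (fun i _ => pureE i)).
  rewrite big_split /= -scaler_suml -rmorph_sum sA addrAC; congr (_ + _).
    rewrite -scalemxAl -/(pure psi) rmorphB scalerBl scale1r.
    by rewrite addrAC subrr add0r scaleNr.
  by apply: eq_bigr => i _; rewrite big_enum /= !big_ord_recl big_ord0 addr0 addrA.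
rewrite /trace_distance E1 ler_pdivrMr ?ltr0n //.
apply: le_trans (trace_norm_sum _ _ _) _.
rewrite /rr big_cons big_allpairs_dep /=.
have nal i : nrm (al i *: psi) = Num.sqrt (A i) by rewrite /nrm nsqZc psi1 mulr1.
have E2 : \sum_(i <- r) \sum_(k <- enum 'I_3) nrm (u k i) * nrm (u' k i)
   = 2 * (\sum_(i <- r) Num.sqrt (A i) * nrm (W i)) + B.
  rewrite mulr_sumr -big_split; apply: eq_bigr => i _ /=.
  rewrite big_enum /= !big_ord_recl big_ord0 /u /u' /= nal -sqr_nrm.
  by move: (Num.sqrt _) (nrm _) => p q; ring.
rewrite E2 nrm1 mulr1 scaleNr nrmN (nrmZ B) nrm1 mulr1.
have B0 : 0 <= B by apply: sumr_ge0 => i _; exact: nsq_ge0.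
rewrite (ger0_norm B0).
set X := \sum_(i <- r) _ * _.
have hX : X <= beta.
  rewrite -ler_sqr ?nnegrE //; last first.
    by rewrite sumr_ge0 // => i _; rewrite mulr_ge0 ?sqrtr_ge0.
  apply: le_trans (ler_sum_CauchySchwarz _ _ _) _ => [i|i|]; rewrite ?sqrtr_ge0 //.
  rewrite (eq_bigr A) => [|i _]; last first.
    by rewrite sqr_sqrtr // addr_ge0 ?sqr_ge0.
  rewrite [X in _ * X](eq_bigr (fun i => nsq (W i))) => [|i _]; last by rewrite sqr_nrm.
  by rewrite sA -/B; nra.
nra.
Qed.

End TraceNorm.

(** * Tensor slices and controlled operators *)

Section Tensor.
Variable R : realType.
Local Notation C := R[i].

Lemma sum_mxtens_index (T : nmodType) m d (F : 'I_(m * d) -> T) :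
  \sum_i F i = \sum_(j < m) \sum_(p < d) F (mxtens_index (j, p)).
Proof.
rewrite pair_big /= (reindex (@mxtens_index m d)) /=; last first.
  by exists (@mxtens_unindex m d) => i _; rewrite (mxtens_indexK, mxtens_unindexK).
by apply: eq_bigr => -[].
Qed.

Lemma adjmx_tens m n p q (A : 'M[C]_(m, n)) (B : 'M[C]_(p, q)) :
  (A *t B)^t* = A^t* *t B^t*.
Proof. by apply/matrixP => i j; rewrite !mxE rmorphM. Qed.

Lemma tensmx1 m d : (1%:M : 'M[C]_m) *t (1%:M : 'M[C]_d) = 1%:M.
Proof.
apply/matrixP => i j; case: (mxtens_indexP i) => i1 i2.
case: (mxtens_indexP j) => j1 j2; rewrite tensmxE !mxE -natrM mulnb.
by rewrite (can_eq (@mxtens_indexK m d)) xpair_eqE.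
Qed.

(** The component <k| (x) I of a vector of the tensor product. Controlled operators act on each
    slice separately, so identities between them are checked slicewise. *)
Definition slice m d e (k : 'I_m) (v : 'M[C]_(m * d, e)) : 'M[C]_(d, e) :=
  \matrix_(i, j) v (mxtens_index (k, i)) j.

Definition stack m d e (Y : 'I_m -> 'M[C]_(d, e)) : 'M[C]_(m * d, e) :=
  \matrix_(i, j) Y (mxtens_unindex i).1 (mxtens_unindex i).2 j.

Lemma stackK m d e (Y : 'I_m -> 'M[C]_(d, e)) k : slice k (stack Y) = Y k.
Proof. by apply/matrixP => i j; rewrite !mxE mxtens_indexK. Qed.

Lemma sliceP m d e (u v : 'M[C]_(m * d, e)) :
  (forall k, slice k u = slice k v) -> u = v.
Proof.
move=> h; apply/matrixP => i j; case: (mxtens_indexP i) => k p.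
by have /matrixP/(_ p j) := h k; rewrite !mxE.
Qed.

Lemma sliceM m d e f (k : 'I_m) (M : 'M[C]_(m * d, e)) (N : 'M[C]_(e, f)) :
  slice k (M *m N) = slice k M *m N.
Proof. by apply/matrixP => i j; rewrite !mxE; apply: eq_bigr => l _; rewrite !mxE. Qed.

Lemma slice_tens m d e (k : 'I_m) (A : 'M[C]_m) (B : 'M[C]_d)
    (v : 'M[C]_(m * d, e)) :
  slice k ((A *t B) *m v) = \sum_l A k l *: (B *m slice l v).
Proof.
apply/matrixP => i j; rewrite summxE !mxE sum_mxtens_index.
apply: eq_bigr => l _; rewrite !mxE mulr_sumr; apply: eq_bigr => p _.
by rewrite tensmxE !mxE mulrA.
Qed.

Lemma adjmx_mul_slice m d e f (u : 'M[C]_(m * d, e)) (v : 'M[C]_(m * d, f)) :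
  u^t* *m v = \sum_k (slice k u)^t* *m slice k v.
Proof.
apply/matrixP => i j; rewrite summxE !mxE sum_mxtens_index.
apply: eq_bigr => k _; rewrite !mxE; apply: eq_bigr => p _.
by rewrite !mxE.
Qed.

Lemma nsq_slice m d (v : 'cV[C]_(m * d)) : nsq v = \sum_k nsq (slice k v).
Proof. by rewrite /nsq /rdot adjmx_mul_slice summxE Re_sum. Qed.

Lemma sliceB m d e (k : 'I_m) (u v : 'M[C]_(m * d, e)) :
  slice k (u - v) = slice k u - slice k v.
Proof. by apply/matrixP => i j; rewrite !mxE. Qed.

Lemma slice_sum (I : Type) (r : seq I) (P : pred I) m d e (k : 'I_m)
    (F : I -> 'M[C]_(m * d, e)) :
  slice k (\sum_(i <- r | P i) F i) = \sum_(i <- r | P i) slice k (F i).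
Proof.
by apply/matrixP => i j; rewrite mxE !summxE; apply: eq_bigr => x _; rewrite mxE.
Qed.

Lemma slice_id_tens m d e (k : 'I_m) (B : 'M[C]_d) (v : 'M[C]_(m * d, e)) :
  slice k ((1%:M *t B) *m v) = B *m slice k v.
Proof.
rewrite slice_tens (bigD1 k) //= big1 => [|l /negPf h]; last first.
  by rewrite mxE eq_sym h scale0r.
by rewrite mxE eqxx scale1r addr0.
Qed.

Lemma ptrace_pure m d (v : 'cV[C]_(m * d)) :
  ptrace (pure v) = \sum_k pure (slice k v).
Proof.
apply/matrixP => i j; rewrite summxE mxE; apply: eq_bigr => k _.
by rewrite !mxE !big_ord1 !mxE.
Qed.

Lemma ptrace_sum (I : Type) (r : seq I) m d (F : I -> 'M[C]_(m * d)) :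
  ptrace (\sum_(x <- r) F x) = \sum_(x <- r) ptrace (F x).
Proof.
apply/matrixP => i j; rewrite !mxE summxE.
rewrite (eq_bigr (fun k => \sum_(x <- r) F x (mxtens_index (k, i)) (mxtens_index (k, j)))).
  by rewrite exchange_big; apply: eq_bigr => x _; rewrite mxE.
by move=> k _; rewrite summxE.
Qed.

(** * Operators controlled by the work register *)

Section Select.
Variables w b n : nat.
Implicit Types f g : 'I_(2 ^ w) -> 'M[C]_(2 ^ b * 2 ^ n).

Lemma eq_select f g : f =1 g -> select f = select g.
Proof. by move=> h; apply: eq_bigr => j _; rewrite h. Qed.

Lemma slice_select e f k (v : 'M[C]_(_, e)) :
  slice k (select f *m v) = f k *m slice k v.
Proof.
rewrite /select mulmx_suml slice_sum (bigD1 k) //= big1 ?addr0 => [|i /negPf ik].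
  rewrite slice_tens (bigD1 k) //= big1 ?addr0 => [|l /negPf lk].
    by rewrite mxE !eqxx scale1r.
  by rewrite mxE eqxx lk scale0r.
by rewrite slice_tens big1 // => l _; rewrite mxE eq_sym ik scale0r.
Qed.

Lemma selectP f (M : operator R w b n) :
  (forall k, slice k M = f k *m slice k 1%:M) -> M = select f.
Proof. by move=> h; apply: sliceP => k; rewrite h -slice_select mulmx1. Qed.

Lemma select1 : select (fun=> 1%:M) = 1%:M :> operator R w b n.
Proof. by symmetry; apply: selectP => k; rewrite mul1mx. Qed.

Lemma selectM f g : select f *m select g = select (fun j => f j *m g j).
Proof. by apply: selectP => k; rewrite slice_select -[select g]mulmx1 slice_select mulmxA. Qed.

Lemma adjmx_select f : (select f)^t* = select (fun j => (f j)^t*).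
Proof.
rewrite /select adjmx_sum; apply: eq_bigr => j _; rewrite adjmx_tens.
by congr (_ *t _); apply/matrixP => p q; rewrite !mxE andbC rmorph_nat.
Qed.

Lemma select_unitary f : (forall j, f j \is unitarymx) -> select f \is unitarymx.
Proof.
move=> h; apply/unitarymxP; rewrite adjmx_select selectM -select1.
by apply: eq_select => j; apply/unitarymxP.
Qed.

Lemma select_orthoproj f : (forall j, orthoproj (f j)) -> orthoproj (select f).
Proof.
move=> h; split; first by rewrite adjmx_select; apply: eq_select => j; case: (h j).
by rewrite selectM; apply: eq_select => j; case: (h j).
Qed.

Lemma orthoproj1 d : orthoproj (1%:M : 'M[C]_d).
Proof. by split; rewrite ?adjmx1 ?mulmx1. Qed.

Lemma orthoproj0 d : orthoproj (0 : 'M[C]_d).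
Proof. by split; rewrite ?mulmx0 // linear0 map_mx0. Qed.

Lemma meas_proj_orthoproj q x : orthoproj (meas_proj R b n q x : operator R w b n).
Proof.
apply: select_orthoproj => j; case: ifP => _; [exact: orthoproj1|exact: orthoproj0].
Qed.

Lemma meas_proj_negb q x :
  meas_proj R b n q (~~ x) = 1%:M - meas_proj R b n q x :> operator R w b n.
Proof.
apply: sliceP => k; rewrite sliceB -[meas_proj _ _ _ _ _]mulmx1.
rewrite -[in X in _ - X](mulmx1 (meas_proj R b n q x)) !slice_select.
by case: (qubit q k); case: x; rewrite /= !(mul1mx, mul0mx) ?subrr ?subr0.
Qed.

Lemma nsq_meas q (v : 'cV[C]_(2 ^ w * (2 ^ b * 2 ^ n))) :
  nsq v = nsq (meas_proj R b n q false *m v) + nsq (meas_proj R b n q true *m v).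
Proof.
rewrite (nsq_orthoproj v (meas_proj_orthoproj q false)).
by rewrite (meas_proj_negb q false) mulmxBl mul1mx.
Qed.

Lemma call_op_unitary (V : 'M[C]_(2 ^ b * 2 ^ n)) inv (ctrl : option 'I_w) :
  V \is unitarymx -> call_op V inv ctrl \is unitarymx.
Proof.
move=> h; apply: select_unitary => j.
have h1 : (1%:M : 'M[C]_(2 ^ b * 2 ^ n)) \is unitarymx.
  by apply/unitarymxP; rewrite mul1mx adjmx1.
have h2 : (if inv then V^t* else V) \is unitarymx.
  by case: inv; [rewrite trmxC_unitary; exact: h | exact: h].
case: ctrl => [q|]; last exact: h2.
by case: ifP => _; [exact: h2 | exact: h1].
Qed.

Lemma call_op_adj (V : 'M[C]_(2 ^ b * 2 ^ n)) (ctrl : option 'I_w) :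
  call_op V true ctrl = (call_op V false ctrl)^t* :> operator R w b n.
Proof.
rewrite /call_op adjmx_select; apply: eq_select => j.
case: ctrl => [q|]; last by [].
by case: ifP => _; last rewrite adjmx1.
Qed.

End Select.

(** * Unitary evolution *)

Section Evolution.
Variables (d : nat) (H : 'M[C]_d).

Lemma evolution_unitary t : evolution H t \is unitarymx.
Proof.
have Pu := spectral_unitarymx H; rewrite /evolution /mxfun (invmx_unitary Pu).
apply: mul_unitarymx; last exact: Pu.
apply: mul_unitarymx; first by rewrite trmxC_unitary.
apply/unitarymxP; rewrite tr_diag_mx map_diag_mx mulmx_diag.
apply/matrixP => i j; rewrite !mxE; congr (_ *+ _).
set x := _ * t; apply/eqP; rewrite eq_complex /=; apply/andP; split; apply/eqP.
  by rewrite mulrN opprK -!expr2 cos2Dsin2.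
by rewrite mulrN mulrC addNr.
Qed.

Lemma evolutionN t : evolution H (- t) = (evolution H t)^t*.
Proof.
have Pu := spectral_unitarymx H; rewrite /evolution /mxfun (invmx_unitary Pu).
set P := spectralmx H; set D := diag_mx _; set D' := diag_mx _.
rewrite (adjmxM (P^t* *m D')) (adjmxM (P^t*) D') trmxCK mulmxA.
suff -> : D = D'^t* by [].
rewrite /D' tr_diag_mx map_diag_mx; congr diag_mx.
apply/rowP => i; rewrite !mxE mulrN cosN sinN.
by apply/eqP; rewrite eq_complex /= !eqxx.
Qed.

(** The diagonalization chosen by [spectralmx] need not have v among its vectors; but wherever v has
    a nonzero coordinate, the diagonal entry there must equal x. *)
Lemma evolution_eigen (v : 'cV[C]_d) (x t : R) : H \is normalmx ->
  H *m v = x%:C *: v -> evolution H t *m v = (cos (x * t) +i* sin (x * t)) *: v.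
Proof.
move=> Hn hv; have Pu := spectral_unitarymx H.
have PP : spectralmx H *m (spectralmx H)^t* = 1%:M by apply/unitarymxP.
have PP' := mulmx1C PP.
rewrite /evolution /mxfun (invmx_unitary Pu).
set P := spectralmx H in PP PP' *; set D := spectral_diag H.
pose c := P *m v.
have hc i : D 0 i * c i 0 = x%:C * c i 0.
  have : P *m (H *m v) = x%:C *: c by rewrite hv -scalemxAr.
  have /orthomx_spectralP -> := Hn.
  rewrite (invmx_unitary Pu) -/P -/D !mulmxA PP mul1mx -mulmxA -/c.
  by move=> /matrixP/(_ i 0); rewrite mul_diag_mx !mxE.
have vE : v = P^t* *m c by rewrite /c mulmxA PP' mul1mx.
rewrite [in RHS]vE -!mulmxA -/c scalemxAr; congr (_ *m _).
clear vE; move: c hc => c hc.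
apply/colP => i; rewrite mul_diag_mx !mxE.
have [->|ci] := eqVneq (c i 0) 0; first by rewrite !mulr0.
by have /(mulIf ci) -> := hc i.
Qed.

End Evolution.

Lemma heisenberg_op_unitary w b n (H : 'M[C]_(2 ^ n))
    (V : 'M[C]_(2 ^ b * 2 ^ n)) t0 k inv (ctrl : option 'I_w) :
  V \is unitarymx -> heisenberg_op H V t0 k inv ctrl \is unitarymx.
Proof.
move=> h; have hE fwd : evolution_op w b H t0 k fwd \is unitarymx.
  apply: select_unitary => j; apply/unitarymxP.
  rewrite adjmx_tens adjmx1 tensmx_mul mul1mx.
  by rewrite (unitarymxP (evolution_unitary H _)) tensmx1.
apply: mul_unitarymx; last exact: hE.
by apply: mul_unitarymx; [exact: hE | exact: call_op_unitary].
Qed.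

Lemma heisenberg_op_adj w b n (H : 'M[C]_(2 ^ n))
    (V : 'M[C]_(2 ^ b * 2 ^ n)) t0 k (ctrl : option 'I_w) :
  heisenberg_op H V t0 k true ctrl = (heisenberg_op H V t0 k false ctrl)^t*.
Proof.
have hE fwd : (evolution_op w b H t0 k fwd)^t* = evolution_op w b H t0 k (~~ fwd).
  rewrite /evolution_op adjmx_select; apply: eq_select => j.
  set t := grid_time _ _ _.
  have -> : (if ~~ fwd then t else - t) = - (if fwd then t else - t).
    by case: fwd; rewrite ?opprK.
  by rewrite evolutionN adjmx_tens adjmx1.
rewrite /heisenberg_op call_op_adj.
have := hE false; have := hE true; rewrite /=.
move: (evolution_op w b H t0 k true) (evolution_op w b H t0 k false) => A B hA hB.
move: (call_op V false ctrl) => U.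
by rewrite (adjmxM (A *m U) B) (adjmxM A U) hA hB mulmxA.
Qed.

End Tensor.

(** * Leaves of a circuit and their failure weight *)

(** The triangle inequality in the plane; it lets a seminorm pass through a two-outcome
    measurement. *)
Lemma minkowski2 (R : rcfType) (a1 a2 b1 b2 : R) :
  0 <= a1 -> 0 <= a2 -> 0 <= b1 -> 0 <= b2 ->
  Num.sqrt ((a1 + b1) ^+ 2 + (a2 + b2) ^+ 2)
    <= Num.sqrt (a1 ^+ 2 + a2 ^+ 2) + Num.sqrt (b1 ^+ 2 + b2 ^+ 2).
Proof.
move=> ha1 ha2 hb1 hb2.
have hp : 0 <= a1 ^+ 2 + a2 ^+ 2 by rewrite addr_ge0 ?sqr_ge0.
have hq : 0 <= b1 ^+ 2 + b2 ^+ 2 by rewrite addr_ge0 ?sqr_ge0.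
rewrite -ler_sqr ?nnegrE ?addr_ge0 ?sqrtr_ge0 //.
rewrite sqr_sqrtr ?addr_ge0 ?sqr_ge0 // [leRHS]sqrrD !sqr_sqrtr // -sqrtrM //.
have h : a1 * b1 + a2 * b2
    <= Num.sqrt ((a1 ^+ 2 + a2 ^+ 2) * (b1 ^+ 2 + b2 ^+ 2)).
  have h0 : 0 <= a1 * b1 + a2 * b2 by rewrite addr_ge0 ?mulr_ge0.
  rewrite -(ger0_norm h0) -sqrtr_sqr ler_sqrt ?mulr_ge0 //.
  have := sqr_ge0 (a1 * b2 - a2 * b1); nra.
move: (Num.sqrt _) h => s h; nra.
Qed.

Section Runs.
Variable R : realType.
Local Notation C := R[i].

Lemma pure_orthoproj d (psi : 'cV[C]_d) : nsq psi = 1 -> orthoproj (pure psi).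
Proof.
move=> psi1; split; first by rewrite /pure adjmxM trmxCK.
rewrite /pure mulmxA -[psi *m _ *m psi]mulmxA [psi^t* *m psi]mx11_scalar nsqE.
by rewrite psi1 mulmx1.
Qed.

Lemma tens_orthoproj m d (P : 'M[C]_d) : orthoproj P ->
  orthoproj ((1%:M : 'M[C]_m) *t P).
Proof.
case=> h1 h2; split; first by rewrite adjmx_tens adjmx1 h1.
by rewrite tensmx_mul mul1mx h2.
Qed.

Lemma pure_mul d e (U : 'M[C]_(e, d)) (v : 'cV[C]_d) :
  pure (U *m v) = U *m pure v *m U^t*.
Proof. by rewrite /pure (adjmxM U v) !mulmxA. Qed.

Variables w b n : nat.
Variables (H : 'M[C]_(2 ^ n)) (V : 'M[C]_(2 ^ b * 2 ^ n)) (psi : 'cV[C]_(2 ^ n)).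
Variable good : pred R.
Hypotheses (psi1 : nsq psi = 1) (Vu : V \is unitarymx).
Local Notation vec := 'cV[C]_(2 ^ w * (2 ^ b * 2 ^ n)).
Implicit Types (p : protocol R w b n) (v : vec).

(** Gates and outcomes keep pure states pure, so [run] can be followed on unnormalized vectors, on
    which errors are additive. *)
Fixpoint leaves p v : seq (R * vec) :=
  match p with
  | Output a => [:: (a, v)]
  | Gate U _ p' => leaves p' (U *m v)
  | Measure q f => leaves (f false) (meas_proj R b n q false *m v)
                     ++ leaves (f true) (meas_proj R b n q true *m v)
  | Call inv ctrl p' => leaves p' (call_op V inv ctrl *m v)
  | Heisenberg t0 k _ _ inv ctrl p' =>
      leaves p' (heisenberg_op H V t0 k inv ctrl *m v)
  end.

Lemma run_pure p v :
  run H V p (pure v) = [seq (x.1, pure x.2) | x <- leaves p v].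
Proof.
elim: p v => [a|U uU p IH|q f IH|inv ctrl p IH|t0 k h1 h2 inv ctrl p IH] v //=;
  by rewrite ?map_cat -!pure_mul !IH.
Qed.

Lemma leaves_nsq p v : \sum_(x <- leaves p v) nsq x.2 = nsq v.
Proof.
elim: p v => [a|U uU p IH|q f IH|inv ctrl p IH|t0 k h1 h2 inv ctrl p IH] v /=.
- by rewrite big_seq1.
- by rewrite IH (nsq_unitary _ uU).
- by rewrite big_cat /= !IH -nsq_meas.
- by rewrite IH (nsq_unitary _ (call_op_unitary _ _ Vu)).
- by rewrite IH (nsq_unitary _ (heisenberg_op_unitary _ _ _ _ _ Vu)).
Qed.

Definition sysproj : operator R w b n := select (fun=> 1%:M *t pure psi).

Lemma sysproj_orthoproj : orthoproj sysproj.
Proof.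
by apply: select_orthoproj => j; apply: tens_orthoproj; exact: pure_orthoproj.
Qed.

(** Charging both kinds of failure at once lets a single quantity control the output probability and
    the final system state. *)
Definition leaf_failure (a : R) v : R :=
  if good a then nsq (v - sysproj *m v) else nsq v.

Definition failure p v : R := \sum_(x <- leaves p v) leaf_failure x.1 x.2.

Definition failure_norm p v : R := Num.sqrt (failure p v).

Lemma leaf_failure_ge0 a v : 0 <= leaf_failure a v.
Proof. by rewrite /leaf_failure; case: ifP => _; exact: nsq_ge0. Qed.

Lemma failure_ge0 p v : 0 <= failure p v.
Proof. by apply: sumr_ge0 => x _; exact: leaf_failure_ge0. Qed.

Lemma sqr_failure_norm p v : failure_norm p v ^+ 2 = failure p v.
Proof. by rewrite sqr_sqrtr // failure_ge0. Qed.

Lemma failure_output a v : failure (Output _ _ _ a) v = leaf_failure a v.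
Proof. by rewrite /failure big_seq1. Qed.

Lemma failure_measure q f v : failure (Measure q f) v
  = failure (f false) (meas_proj R b n q false *m v)
    + failure (f true) (meas_proj R b n q true *m v).
Proof. by rewrite /failure /= big_cat. Qed.

Lemma nrm_sysprojC v : nsq (v - sysproj *m v) <= nsq v.
Proof.
by rewrite [leRHS](nsq_orthoproj v sysproj_orthoproj) lerDr nsq_ge0.
Qed.

Lemma failure_le p v : failure p v <= nsq v.
Proof.
rewrite -(leaves_nsq p); apply: ler_sum => x _.
by rewrite /leaf_failure; case: ifP => _; [exact: nrm_sysprojC | exact: lexx].
Qed.

Lemma failure_norm_ge0 p v : 0 <= failure_norm p v.
Proof. exact: sqrtr_ge0. Qed.

Lemma failure_norm_le p v : failure_norm p v <= nrm v.
Proof. by rewrite ler_sqrt ?nsq_ge0 // failure_le. Qed.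

(** By induction on the circuit: at a leaf it is the norm of a vector or of its projection,
    unitaries are linear, and a measurement combines its branches in the Euclidean way. *)
Lemma failure_normD p u v :
  failure_norm p (u + v) <= failure_norm p u + failure_norm p v.
Proof.
elim: p u v => [a|U uU p IH|q f IH|inv ctrl p IH|t0 k h1 h2 inv ctrl p IH] u v;
  rewrite /failure_norm; last 1 first.
- by move: (IH (heisenberg_op H V t0 k inv ctrl *m u)
    (heisenberg_op H V t0 k inv ctrl *m v)); rewrite -mulmxDr.
- rewrite !failure_output /leaf_failure; case: (good a); last exact: nrmD.
  by rewrite mulmxDr opprD addrACA; exact: nrmD.
- by move: (IH (U *m u) (U *m v)); rewrite -mulmxDr.
- rewrite !failure_measure -!sqr_failure_norm !mulmxDr.
  apply: le_trans (minkowski2 _ _ _ _); try exact: failure_norm_ge0.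
  rewrite ler_sqrt ?addr_ge0 ?sqr_ge0 //; apply: lerD;
    by rewrite ler_sqr ?nnegrE ?addr_ge0 ?failure_norm_ge0 ?IH.
- by move: (IH (call_op V inv ctrl *m u) (call_op V inv ctrl *m v)); rewrite -mulmxDr.
Qed.

Lemma failure_normZ p (c : R) v : failure_norm p (c%:C *: v) = `|c| * failure_norm p v.
Proof.
rewrite /failure_norm; suff -> : failure p (c%:C *: v) = c ^+ 2 * failure p v.
  by rewrite sqrtrM ?sqr_ge0 // sqrtr_sqr.
elim: p v => [a|U uU p IH|q f IH|inv ctrl p IH|t0 k h1 h2 inv ctrl p IH] v.
- rewrite !failure_output /leaf_failure; case: (good a); last exact: nsqZ.
  by rewrite -scalemxAr -scalerBr nsqZ.
- by move: (IH (U *m v)); rewrite scalemxAr.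
- by rewrite !failure_measure -!scalemxAr !IH mulrDr.
- by move: (IH (call_op V inv ctrl *m v)); rewrite scalemxAr.
- by move: (IH (heisenberg_op H V t0 k inv ctrl *m v)); rewrite scalemxAr.
Qed.

Lemma nsq_sysprojC v : nsq (v - sysproj *m v)
  = \sum_k \sum_l nsq (slice l (slice k v) - pure psi *m slice l (slice k v)).
Proof.
rewrite nsq_slice; apply: eq_bigr => k _; rewrite nsq_slice; apply: eq_bigr => l _.
by rewrite sliceB slice_select sliceB slice_id_tens.
Qed.

Lemma output_probability_ge p v : nsq v = 1 ->
  1 - failure p v <= \sum_(x <- run H V p (pure v) | good x.1) complex.Re (\tr x.2).
Proof.
move=> v1; rewrite run_pure big_map /=.
rewrite (eq_bigr (fun x : R * vec => nsq x.2)); last first.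
  by move=> x _; rewrite mxtrace_pure.
have := leaves_nsq p v; rewrite v1 (bigID (fun x : R * vec => good x.1)) /= => h.
suff hf : \sum_(x <- leaves p v | ~~ good x.1) nsq x.2 <= failure p v.
  by rewrite lerBlDr -[X in X <= _]h lerD2l.
rewrite /failure [leRHS](bigID (fun x : R * vec => good x.1)) /=.
rewrite -[X in X <= _]add0r; apply: lerD.
  by apply: sumr_ge0 => x _; exact: leaf_failure_ge0.
by apply: ler_sum => x /negPf hx; rewrite /leaf_failure hx.
Qed.

Lemma trace_distance_run p v (beta : R) : nsq v = 1 -> 0 <= beta ->
  failure_norm p v <= beta ->
  trace_distance (\sum_(x <- run H V p (pure v)) ptrace (ptrace x.2)) (pure psi)
    <= beta ^+ 2 + beta.
Proof.
move=> v1 b0 hb.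
(* Tracing out both ancilla factors of a pure state yields the mixture of its slices, so a leaf
   together with an ancilla basis state indexes a pure component. *)
pose rr := [seq (x, kl) | x <- leaves p v, kl <- enum {: 'I_(2 ^ w) * 'I_(2 ^ b)}].
pose u (y : (R * vec) * ('I_(2 ^ w) * 'I_(2 ^ b))) := slice y.2.2 (slice y.2.1 y.1.2).
have sumE (F : _ -> R) : \sum_(y <- rr) F (u y)
    = \sum_(x <- leaves p v) \sum_k \sum_l F (slice l (slice k x.2)).
  rewrite /rr big_allpairs; apply: eq_bigr => x _.
  by rewrite big_enum /= pair_big.
have -> : \sum_(x <- run H V p (pure v)) ptrace (ptrace x.2) = \sum_(y <- rr) pure (u y).
  rewrite run_pure big_map /= /rr big_allpairs; apply: eq_bigr => x _.
  rewrite ptrace_pure ptrace_sum big_enum /= -(pair_big xpredT xpredT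
    (fun k l => pure (slice l (slice k x.2)))) /=.
  by apply: eq_bigr => k _; rewrite ptrace_pure.
apply: trace_distance_pure => //.
  rewrite (sumE (@nsq R _)) -v1 -(leaves_nsq p); apply: eq_bigr => x _.
  by rewrite nsq_slice; apply: eq_bigr => k _; rewrite nsq_slice.
rewrite (sumE (fun z => nsq (z - pure psi *m z))).
apply: (@le_trans _ _ (failure p v)); last first.
  by rewrite -sqr_failure_norm ler_sqr ?nnegrE // failure_norm_ge0.
apply: ler_sum => x _; rewrite -nsq_sysprojC /leaf_failure.
by case: ifP => _; [exact: lexx | exact: nrm_sysprojC].
Qed.

End Runs.

(** * Rotation angles *)

Section Trigonometry.
Variable R : realType.
Implicit Types a x y : R.

Lemma sin_mvt x y : x <= y -> exists2 c, x <= c <= y & sin y - sin x = cos c * (y - x).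
Proof.
move=> xy; have [|c] := @MVT_segment R sin cos x y xy (fun z _ => is_derive_sin z).
  exact/continuous_subspaceT/continuous_sin.
by rewrite in_itv /= => h1 h2; exists c.
Qed.

Lemma sin_lipschitz x y : x <= y -> sin y - sin x <= y - x.
Proof.
move=> xy; have [c _ ->] := sin_mvt xy.
by rewrite ler_piMl ?subr_ge0 // cos_le1.
Qed.

Lemma sin_le_id x : 0 <= x -> sin x <= x.
Proof. by move=> /sin_lipschitz; rewrite sin0 !subr0. Qed.

Lemma cos_ge_quadratic x : 1 - x ^+ 2 / 2 <= cos x.
Proof.
wlog x0 : x / 0 <= x => [h|].
  have [/h//|/ltW x0] := leP 0 x.
  by rewrite -cosN -sqrrN; apply: h; rewrite oppr_ge0.
have h0 : 0 <= x / 2 by rewrite divr_ge0.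
have -> : cos x = cos (x / 2 *+ 2) by congr cos; rewrite -mulr_natr; lra.
rewrite cos_mulr2n cos2sin2.
have h1 := sin_le_id h0.
have h2 : - (x / 2) <= sin (x / 2).
  have [c _] := sin_mvt h0; rewrite sin0 !subr0 => ->.
  by have := cos_geN1 c; move: (cos c) => t; nra.
have : sin (x / 2) ^+ 2 <= (x / 2) ^+ 2 by move: (sin (x/2)) h1 h2 => s; nra.
move: (sin (x/2) ^+ 2) => s h; nra.
Qed.

Lemma sin_ge_cubic x : 0 <= x -> x * (1 - x ^+ 2 / 2) <= sin x.
Proof.
move=> x0; have [c /andP[c0 cx]] := sin_mvt x0; rewrite sin0 !subr0 => ->.
rewrite mulrC; apply: ler_wpM2r => //; apply: le_trans (cos_ge_quadratic c).
rewrite lerD2l lerN2 ler_pM2r ?invr_gt0 ?ltr0n // ler_sqr ?nnegrE //.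
Qed.

(** The lower bound 1 - c^2 / 2 of cosine is still positive at 11/10. *)
Lemma ler_sin_angle x y : 0 <= x -> x <= y -> y <= 11 / 10 -> sin x <= sin y.
Proof.
move=> x0 xy y1; have [c /andP[c0 cx] h] := sin_mvt xy.
rewrite -subr_ge0 h mulr_ge0 ?subr_ge0 //.
by apply: le_trans (cos_ge_quadratic c); nra.
Qed.

Lemma asin_small x : 0 <= x <= 4^-1 -> [/\ sin (asin x) = x,
  x <= asin x <= 16 / 15 * x & 3 / 4 <= cos (asin x)].
Proof.
move=> /andP[x0 x1].
have xI : x \in `[(-1), 1] by rewrite in_itv /=; apply/andP; split; lra.
have xI' : -1 <= x <= 1 by apply/andP; split; lra.
have s := asinK xI; split => //; last first.
  rewrite cos_asin // -[3 / 4](@ger0_norm R) ?divr_ge0 // -sqrtr_sqr ler_sqrt; nra.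
have p2 := @pihalf_lt2 R; have p1 := @pihalf_ge1 R.
have h1 := asin_geNpi2 xI'; have h2 := asin_lepi2 xI'.
have h0 : 0 <= asin x.
  rewrite leNgt; apply/negP => h.
  have := @sin2_gt0 R (- asin x); rewrite sinN s => h3.
  have : 0 < - x by apply: h3; apply/andP; split; lra.
  lra.
apply/andP; split; first by rewrite -[leLHS]s sin_le_id.
(* If asin x exceeded 16 x / 15, then sin (16 x / 15) < x, against the cubic lower bound of sine,
   which is at least x here because x <= 1/4. *)
rewrite leNgt; apply/negP => h.
have : sin (16 / 15 * x) < sin (asin x).
  by rewrite ltr_sin // in_itv /=; apply/andP; split; lra.
have h3 := @sin_ge_cubic (16 / 15 * x) ltac:(lra).
rewrite s; nra.
Qed.

(** Sine is 1-Lipschitz, so its inverse expands distances. *)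
Lemma asin_gap x y : 0 <= x -> x <= y -> y <= 4^-1 -> y - x <= asin y - asin x.
Proof.
move=> x0 xy y1.
have [sx /andP[x2 x3] _] := @asin_small x ltac:(apply/andP; split; lra).
have [sy /andP[y2 y3] _] := @asin_small y ltac:(apply/andP; split; lra).
have h : asin x <= asin y.
  rewrite leNgt; apply/negP => h.
  have p1 := @pihalf_ge1 R.
  have : sin (asin y) < sin (asin x).
    by rewrite ltr_sin // in_itv /=; apply/andP; split; lra.
  rewrite sx sy; lra.
by have := sin_lipschitz h; rewrite sx sy.
Qed.

Definition flip_prob (k x : R) : R := sin (k * (2 * asin x)) ^+ 2.

Section FlipProb.
Variables r k : R.
Hypothesis hrk : [/\ 0 < r, r <= 2, 0 <= k, 8 / 3 <= k * r & k * r <= 4].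

(** With 8/3 <= k r <= 4 the lower end is (8/3) / 8, and the upper end is 4 / 4 times the factor
    16/15 from [asin_small]. *)
Lemma flip_angle x : r / 16 <= x <= r / 8 ->
  3^-1 <= k * (2 * asin x) <= 16 / 15.
Proof.
have [r0 r2 k0 K1 K2] := hrk; move=> /andP[x1 x2].
have hx : 0 <= x <= 4^-1.
  by apply/andP; split; lra.
have [_ /andP[x3 x4] _] := asin_small hx.
apply/andP; split.
  have : k * (2 * (r / 16)) <= k * (2 * asin x) by apply: ler_wpM2l => //; lra.
  lra.
have : k * (2 * asin x) <= k * (2 * (16 / 15 * (r / 8))).
  by apply: ler_wpM2l => //; lra.
lra.
Qed.

Lemma flip_angle_gap x y : r / 16 <= x -> x <= y -> y <= r / 8 ->
  k * (2 * (y - x)) <= k * (2 * asin y) - k * (2 * asin x).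
Proof.
have [r0 r2 k0 K1 K2] := hrk; move=> x1 xy y2; rewrite -mulrBr -mulrBr ler_wpM2l // ler_wpM2l //.
apply: asin_gap => //; lra.
Qed.

Lemma flip_sin_ge x : r / 16 <= x <= r / 8 ->
  31 / 100 <= sin (k * (2 * asin x)).
Proof.
move=> /flip_angle/andP[h1 h2].
apply: (@le_trans _ _ (sin 3^-1)); last by apply: ler_sin_angle => //; lra.
apply: le_trans (sin_ge_cubic _); [|by rewrite invr_ge0]; lra.
Qed.

Lemma flip_prob_ge x : r / 16 <= x <= r / 8 -> 9 / 100 <= flip_prob k x.
Proof.
by move=> /flip_sin_ge; rewrite /flip_prob; move: (sin _) => s h; nra.
Qed.

Lemma flip_prob_le1 x : flip_prob k x <= 1.
Proof.
rewrite /flip_prob; have := sin_le1 (k * (2 * asin x)).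
have := sin_geN1 (k * (2 * asin x)); move: (sin _) => s; nra.
Qed.

Lemma flip_prob_mono x y : r / 16 <= x -> x <= y -> y <= r / 8 ->
  flip_prob k x <= flip_prob k y.
Proof.
have [r0 r2 k0 K1 K2] := hrk; move=> x1 xy y2.
have hx : r / 16 <= x <= r / 8 by apply/andP; split; lra.
have hy : r / 16 <= y <= r / 8 by apply/andP; split; lra.
have sx := flip_sin_ge hx.
have /andP[ax1 ax2] := flip_angle hx; have /andP[ay1 ay2] := flip_angle hy.
have h : k * (2 * asin x) <= k * (2 * asin y).
  have := flip_angle_gap x1 xy y2.
  have : 0 <= k * (2 * (y - x)) by rewrite !mulr_ge0 // subr_ge0.
  lra.
have : sin (k * (2 * asin x)) <= sin (k * (2 * asin y)).
  by apply: ler_sin_angle => //; lra.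
rewrite /flip_prob; move: (sin _) (sin _) sx => s t sx st; nra.
Qed.

(** The two angles differ by at least k r / 24 >= 1/9. Cosine is at least 2/5 between them, so the
    sines differ by 2/45, and each sine is at least 31/100; the product of the difference and the
    sum of the sines exceeds 1/40. *)
Lemma flip_prob_gap : 40^-1 <= flip_prob k (5 * r / 48) - flip_prob k (r / 12).
Proof.
have [r0 r2 k0 K1 K2] := hrk; set x := r / 12; set y := 5 * r / 48.
have hx : r / 16 <= x <= r / 8 by rewrite /x; apply/andP; split; lra.
have hy : r / 16 <= y <= r / 8 by rewrite /y; apply/andP; split; lra.
have sx := flip_sin_ge hx; have sy := flip_sin_ge hy.
have /andP[ax1 ax2] := flip_angle hx; have /andP[ay1 ay2] := flip_angle hy.
have h : 9^-1 <= k * (2 * asin y) - k * (2 * asin x).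
  apply: le_trans (flip_angle_gap _ _ _); rewrite /x /y; [|lra..].
  have -> : k * (2 * (5 * r / 48 - r / 12)) = (k * r) / 24 :> R by lra.
  lra.
rewrite /flip_prob; move: (k * (2 * asin x)) (k * (2 * asin y)) ax1 ax2 ay1 ay2 h sx sy.
move=> p q p1 p2 q1 q2 h sp sq.
have [c /andP[c0 cx]] := @sin_mvt p q ltac:(lra).
have hc : 2 / 5 <= cos c.
  by apply: le_trans (cos_ge_quadratic c); have : c ^+ 2 <= (16 / 15) ^+ 2; nra.
move: (sin p) (sin q) (cos c) hc sp sq => s t e he hs ht hst.
have h1 : 2 / 45 <= t - s by nra.
have : (2 / 45) * (62 / 100) <= (t - s) * (t + s) by apply: ler_pM; lra.
have -> : (t - s) * (t + s) = t ^+ 2 - s ^+ 2 by ring.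
by move: (t ^+ 2) (s ^+ 2) => u v; lra.
Qed.

End FlipProb.
End Trigonometry.

(** * Filtering a Heisenberg evolution *)

Section Filter.
Variable R : realType.
Local Notation C := R[i].

Definition cis (x : R) : C := cos x +i* sin x.
Definition sqn (z : C) : R := complex.Re z ^+ 2 + complex.Im z ^+ 2.

Lemma cis0 : cis 0 = 1.
Proof. by rewrite /cis cos0 sin0. Qed.

Lemma cisD x y : cis (x + y) = cis x * cis y.
Proof.
rewrite /cis cosD sinD; apply/eqP; rewrite eq_complex /= eqxx /=.
by apply/eqP; rewrite addrC.
Qed.

Lemma cisN x : cis (- x) = conjc (cis x).
Proof. by rewrite /cis cosN sinN. Qed.

Lemma cisX n x : cis (n%:R * x) = cis x ^+ n.
Proof.
elim: n => [|n ih]; first by rewrite mul0r cis0 expr0.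
by rewrite exprS -ih -cisD -natr1 mulrDl mul1r addrC.
Qed.

Lemma sqnM z y : sqn (z * y) = sqn z * sqn y.
Proof. by case: z y => a b [c d]; rewrite /sqn /=; ring. Qed.

Lemma sqn_cis x : sqn (cis x) = 1.
Proof. by rewrite /sqn /= cos2Dsin2. Qed.

Lemma sqn_ge0 z : 0 <= sqn z.
Proof. by rewrite addr_ge0 ?sqr_ge0. Qed.

Lemma sqn_realM (c : R) z : sqn (c%:C * z) = c ^+ 2 * sqn z.
Proof. by case: z => a b; rewrite /sqn /=; ring. Qed.

Lemma sqnX z n : sqn (z ^+ n) = sqn z ^+ n.
Proof.
elim: n => [|n ih]; last by rewrite !exprS sqnM ih.
by rewrite !expr0 /sqn /= expr1n expr0n addr0.
Qed.

Definition box (L : nat) : {poly R} := \poly_(j < L) L%:R^-1.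

(* The [m]-fold convolution of the uniform distribution on [{0, ..., L - 1}]. *)
Definition filt (L m i : nat) : R := (box L ^+ m)`_i.

Lemma filt_ge0 L m i : 0 <= filt L m i.
Proof.
rewrite /filt; elim: m i => [|m ih] i.
  by rewrite expr0 coef1 ler0n.
rewrite exprS coefM; apply: sumr_ge0 => j _; apply: mulr_ge0 => //.
by rewrite coef_poly; case: ifP; rewrite // invr_ge0.
Qed.

Lemma size_box_exp L m : (size (box L ^+ m) <= (L.-1 * m).+1)%N.
Proof.
apply: leq_trans (size_poly_exp_leq _ _) _; rewrite ltnS leq_mul2r.
by apply/orP; right; rewrite -!subn1 leq_sub2r // size_poly.
Qed.

Lemma filt_sum L m N : (0 < L)%N -> (L.-1 * m < N)%N ->
  \sum_(i < N) filt L m i = 1.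
Proof.
move=> L0 hN; have hs := leq_trans (size_box_exp L m) hN.
have := horner_coef_wide 1 hs; rewrite horner_exp horner_poly.
under eq_bigr do rewrite expr1n mulr1.
under [in X in _ = X -> _]eq_bigr do rewrite expr1n mulr1.
rewrite sumr_const card_ord -[_ *+ L]mulr_natr mulVf ?pnatr_eq0 -?lt0n //.
by rewrite expr1n => <-.
Qed.

(** Both sides are the polynomial [box L ^+ m] evaluated at z; the bound on N ensures that no
    coefficient is cut off. *)
Lemma filt_fourier L m N (z : C) : (L.-1 * m < N)%N ->
  \sum_(i < N) (filt L m i)%:C * z ^+ i
    = ((L%:R^-1)%:C * \sum_(j < L) z ^+ j) ^+ m.
Proof.
move=> hN; have hs := leq_trans (size_box_exp L m) hN.
have hs' : (size (map_poly (real_complex R) (box L ^+ m)) <= N)%N.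
  by rewrite size_map_poly.
have := horner_coef_wide z hs'.
under [in X in _ = X -> _]eq_bigr do rewrite coef_map.
move=> <-; rewrite rmorphXn /= horner_exp; congr (_ ^+ m).
have hb : (size (map_poly (real_complex R) (box L)) <= L)%N.
  by rewrite size_map_poly size_poly.
rewrite (horner_coef_wide z hb) mulr_sumr; apply: eq_bigr => j _.
by rewrite coef_map coef_poly ltn_ord.
Qed.

(** In the closed form of the geometric sum the numerator has modulus at most 2 and the denominator
    at least sin x >= x / 2, so the mean is at most 4 / (L x) <= 1/2 in modulus. *)
Lemma sqn_geometric (L : nat) (x : R) : 0 < x -> x <= 1 -> 8 <= L%:R * x ->
  sqn ((L%:R^-1)%:C * \sum_(j < L) cis x ^+ j) <= 4^-1.
Proof.
move=> x0 x1 hL.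
have L0 : 0 < L%:R :> R.
  by rewrite ltr0n lt0n; apply/eqP => L0; move: hL; rewrite L0 mul0r; lra.
set S := \sum_(j < L) _.
have h1 : sqn (cis x - 1) * sqn S = sqn (cis (L%:R * x) - 1).
  by rewrite -sqnM -subrX1 cisX.
have h2 : sqn (cis (L%:R * x) - 1) <= 4.
  rewrite /sqn /= subr0; have := cos2Dsin2 (L%:R * x); have := cos_geN1 (L%:R * x).
  by move: (cos _) (sin _) => c s; nra.
have h3 : (x / 2) ^+ 2 <= sqn (cis x - 1).
  have s1 : x / 2 <= sin x by apply: le_trans (sin_ge_cubic (ltW x0)); nra.
  rewrite /sqn /= subr0; apply: ler_wpDl; first exact: sqr_ge0.
  by rewrite ler_sqr ?nnegrE; lra.
rewrite sqn_realM; have s0 := sqn_ge0 S.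
have h4 : (x / 2) ^+ 2 * sqn S <= 4.
  by apply: le_trans h2; rewrite -h1 ler_wpM2r.
rewrite exprVn mulrC ler_pdivrMr ?exprn_gt0 //.
move: (sqn S) (L%:R : R) s0 h4 hL L0 => q l q0 h4 hL l0.
have h5 : 64 <= (l * x) ^+ 2 by move: (l * x) hL => y hy; nra.
have : 64 * q <= (l * x) ^+ 2 * q by rewrite ler_wpM2r.
have -> : (l * x) ^+ 2 * q = l ^+ 2 * 4 * ((x / 2) ^+ 2 * q) by field.
have : l ^+ 2 * 4 * ((x / 2) ^+ 2 * q) <= l ^+ 2 * 4 * 4.
  by rewrite ler_wpM2l // mulr_ge0 ?sqr_ge0.
move: (l ^+ 2 * 4 * _) => y; lra.
Qed.

Lemma filt_decay L m N (x : R) : (L.-1 * m < N)%N -> 0 < x -> x <= 1 ->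
  8 <= L%:R * x ->
  sqn (\sum_(i < N) (filt L m i)%:C * cis x ^+ i) <= (2^-1 ^+ m) ^+ 2.
Proof.
move=> hN x0 x1 hL; rewrite filt_fourier // sqnX -exprM mulnC exprM.
have := sqn_geometric x0 x1 hL; move: (sqn _) (sqn_ge0 ((L%:R^-1)%:C * \sum_(j < L) cis x ^+ j)) => q q0 hq.
have -> : 2^-1 ^+ 2 = 4^-1 :> R by field.
by apply: lerXn2r hq; rewrite nnegrE // invr_ge0.
Qed.

End Filter.

(** * Filtering an observable on the ground state *)

Section GroundState.
Variable R : realType.
Local Notation C := R[i].
Variables (n : nat) (H : 'M[C]_(2 ^ n)) (E : nat -> R)
  (psi : nat -> 'cV[C]_(2 ^ n)).
Hypothesis HE : eigendecomposition H E psi.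

Lemma eigendecomposition_adj : H^t* = H.
Proof.
case: HE => _ _ ->; rewrite adjmx_sum; apply: eq_bigr => i _.
by rewrite adjmxZr /pure (adjmxM (psi i)) trmxCK.
Qed.

Lemma eigendecomposition_normal : H \is normalmx.
Proof. by apply/normalmxP; rewrite eigendecomposition_adj. Qed.

Lemma eigendecomposition_eigen j : (j < 2 ^ n)%N -> H *m psi j = (E j)%:C *: psi j.
Proof.
move=> hj; case: HE => h1 _ ->; rewrite mulmx_suml (bigD1 (Ordinal hj)) //=.
rewrite big1 ?addr0 => [|i]; rewrite -scalemxAl /pure -mulmxA h1 //.
  by rewrite eqxx mulmx1.
rewrite -val_eqE /= => /negPf ->.
by rewrite -scalemx1 scale0r mulmx0 scaler0.
Qed.

Lemma eigendecomposition_nsq j : (j < 2 ^ n)%N -> nsq (psi j) = 1.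
Proof.
by move=> hj; case: HE => h1 _ _; rewrite /nsq /rdot h1 // eqxx mxE eqxx.
Qed.

Definition eigenbasis : 'M[C]_(2 ^ n) := \matrix_(i, j) psi j i 0.

Lemma eigenbasis_coord e (x : 'M[C]_(_, e)) j k :
  (eigenbasis^t* *m x) j k = ((psi j)^t* *m x) 0 k.
Proof. by rewrite mxE [RHS]mxE; apply: eq_bigr => i _; rewrite !adjmxE mxE. Qed.

Lemma eigenbasis_unitary : eigenbasis \is unitarymx.
Proof.
apply/unitaryP_left/matrixP => i j; case: HE => h1 _ _.
rewrite eigenbasis_coord [RHS]mxE.
have -> : ((psi i)^t* *m eigenbasis) 0 j = ((psi i)^t* *m psi j) 0 0.
  by rewrite mxE [RHS]mxE; apply: eq_bigr => k _; rewrite [eigenbasis k j]mxE.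
by rewrite h1 // mxE eqxx mulr1n.
Qed.

Lemma nsq_eigenbasis (v : 'cV[C]_(2 ^ n)) :
  nsq v = \sum_(j < 2 ^ n) sqn (((psi j)^t* *m v) 0 0).
Proof.
have h : eigenbasis^t* \is unitarymx by rewrite trmxC_unitary eigenbasis_unitary.
rewrite -(nsq_unitary v h) nsq_sum; apply: eq_bigr => j _.
by rewrite eigenbasis_coord.
Qed.

Lemma energy_le_opnorm j : (j < 2 ^ n)%N -> `|E j| <= opnorm H.
Proof.
move=> hj.
(* A crude bound that makes the set below [opnorm] bounded, as its supremum requires. *)
have hE : forall v, nsq (H *m v) <= (\sum_(k < 2 ^ n) E k ^+ 2) * nsq v.
  move=> v; rewrite nsq_eigenbasis (nsq_eigenbasis v) mulr_sumr.
  apply: ler_sum => k _.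
  have -> : (psi k)^t* *m (H *m v) = (E k)%:C *: ((psi k)^t* *m v).
    rewrite mulmxA -[in LHS]eigendecomposition_adj -adjmxM.
    by rewrite eigendecomposition_eigen // adjmxZr scalemxAl.
  rewrite mxE sqn_realM ler_wpM2r ?sqn_ge0 // (bigD1 k) //= lerDl.
  by apply: sumr_ge0 => i _; exact: sqr_ge0.
have -> : `|E j| = vnorm (H *m psi j).
  rewrite vnormE eigendecomposition_eigen // nrmZ /nrm eigendecomposition_nsq //.
  by rewrite sqrtr1 mulr1.
rewrite /opnorm; apply: ub_le_sup.
  exists (Num.sqrt (\sum_(k < 2 ^ n) E k ^+ 2)) => _ [v /= hv <-].
  rewrite vnormE; have s0 : 0 <= \sum_(k < 2 ^ n) E k ^+ 2.
    by apply: sumr_ge0 => i _; exact: sqr_ge0.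
  rewrite ler_sqrt //; apply: le_trans (hE v) _.
  rewrite -[leRHS]mulr1 ler_wpM2l // -sqr_nrm.
  by move: hv; rewrite vnormE => hv; have := nrm_ge0 v; move: (nrm v) hv => t; nra.
exists (psi j) => //=.
by rewrite vnormE /nrm eigendecomposition_nsq // sqrtr1.
Qed.

Lemma evolution_psi t j : (j < 2 ^ n)%N ->
  evolution H t *m psi j = cis (E j * t) *: psi j.
Proof.
move=> hj; exact: evolution_eigen eigendecomposition_normal (eigendecomposition_eigen hj).
Qed.

Lemma psi_evolution t j : (j < 2 ^ n)%N ->
  (psi j)^t* *m evolution H t = cis (E j * t) *: (psi j)^t*.
Proof.
move=> hj; rewrite -[evolution H t]trmxCK -adjmxM -evolutionN evolution_psi //.
by rewrite adjmxZ mulrN cisN conjcK.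
Qed.

Variables (A : 'M[C]_(2 ^ n)) (L m N : nat) (t0 : R).
Hypotheses (AH : A^t* = A) (L0 : (0 < L)%N) (LmN : (L.-1 * m < N)%N).
Hypothesis gap : forall j, (0 < j < 2 ^ n)%N ->
  [/\ 0 < (E j - E 0%N) * t0, (E j - E 0%N) * t0 <= 1
    & 8 <= L%:R * ((E j - E 0%N) * t0)].

Lemma expectationE : ((psi 0)^t* *m A *m psi 0) 0 0 = (expectation A (psi 0%N))%:C.
Proof.
rewrite /expectation; set M := _ *m _ *m _.
have : M^t* 0 0 = M 0 0 by rewrite /M adjmxM adjmxM trmxCK AH mulmxA.
rewrite adjmxE; case: (M 0 0) => a c [] /= h; apply/eqP.
by rewrite eq_complex /= eqxx /=; apply/eqP; lra.
Qed.

(** On the j-th eigenvector the summand for time t acquires the phase of (E j - E 0) t, so the sum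
    is the Fourier transform of the filter at (E j - E 0) t0, up to the unimodular phase due to
    [off]. It is 1 for j = 0 and at most 2^-m otherwise; the bound (E j - E 0) t0 <= 1 excludes
    aliasing. *)
Lemma filtered_observable (off : R) :
  nrm (\sum_(i < N) (filt R L m i)%:C *:
         (evolution H (t0 * (i%:R - off)) *m
           (A *m (evolution H (- (t0 * (i%:R - off))) *m psi 0%N)))
       - (expectation A (psi 0%N))%:C *: psi 0%N)
    <= 2^-1 ^+ m * nrm (A *m psi 0%N).
Proof.
have n0 : (0 < 2 ^ n)%N by rewrite expn_gt0.
set v := _ - _.
have hv (j : 'I_(2 ^ n)) : ((psi j)^t* *m v) 0 0
   = (if j == 0%N :> nat then 0 else
      cis (- ((E j - E 0%N) * t0 * off)) *
      \sum_(i < N) (filt R L m i)%:C * cis ((E j - E 0%N) * t0) ^+ i)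
     * ((psi j)^t* *m (A *m psi 0%N)) 0 0.
  have hj := ltn_ord j; set al := ((psi j)^t* *m (A *m psi 0%N)) 0 0.
  have ht t : (psi j)^t* *m (evolution H t *m (A *m (evolution H (- t) *m psi 0%N)))
      = cis ((E j - E 0%N) * t) *: ((psi j)^t* *m (A *m psi 0%N)).
    rewrite (mulmxA _ (evolution H t)) psi_evolution // evolution_psi // -!scalemxAr -scalemxAl scalerA.
    by rewrite -cisD; congr (cis _ *: _); ring.
  have -> : ((psi j)^t* *m v) 0 0
     = \sum_(i < N) (filt R L m i)%:C * (cis ((E j - E 0%N) * (t0 * (i%:R - off))) * al)
       - (expectation A (psi 0%N))%:C * ((psi j)^t* *m psi 0%N) 0 0.
    rewrite /v mulmxBr mulmx_sumr mxE [X in _ + X]mxE summxE.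
    congr (_ - _); last by rewrite -scalemxAr mxE.
    by apply: eq_bigr => i _; rewrite -scalemxAr ht mxE [X in _ * X]mxE.
  case: HE => h1 _ _; rewrite h1 // mxE eqxx mulr1n.
  case: eqP => [j0|/eqP j0].
    rewrite /al j0 subrr mul0r; under eq_bigr do rewrite mul0r cis0 mul1r mulmxA.
    rewrite -mulr_suml -rmorph_sum filt_sum // expectationE.
    by rewrite mul1r mulr1 subrr.
  rewrite mulr0 subr0 mulr_sumr mulr_suml; apply: eq_bigr => i _.
  set x := (E j - E 0%N) * (t0 * (i%:R - off)).
  have -> : cis x = cis (- ((E j - E 0%N) * t0 * off)) * cis ((E j - E 0%N) * t0) ^+ i.
    by rewrite -cisX -cisD /x; congr cis; ring.
  move: (_%:C) (cis _) (cis _ ^+ i) => p q s; ring.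
rewrite -ler_sqr ?nnegrE ?mulr_ge0 ?nrm_ge0 ?exprn_ge0 ?invr_ge0 //.
rewrite exprMn !sqr_nrm nsq_eigenbasis [nsq (A *m _)]nsq_eigenbasis mulr_sumr.
apply: ler_sum => j _; rewrite hv sqnM ler_wpM2r ?sqn_ge0 //.
case: eqP => [_|/eqP j0]; first by rewrite /sqn /= expr0n addr0 sqr_ge0.
have jP : (0 < j < 2 ^ n)%N by rewrite lt0n j0 /=.
have [g1 g2 g3] := gap jP.
by rewrite sqnM sqn_cis mul1r filt_decay.
Qed.

End GroundState.

(** * Dynamics in an invariant plane *)

Section Plane.
Variable R : realType.
Local Notation C := R[i].
Variables (d : nat) (P P' : 'M[C]_d) (x y z p q : 'cV[C]_d) (eta e : R).
Hypotheses (hP : orthoproj P) (hP' : orthoproj P').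
Hypotheses (Px : P *m x = x) (Py' : P' *m y = y).
Hypothesis yE : y = (sin eta)%:C *: x + (cos eta)%:C *: z.
Hypothesis PyE : P *m y = (sin eta)%:C *: x + p.
Hypothesis Px'E : P' *m x = (sin eta)%:C *: y + q.
Hypotheses (hp : nrm p <= e) (hq : nrm q <= e).
Hypotheses (sin_eta : 0 <= sin eta <= 4^-1) (cos_eta : 3 / 4 <= cos eta).

(** The partner z is solved from y = sin eta x + cos eta z. It is orthogonal to x only up to order
    e, so the parametrization is that of a circle only approximately. *)
Definition plane_vec (phi : R) : 'cV[C]_d := (cos phi)%:C *: x + (sin phi)%:C *: z.

Definition walk_mx : 'M[C]_d := (1%:M - 2 *: P) *m (2 *: P' - 1%:M).

Local Notation Rf := (1%:M - 2 *: P).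

Lemma nrm_reflect v : nrm (Rf *m v) = nrm v.
Proof. exact: nrm_unitary (reflection_unitary hP). Qed.

Lemma mul_reflect (v : 'cV[C]_d) : Rf *m v = v - 2 *: (P *m v).
Proof. by rewrite mulmxBl mul1mx -scalemxAl. Qed.

Lemma mul_walk (v : 'cV[C]_d) : walk_mx *m v = Rf *m (2 *: (P' *m v) - v).
Proof. by rewrite /walk_mx -mulmxA (mulmxBl (2 *: P')) mul1mx -scalemxAl. Qed.

Lemma cos_eta_neq0 : cos eta != 0.
Proof. by have h := cos_eta; apply: lt0r_neq0; lra. Qed.

Let cos2E : cos (eta + eta) = 1 - 2 * sin eta ^+ 2.
Proof.
rewrite cosD; have := cos2Dsin2 eta; move: (cos eta) (sin eta) => c s; nra.
Qed.

Let sin2E : sin (eta + eta) = 2 * sin eta * cos eta.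
Proof. by rewrite sinD; move: (cos eta) (sin eta) => c s; ring. Qed.

Lemma walk_x : walk_mx *m x = plane_vec (eta + eta)
  + ((- (4 * sin eta))%:C *: p + 2 *: (Rf *m q)).
Proof.
rewrite /plane_vec cos2E sin2E mul_walk Px'E mulmxBr -scalemxAr mulmxDr -scalemxAr.
rewrite (mul_reflect y) (mul_reflect x) Px PyE yE.
move: (Rf *m q) (sin eta) (cos eta) => r s c.
apply/colP => i; rewrite !mxE.
move: (x i 0) (z i 0) (p i 0) (r i 0) => a b1 c1 d1.
rewrite !(rmorphB, rmorphN, rmorphM, rmorphXn) /= ?rmorph1 ?rmorph_nat; ring.
Qed.

Lemma walk_y : walk_mx *m y = y - (2 * sin eta)%:C *: x - 2 *: p.
Proof.
rewrite mul_walk Py' mul_reflect mulmxBr -scalemxAr PyE.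
move: (sin eta) => s; apply/colP => i; rewrite !mxE.
move: (x i 0) (y i 0) (p i 0) => a b1 c1.
rewrite !rmorphM /= ?rmorph_nat; ring.
Qed.

(** Follows from cos eta z = y - sin eta x and the images of x and y; the division by cos eta is the
    reason for bounding it from below. *)
Lemma walk_perp : walk_mx *m z = plane_vec (eta + eta + pi / 2)
  + ((cos eta)^-1)%:C *:
     ((4 * sin eta ^+ 2 - 2)%:C *: p + (- (2 * sin eta))%:C *: (Rf *m q)).
Proof.
have c0 := cos_eta_neq0; have h := cos2Dsin2 eta.
have hC : ((cos eta)%:C : C) ^+ 2 = 1 - (sin eta)%:C ^+ 2.
  have := congr1 (real_complex R) h; rewrite rmorphD !rmorphXn rmorph1 /= => <-.
  by rewrite addrK.
have hC0 : ((cos eta)%:C : C) != 0.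
  by apply: contra_neq c0 => /complexI.
apply: (scalerI hC0).
have -> : (cos eta)%:C *: (walk_mx *m z)
    = walk_mx *m y - (sin eta)%:C *: (walk_mx *m x).
  rewrite [y in RHS]yE mulmxDr -(scalemxAr (sin eta)%:C) -(scalemxAr (cos eta)%:C).
  by rewrite addrC addKr.
rewrite walk_y walk_x /plane_vec cosDpihalf sinDpihalf cos2E sin2E yE.
move: (Rf *m q) => r.
apply/colP => i; rewrite !mxE.
move: (x i 0) (z i 0) (p i 0) (r i 0) => a b1 c1 d1.
rewrite !(rmorphB, rmorphN, rmorphM, rmorphXn, fmorphV, rmorphD) /= ?rmorph1 ?rmorph_nat.
move: ((cos eta)%:C : C) ((sin eta)%:C : C) hC hC0 => c s hC hC0.
apply/eqP; rewrite -subr_eq0; apply/eqP.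
transitivity (2 * s * a * (c ^+ 2 - (1 - s ^+ 2))); first by field.
by rewrite hC subrr mulr0.
Qed.

Lemma plane_vec0 : plane_vec 0 = x.
Proof. by rewrite /plane_vec cos0 sin0 scale1r scale0r addr0. Qed.

Lemma plane_vec_pihalf : plane_vec (pi / 2) = z.
Proof. by rewrite /plane_vec cos_pihalf sin_pihalf scale1r scale0r add0r. Qed.

Let e0 : 0 <= e. Proof. exact: le_trans (nrm_ge0 p) hp. Qed.

Lemma walk_x_error : exists2 r, walk_mx *m x = plane_vec (eta + eta) + r & nrm r <= 4 * e.
Proof.
have /andP[s0 s1] := sin_eta; have u0 := e0; have h1 := hp; have h2 := hq.
have := walk_x; have := nrm_reflect q; move: (Rf *m q) => r hr wx.
eexists; first exact: wx.
apply: le_trans (nrmD _ _) _; rewrite nrmZ -[2](rmorph_nat (real_complex R)) nrmZ.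
rewrite hr normrN ger0_norm ?mulr_ge0 // normr_nat.
move: (nrm p) (nrm q) (nrm_ge0 p) (nrm_ge0 q) h1 h2 => u v hu hv; nra.
Qed.

Lemma walk_perp_error :
  exists2 r, walk_mx *m z = plane_vec (eta + eta + pi / 2) + r & nrm r <= 4 * e.
Proof.
have /andP[s0 s1] := sin_eta; have u0 := e0; have h1 := hp; have h2 := hq.
have hc := cos_eta.
have := walk_perp; have := nrm_reflect q; move: (Rf *m q) => r hr wx.
eexists; first exact: wx.
rewrite nrmZ ger0_norm ?invr_ge0; last by lra.
rewrite mulrC ler_pdivrMr; last by lra.
apply: le_trans (nrmD _ _) _; rewrite !nrmZ hr normrN.
rewrite (ler0_norm (_ : 4 * sin eta ^+ 2 - 2 <= 0)); last by nra.
rewrite ger0_norm ?mulr_ge0 //.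
move: (sin eta) (cos eta) (nrm p) (nrm q) (nrm_ge0 p) (nrm_ge0 q) h1 h2 s0 s1 hc.
move=> s c u v hu hv h1 h2 s0 s1 hc.
have : - (4 * s ^+ 2 - 2) * u <= 2 * e by nra.
nra.
Qed.

Lemma plane_vecD phi t : plane_vec (phi + t) =
  (cos phi)%:C *: plane_vec t + (sin phi)%:C *: plane_vec (t + pi / 2).
Proof.
rewrite /plane_vec cosDpihalf sinDpihalf cosD sinD.
apply/colP => i; rewrite !mxE.
rewrite !(rmorphB, rmorphN, rmorphM, rmorphD) /=; ring.
Qed.

Lemma mul_plane_vec (M : 'M[C]_d) phi : M *m plane_vec phi
  = (cos phi)%:C *: (M *m x) + (sin phi)%:C *: (M *m z).
Proof.
by rewrite /plane_vec mulmxDr -(scalemxAr (cos phi)%:C) -(scalemxAr (sin phi)%:C).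
Qed.

Lemma walk_plane_vec phi :
  nrm (walk_mx *m plane_vec phi - plane_vec (phi + (eta + eta))) <= 8 * e.
Proof.
have [E1 wx n1] := walk_x_error; have [E2 wz n2] := walk_perp_error.
rewrite mul_plane_vec wx wz (plane_vecD phi (eta + eta)); move: (plane_vec _) (plane_vec _) => v1 v2.
have gen (a b u v : 'cV[C]_d) : a + u + (b + v) - (a + b) = u + v.
  by rewrite addrACA (addrC (a + b)) addrK.
rewrite (scalerDr _ v1) (scalerDr _ v2) gen.
have h5 := e0; apply: le_trans (nrmD _ _) _; rewrite !nrmZ.
have := cos_max phi; have := sin_max phi.
have := normr_ge0 (cos phi); have := normr_ge0 (sin phi).
move: `|cos phi| `|sin phi| (nrm_ge0 E1) (nrm_ge0 E2) n1 n2 => c s.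
move: (nrm E1) (nrm E2) => u v u0 v0 hu hv h1 h2 h3 h4; nra.
Qed.

Lemma walk_unitary : walk_mx \is unitarymx.
Proof.
apply: mul_unitarymx; first exact: reflection_unitary.
by rewrite -opprB; apply: unitarymxN; exact: reflection_unitary.
Qed.

(** The walk is unitary, so the deviation of each step is carried along with unchanged norm and the
    deviations add. *)
Lemma iter_walk_plane_vec K phi :
  nrm (iter K (mulmx walk_mx) (plane_vec phi) - plane_vec (phi + K%:R * (2 * eta)))
    <= K%:R * (8 * e).
Proof.
elim: K => [|K ih]; first by rewrite /= !mul0r addr0 subrr nrm0.
rewrite iterS; set v := iter _ _ _ in ih *.
have -> : phi + K.+1%:R * (2 * eta) = phi + K%:R * (2 * eta) + (eta + eta).
  by rewrite -natr1; move: (K%:R : R) => k; ring.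
move: (phi + K%:R * (2 * eta)) ih => t ih.
have -> : walk_mx *m v - plane_vec (t + (eta + eta)) = walk_mx *m (v - plane_vec t)
     + (walk_mx *m plane_vec t - plane_vec (t + (eta + eta))).
  by rewrite (mulmxBr walk_mx v) subrKA.
apply: le_trans (nrmD _ _) _; rewrite (nrm_unitary _ walk_unitary) -natr1 mulrDl mul1r.
by apply: lerD => //; exact: walk_plane_vec.
Qed.

Lemma nrm_proj_perp : nrm (P *m z) <= 2 * e.
Proof.
have hc := cos_eta; have h := hp; have h0 := e0.
have : (cos eta)%:C *: (P *m z) = p.
  have := PyE; rewrite yE mulmxDr -(scalemxAr (sin eta)%:C) Px.
  by rewrite -(scalemxAr (cos eta)%:C) => /addrI.
move=> /(congr1 (@nrm R d)); rewrite nrmZ ger0_norm; last by lra.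
move: (nrm p) (nrm _) (nrm_ge0 (P *m z)) h => u v v0 hu; nra.
Qed.

Hypotheses (nx : nsq x = 1) (ny : nsq y = 1).

(** Expand 1 = |y|^2 in x and z: the cross term is 2 sin eta <x, p>, because cos eta <x, z> = <x,
    p>, and |<x, p>| <= e. *)
Lemma nrm_plane_perp : nrm z <= 1 + e.
Proof.
have hc := cos_eta; have h := hp; have /andP[s0 s1] := sin_eta; have u0 := e0.
have xy : rdot x y = sin eta + rdot x p.
  have [hP1 _] := hP; have -> : rdot x y = rdot x (P *m y) by rewrite -rdot_adjmx hP1 Px.
  by rewrite PyE rdotDr rdotZr -/(nsq x) nx mulr1.
have h1 : `|rdot x p| <= e.
  by apply: le_trans (rdot_le _ _) _; rewrite {1}/nrm nx sqrtr1 mul1r.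
have h2 : nsq y = sin eta ^+ 2 + 2 * (sin eta * (cos eta * rdot x z)) + cos eta ^+ 2 * nsq z.
  by rewrite {1}yE nsqD !nsqZ nx mulr1 rdotZr rdotZl; congr (_ + 2 * _ + _); rewrite mulrCA.
have h3 : rdot x y = sin eta + cos eta * rdot x z.
  by rewrite yE rdotDr !rdotZr -/(nsq x) nx mulr1.
have h4 : cos eta * rdot x z = rdot x p by lra.
have hcs := cos2Dsin2 eta.
rewrite -ler_sqr ?nnegrE ?nrm_ge0 ?addr_ge0 // sqr_nrm.
move: h2; rewrite ny h4; move: h1; rewrite ler_norml => /andP[h1 _].
move: (rdot x p) (sin eta) (cos eta) (nsq z) h1 s0 s1 hc hcs => u s c t h1 s0 s1 hc hcs ht.
have : c ^+ 2 * t <= c ^+ 2 * (1 + e) ^+ 2; last first.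
  by rewrite ler_pM2l // exprn_gt0 //; lra.
have hT : c ^+ 2 * t = c ^+ 2 - 2 * (s * u) by lra.
have k1 : 0 <= s * (u + e) by apply: mulr_ge0 => //; lra.
have k2 : 9 / 16 <= c ^+ 2 by nra.
have k3 : 0 <= (c ^+ 2 - s) * e by apply: mulr_ge0 => //; lra.
have k4 : 0 <= c ^+ 2 * e ^+ 2 by rewrite mulr_ge0 ?sqr_ge0.
rewrite hT; move: (c ^+ 2) k2 k3 k4 => w k2 k3 k4; nra.
Qed.

End Plane.

(** * Measuring a projection by means of a flag qubit *)

Section FlagMeasurement.
Variable R : realType.
Local Notation C := R[i].
Variables (d : nat) (P P0 P1 X : 'M[C]_d).
Hypotheses (hP : orthoproj P) (Xa : X^t* = X) (XX : X *m X = 1%:M).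
Hypotheses (hP0 : orthoproj P0) (P1E : P1 = 1%:M - P0) (XP0 : X *m P0 = P1 *m X).
Hypothesis (P0P : P0 *m P = P).

(** A circuit can measure qubits only. [flag_proj] is P with the flag ignored, and [flag_gate] flips
    the flag on its orthogonal complement, so that reading the flag amounts to measuring P. *)
Definition flag_proj : 'M[C]_d := P + X *m P *m X.
Definition flag_gate : 'M[C]_d := flag_proj + X *m (1%:M - flag_proj).

Lemma flag_PXP0 : P *m X *m P0 = 0.
Proof.
have [Pa PP] := hP; have [P0a P0P0] := hP0.
have PP0 : P *m P0 = P by rewrite -Pa -P0a -adjmxM P0P.
rewrite -PP0 -2!mulmxA XP0 P1E (mulmxA P0) mulmxBr mulmx1 P0P0 subrr.
by rewrite mul0mx mulmx0.
Qed.

Lemma flag_PXP : P *m X *m P = 0.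
Proof. by rewrite -{2}P0P mulmxA flag_PXP0 mul0mx. Qed.

Lemma flag_proj_comm : X *m flag_proj = flag_proj *m X.
Proof.
by rewrite mulmxDr mulmxDl !mulmxA XX mul1mx -(mulmxA (X *m P)) XX mulmx1 addrC.
Qed.

Lemma flag_projK : flag_proj *m flag_proj = flag_proj.
Proof.
have [Pa PP] := hP; have h := flag_PXP.
rewrite /flag_proj mulmxDl !mulmxDr PP.
have -> : P *m (X *m P *m X) = 0 by rewrite !mulmxA h mul0mx.
have -> : X *m P *m X *m P = 0 by rewrite -2!mulmxA (mulmxA P) h mulmx0.
have -> : X *m P *m X *m (X *m P *m X) = X *m P *m X.
  by rewrite !mulmxA -(mulmxA (X *m P)) XX mulmx1 -(mulmxA X) PP.
by rewrite addr0 add0r.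
Qed.

Lemma flag_proj_adj : flag_proj^t* = flag_proj.
Proof.
have [Pa PP] := hP.
by rewrite /flag_proj adjmxD (adjmxM (X *m P)) (adjmxM X) Pa Xa mulmxA.
Qed.

Lemma flag_gate_unitary : flag_gate \is unitarymx.
Proof.
apply/unitaryP_left.
have -> : flag_gate^t* = flag_gate.
  rewrite /flag_gate adjmxD (adjmxM X) adjmxB adjmx1 flag_proj_adj Xa.
  by rewrite mulmxBl mulmxBr mul1mx mulmx1 flag_proj_comm.
rewrite /flag_gate; move: flag_proj flag_projK flag_proj_comm => Q QQ XQ.
have h1 : Q *m (1%:M - Q) = 0 by rewrite mulmxBr mulmx1 QQ subrr.
have h2 : (1%:M - Q) *m Q = 0 by rewrite mulmxBl mul1mx QQ subrr.
have h3 : (1%:M - Q) *m X = X *m (1%:M - Q) by rewrite mulmxBl mulmxBr mul1mx mulmx1 XQ.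
have h4 : (1%:M - Q) *m (1%:M - Q) = 1%:M - Q by rewrite mulmxBl mul1mx h1 subr0.
have h5 : Q + (1%:M - Q) = 1%:M by rewrite addrC subrK.
move: (1%:M - Q) h1 h2 h3 h4 h5 => T h1 h2 h3 h4 h5.
rewrite mulmxDl !mulmxDr QQ (mulmxA Q X) -XQ -(mulmxA X) h1 mulmx0 addr0.
rewrite -(mulmxA X T Q) h2 mulmx0 add0r mulmxA -(mulmxA X T X) h3 mulmxA XX mul1mx.
by rewrite h4.
Qed.

Section Vector.
Variable v : 'cV[C]_d.
Hypothesis P0v : P0 *m v = v.

Let P1P : P1 *m P = 0. Proof. by rewrite P1E mulmxBl mul1mx P0P subrr. Qed.
Let PX0 (u : 'cV[C]_d) : P0 *m u = u -> P *m (X *m u) = 0.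
Proof.
by move=> <-; rewrite mulmxA mulmxA flag_PXP0 mul0mx.
Qed.
Let P0Pv : P0 *m (P *m v) = P *m v. Proof. by rewrite mulmxA P0P. Qed.
Let P0r : P0 *m (v - P *m v) = v - P *m v. Proof. by rewrite mulmxBr P0v P0Pv. Qed.

Lemma flag_gate_mul (u : 'cV[C]_d) :
  flag_gate *m u = flag_proj *m u + X *m (u - flag_proj *m u).
Proof. by rewrite mulmxDl -mulmxA (mulmxBl 1%:M) mul1mx. Qed.

Lemma flag_proj_mul (u : 'cV[C]_d) :
  flag_proj *m u = P *m u + X *m (P *m (X *m u)).
Proof. by rewrite mulmxDl !mulmxA. Qed.

Lemma flag_gateE : flag_gate *m v = P *m v + X *m (v - P *m v).
Proof. by rewrite flag_gate_mul flag_proj_mul (PX0 P0v) mulmx0 addr0. Qed.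

(** The second use of the gate resets the flag: the two branches are exactly P v and v - P v, and
    the flag is ready for the next measurement. *)
Lemma flag_gate_meas0 : flag_gate *m (P0 *m (flag_gate *m v)) = P *m v.
Proof.
have [Pa PP] := hP; have [P0a P0P0] := hP0.
have -> : P0 *m (flag_gate *m v) = P *m v.
  rewrite flag_gateE mulmxDr P0Pv -[X in _ + P0 *m (_ *m X)]P0r.
  rewrite (mulmxA X) XP0 P1E -mulmxA (mulmxA P0) mulmxBr mulmx1 P0P0.
  by rewrite subrr mul0mx addr0.
rewrite flag_gate_mul flag_proj_mul (PX0 P0Pv) mulmx0 addr0 mulmxA PP.
by rewrite subrr mulmx0 addr0.
Qed.

Lemma flag_gate_meas1 : flag_gate *m (P1 *m (flag_gate *m v)) = v - P *m v.
Proof.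
have [Pa PP] := hP; have [P0a P0P0] := hP0.
have -> : P1 *m (flag_gate *m v) = X *m (v - P *m v).
  rewrite flag_gateE mulmxDr (mulmxA P1) P1P mul0mx add0r (mulmxA P1) -XP0.
  by rewrite -mulmxA P0r.
rewrite flag_gate_mul flag_proj_mul (PX0 P0r) add0r (mulmxA X X) XX mul1mx.
have -> : P *m (v - P *m v) = 0 by rewrite mulmxBr mulmxA PP subrr.
by rewrite mulmx0 add0r subr0 mulmxA XX mul1mx.
Qed.

End Vector.
End FlagMeasurement.

(** * Embedding the system into the register *)

Section Embedding.
Variable R : realType.
Local Notation C := R[i].

Section Inject.
Variables b n : nat.
Local Notation J := (inject0 R b n).

Lemma slice_inject0 k : slice k J = ((k == 0%N :> nat)%:R)%:M.
Proof.
apply/matrixP => i j; rewrite !mxE castmxE !mxE cast_ord_id mxtens_indexK.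
have -> : (mxtens_unindex (cast_ord (esym (mul1n (2 ^ n)%N)) j)).2 = j.
  by apply: val_inj; rewrite /= modn_small.
by rewrite /=; case: (k == 0%N :> nat); rewrite ?mul1r ?mul0r ?mul0rn.
Qed.

Lemma inject0_mul (B : 'M[C]_(2 ^ n)) : (1%:M *t B) *m J = J *m B.
Proof.
apply: sliceP => k; rewrite slice_id_tens sliceM slice_inject0.
by rewrite mul_mx_scalar mul_scalar_mx.
Qed.

Lemma inject0_gram : J^t* *m J = 1%:M.
Proof.
have h0 : (0 < 2 ^ b)%N by rewrite expn_gt0.
rewrite adjmx_mul_slice (bigD1 (Ordinal h0)) //= big1 ?addr0.
  by rewrite slice_inject0 /= mulmx1 adjmx1.
by move=> k; rewrite -val_eqE /= slice_inject0 => /negPf ->; rewrite -scalemx1 scale0r mulmx0.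
Qed.

Lemma inject0_adj_mul (B : 'M[C]_(2 ^ n)) : J^t* *m (1%:M *t B) = B *m J^t*.
Proof.
have := congr1 (fun M => M^t*) (inject0_mul (B^t*)).
by rewrite !adjmxM adjmx_tens adjmx1 trmxCK.
Qed.

End Inject.

Variables w b n : nat.
Local Notation J := (inject0 R b n).
Implicit Types u : 'I_(2 ^ w) -> R.

(** The map psi -> u (x) |0^b> (x) psi, for real amplitudes u of the work register. *)
Definition embed u : 'M[C]_(2 ^ w * (2 ^ b * 2 ^ n), 2 ^ n) :=
  stack (fun j => (u j)%:C *: J).

(** Between two superpositions of the control register a controlled operation becomes a linear
    combination of its blocks. The weights u' j * u j may be negative, which is how the shift enters
    beside the filter. *)
Lemma embed_select u u' f : (embed u')^t* *m (select f *m embed u)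
  = \sum_j (u' j * u j)%:C *: (J^t* *m f j *m J).
Proof.
rewrite adjmx_mul_slice; apply: eq_bigr => j _.
rewrite slice_select !stackK adjmxZr -scalemxAl -2!scalemxAr scalerA.
by rewrite rmorphM mulmxA.
Qed.

Lemma embed_gram u u' : (embed u')^t* *m embed u = (\sum_j u' j * u j)%:C%:M.
Proof.
have := embed_select u u' (fun=> 1%:M); rewrite select1 mul1mx => ->.
under eq_bigr do rewrite mulmx1 inject0_gram.
by rewrite -scaler_suml -rmorph_sum scalemx1.
Qed.

Lemma slice_embed e u (v : 'M[C]_(_, e)) k :
  slice k (embed u *m v) = (u k)%:C *: (J *m v).
Proof. by rewrite sliceM stackK -scalemxAl. Qed.

Lemma embed_ket0 (psi : 'cV[C]_(2 ^ n)) :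
  embed (fun j => (j == 0%N :> nat)%:R) *m psi = ket0 R w *t (ket0 R b *t psi).
Proof.
apply: sliceP => k; rewrite slice_embed; apply: sliceP => l.
apply/matrixP => i j; rewrite [LHS]mxE [LHS]mxE.
have -> : (J *m psi) (mxtens_index (l, i)) j = (slice l (J *m psi)) i j by rewrite [RHS]mxE.
rewrite sliceM slice_inject0 mul_scalar_mx !mxE !mxtens_indexK /=.
rewrite rmorph_nat; congr (_ * (_ * psi _ _)); by rewrite [LHS]ord1 [RHS]ord1.
Qed.

Lemma sysproj_embed u psi : nsq psi = 1 ->
  sysproj w b psi *m (embed u *m psi) = embed u *m psi.
Proof.
move=> psi1; apply: sliceP => k; rewrite slice_select slice_embed.
rewrite -scalemxAr mulmxA inject0_mul -mulmxA /pure -mulmxA.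
by rewrite [psi^t* *m psi]mx11_scalar nsqE psi1 mulmx1.
Qed.

(** Tests the ancillas alone, so the circuit needs no description of psi. On the invariant plane it
    agrees with the projection onto x up to order e. *)
Definition embed_proj u : operator R w b n := embed u *m (embed u)^t*.

Lemma embed_iso u : \sum_j u j * u j = 1 -> (embed u)^t* *m embed u = 1%:M.
Proof. by move=> h; rewrite embed_gram h. Qed.

Lemma embed_orthoproj u : \sum_j u j * u j = 1 -> orthoproj (embed_proj u).
Proof.
move=> h; split; first by rewrite /embed_proj (adjmxM (embed u)) trmxCK.
by rewrite /embed_proj mulmxA -(mulmxA (embed u)) embed_iso // mulmx1.
Qed.

Lemma meas_proj_select (q : 'I_w) x f :
  meas_proj R b n q x *m select f = select f *m meas_proj R b n q x.
Proof.
rewrite !selectM; apply: eq_select => j.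
by case: ifP => _; rewrite ?mul1mx ?mulmx1 ?mul0mx ?mulmx0.
Qed.

Lemma meas_proj_embed (q : 'I_w) u : (forall j, qubit q j -> u j = 0) ->
  meas_proj R b n q false *m embed u = embed u.
Proof.
move=> h; apply: sliceP => k; rewrite slice_select stackK.
case: (boolP (qubit q k)) => [hk|_] /=; last by rewrite mul1mx.
by rewrite h // scale0r mulmx0.
Qed.

Section Heisenberg.
Variables (H A : 'M[C]_(2 ^ n)) (V : 'M[C]_(2 ^ b * 2 ^ n)) (t0 : R) (k : nat)
  (q : 'I_w).
Hypothesis VA : block_encoding V A.

Definition heis_block (j : 'I_(2 ^ w)) : 'M[C]_(2 ^ b * 2 ^ n) :=
  let t := grid_time t0 k (j %% 2 ^ k) in
  ((1%:M *t evolution H t) *m (if qubit q j then V else 1%:M))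
    *m (1%:M *t evolution H (- t)).

Lemma heisenberg_select : heisenberg_op H V t0 k false (Some q) = select heis_block.
Proof. by rewrite /heisenberg_op !selectM; apply: eq_select. Qed.

(** If the control is off, forward and backward evolution cancel; if it is on, the evolution
    commutes with the injection of |0^b>, which reduces V to A. *)
Lemma heis_blockE (j : 'I_(2 ^ w)) : let t := grid_time t0 k (j %% 2 ^ k) in
  J^t* *m heis_block j *m J
  = if qubit q j then evolution H t *m A *m evolution H (- t) else 1%:M.
Proof.
move=> t; rewrite /heis_block -/t.
have E (X1 Y X2 : 'M[C]_(2 ^ b * 2 ^ n)) :
  J^t* *m (X1 *m Y *m X2) *m J = (J^t* *m X1) *m Y *m (X2 *m J) by rewrite !mulmxA.
rewrite E inject0_adj_mul inject0_mul; case: ifP => _.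
  by have [_ <-] := VA; rewrite !mulmxA.
have -> : evolution H t *m J^t* *m 1%:M *m (J *m evolution H (- t))
    = evolution H t *m (J^t* *m J) *m evolution H (- t) by rewrite mulmx1 !mulmxA.
rewrite inject0_gram mulmx1 evolutionN.
by apply/unitarymxP; exact: evolution_unitary.
Qed.

End Heisenberg.
End Embedding.

(** * The flag as the top bit of the work register *)

Section Flag.
Variable R : realType.
Local Notation C := R[i].
Variables w b n : nat.

Lemma flag_swap_proof (j : 'I_(2 ^ w.+1)) :
  ((if j < 2 ^ w then j + 2 ^ w else j - 2 ^ w) < 2 ^ w.+1)%N.
Proof.
have hj : (j < 2 ^ w + 2 ^ w)%N by rewrite addnn -mul2n -expnS.
suff : ((if j < 2 ^ w then j + 2 ^ w else j - 2 ^ w) < 2 ^ w + 2 ^ w)%N.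
  by rewrite addnn -mul2n -expnS.
case: (ltnP j (2 ^ w)) => h1; first by rewrite ltn_add2r.
by rewrite (leq_ltn_trans (leq_subr _ _)).
Qed.

Definition flag_swap j := Ordinal (flag_swap_proof j).

Lemma flag_swapK : involutive flag_swap.
Proof.
move=> j; apply: val_inj; rewrite /=.
have hj : (j < 2 ^ w + 2 ^ w)%N by rewrite addnn -mul2n -expnS.
case: (ltnP j (2 ^ w)) => h; first by rewrite ltnNge leq_addl /= addnK.
by rewrite ltn_subLR // hj subnK.
Qed.

Lemma qubit_flag (j : 'I_(2 ^ w.+1)) : qubit (ord_max : 'I_w.+1) j = (2 ^ w <= j)%N.
Proof.
have hj : (j < 2 ^ w + 2 ^ w)%N by rewrite addnn -mul2n -expnS.
rewrite /qubit /=; case: leqP => h; last by rewrite divn_small.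
by rewrite -(subnK h) divnDr // divnn expn_gt0 /= divn_small // ltn_subLR.
Qed.

Lemma qubit_flag_swap (j : 'I_(2 ^ w.+1)) :
  qubit (ord_max : 'I_w.+1) (flag_swap j) = ~~ qubit (ord_max : 'I_w.+1) j.
Proof.
have hj : (j < 2 ^ w + 2 ^ w)%N by rewrite addnn -mul2n -expnS.
rewrite !qubit_flag /= -ltnNge; case: (ltnP j (2 ^ w)) => h.
  by rewrite leq_addl.
by apply/negbTE; rewrite -ltnNge ltn_subLR.
Qed.

Definition flag_flip : operator R w.+1 b n :=
  (\matrix_(i, j) (i == flag_swap j)%:R : 'M[C]_(2 ^ w.+1)) *t 1%:M.

Lemma slice_flag_flip e (v : 'M[C]_(_, e)) i :
  slice i (flag_flip *m v) = slice (flag_swap i) v.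
Proof.
rewrite slice_tens (bigD1 (flag_swap i)) //= big1 ?addr0 => [|j /negPf h].
  by rewrite mxE flag_swapK eqxx scale1r mul1mx.
rewrite mxE; case: eqP => [hi|_]; last by rewrite scale0r.
by move: h; rewrite hi flag_swapK eqxx.
Qed.

Lemma flag_flip_adj : flag_flip^t* = flag_flip.
Proof.
rewrite /flag_flip adjmx_tens adjmx1; congr (_ *t _); apply/matrixP => i j.
rewrite adjmxE !mxE conjc_nat; congr (_%:R).
by rewrite -(inj_eq (inv_inj flag_swapK)) flag_swapK eq_sym.
Qed.

Lemma flag_flipK : flag_flip *m flag_flip = 1%:M.
Proof.
apply: sliceP => i; rewrite slice_flag_flip -[flag_flip]mulmx1 slice_flag_flip.
by rewrite flag_swapK.
Qed.

Lemma flag_flip_meas : flag_flip *m meas_proj R b n (ord_max : 'I_w.+1) false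
  = meas_proj R b n (ord_max : 'I_w.+1) true *m flag_flip.
Proof.
apply: sliceP => i; rewrite slice_flag_flip slice_select.
rewrite -[meas_proj _ _ _ _ _]mulmx1 slice_select -[flag_flip]mulmx1 slice_flag_flip.
by rewrite qubit_flag_swap; case: (qubit _ i).
Qed.

End Flag.

(** * Circuit building blocks *)

Section Builders.
Variable R : realType.
Variables w b n : nat.
Local Notation C := R[i].
Local Notation prot := (protocol R w.+1 b n).
Local Notation op := (operator R w.+1 b n).

(* The identity gate replaces [U] when [U] is not unitary. *)
Definition gate (U : op) (p : prot) : prot :=
  if Bool.bool_dec (U \is unitarymx) true is left h then Gate h p else p.

Definition flag : 'I_w.+1 := ord_max.

Variables (t0 : R) (k : nat) (t0_gt0 : 0 < t0) (kw : (0 < k <= w.+1)%N) (q : 'I_w.+1).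
Variable u : 'I_(2 ^ w.+1) -> R.

Definition heis (inv : bool) (p : prot) : prot := Heisenberg t0_gt0 kw inv (Some q) p.

Definition walk_step (u' : 'I_(2 ^ w.+1) -> R) (p : prot) : prot :=
  heis false (gate (2 *: embed_proj b n u' - 1%:M)
    (heis true (gate (1%:M - 2 *: embed_proj b n u) p))).

Definition measure_gate : op := flag_gate (embed_proj b n u) (flag_flip R w b n).

Definition measure (p0 p1 : prot) : prot :=
  gate measure_gate
    (Measure flag (fun x : bool => gate measure_gate (if x then p1 else p0))).

(** [p0] continues after the outcome u, and [p1] after the complementary outcome, which signals the
    partner state. *)
Definition step u' K (p0 p1 : prot) : prot := iter K (walk_step u') (measure p0 p1).

(** Started from the partner state, it repeats the step until x is found. The output 0 after m
    unsuccessful attempts is arbitrary and is charged as a failure. *)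
Fixpoint recover u' K m (rest : prot) : prot :=
  if m is m'.+1 then step u' K rest (recover u' K m' rest) else Output _ _ _ 0.

(** [s] tells whether the partner state is present, and [cnt] counts the changes of [s]. A run that
    ends in the partner state is recovered before the continuation starts. *)
Fixpoint trials u' K (M m : nat) (rest : nat -> prot) (s : bool) (cnt : nat) : prot :=
  if m is m'.+1 then
    step u' K (trials u' K M m' rest false (cnt + s))
              (trials u' K M m' rest true (cnt + ~~ s))
  else if s then recover u' K M (rest cnt) else rest cnt.

(** Reduces the bound on the evolution time to a count of calls, as every call then consists of one
    forward and one backward evolution of time at most T. *)
Fixpoint heisenberg_only (T : R) (p : prot) : Prop :=
  match p with
  | Output _ => True
  | Gate _ _ p' => heisenberg_only T p'
  | Measure _ f => heisenberg_only T (f false) /\ heisenberg_only T (f true)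
  | Call _ _ _ => False
  | Heisenberg t0' k' _ _ _ _ p' => max_time t0' k' <= T /\ heisenberg_only T p'
  end.

Lemma evolution_time_le T p : 0 <= T -> heisenberg_only T p ->
  evolution_time p <= (calls p)%:R * (2 * T).
Proof.
move=> T0; have T2 : 0 <= 2 * T by rewrite mulr_ge0.
elim: p => [a|U uU p IH|qq f IH|inv ctrl p IH|t0' k' h1 h2 inv ctrl p IH] //=.
- by rewrite mul0r.
- move=> [h0 h1]; rewrite ge_max; apply/andP; split.
    by apply: le_trans (IH false h0) _; rewrite ler_wpM2r // ler_nat leq_maxl.
  by apply: le_trans (IH true h1) _; rewrite ler_wpM2r // ler_nat leq_maxr.
- move=> [h3 /IH h4]; rewrite -natr1 mulrDl mul1r addrC lerD //.
  by rewrite mulr2n mulrDl mul1r lerD.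
Qed.

Lemma calls_gate U p : calls (gate U p) = calls p.
Proof. by rewrite /gate; case: Bool.bool_dec. Qed.

Lemma heisenberg_only_gate T U p : heisenberg_only T (gate U p) <-> heisenberg_only T p.
Proof. by rewrite /gate; case: Bool.bool_dec. Qed.

Lemma calls_step u' K p0 p1 N : (calls p0 <= N)%N -> (calls p1 <= N)%N ->
  (calls (step u' K p0 p1) <= N + 2 * K)%N.
Proof.
move=> h0 h1; rewrite /step; elim: K => [|K IH].
  by rewrite /= muln0 addn0 !calls_gate /= !calls_gate geq_max h0 h1.
rewrite iterS /walk_step /heis /= calls_gate /= calls_gate.
by rewrite mulnS addnCA; apply: (@leq_trans (N + 2 * K).+2) => //; rewrite !ltnS.
Qed.

Lemma heisenberg_only_step T u' K p0 p1 : max_time t0 k <= T ->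
  heisenberg_only T p0 -> heisenberg_only T p1 -> heisenberg_only T (step u' K p0 p1).
Proof.
move=> hT h0 h1; rewrite /step; elim: K => [|K IH].
  by apply/heisenberg_only_gate; split; apply/heisenberg_only_gate.
rewrite iterS; split=> //; apply/heisenberg_only_gate.
by split=> //; apply/heisenberg_only_gate.
Qed.

Lemma calls_recover u' K m p N : (calls p <= N)%N ->
  (calls (recover u' K m p) <= N + m * (2 * K))%N.
Proof.
move=> h; elim: m => [|m IH] //=.
rewrite mulSn addnCA addnC; apply: calls_step => //.
by rewrite (leq_trans h) // leq_addr.
Qed.

Lemma heisenberg_only_recover T u' K m p : max_time t0 k <= T ->
  heisenberg_only T p -> heisenberg_only T (recover u' K m p).
Proof. by move=> hT h; elim: m => [|m IH] //=; apply: heisenberg_only_step. Qed.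

Lemma calls_trials u' K M m rest s cnt N : (forall c, (calls (rest c) <= N)%N) ->
  (calls (trials u' K M m rest s cnt) <= N + (M + m) * (2 * K))%N.
Proof.
move=> h; elim: m s cnt => [|m IH] s cnt /=.
  rewrite addn0; case: s; first exact: calls_recover.
  by rewrite (leq_trans (h _)) // leq_addr.
by rewrite addnS mulSn [leqRHS]addnCA [leqRHS]addnC; apply: calls_step.
Qed.

Lemma heisenberg_only_trials T u' K M m rest s cnt : max_time t0 k <= T ->
  (forall c, heisenberg_only T (rest c)) ->
  heisenberg_only T (trials u' K M m rest s cnt).
Proof.
move=> hT h; elim: m s cnt => [|m IH] s cnt /=.
  by case: s => //; exact: heisenberg_only_recover.
exact: heisenberg_only_step.
Qed.

End Builders.

(** The vector (c d, r d) has length d, and (2 e, 2 e) is shorter than 4 e. *)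
Lemma sqrt_mixing (R : rcfType) (c r d e : R) : 0 <= c -> 0 <= r ->
  c ^+ 2 + r ^+ 2 = 1 -> 0 <= d -> 0 <= e ->
  Num.sqrt ((c * d + 2 * e) ^+ 2 + (r * d + 2 * e) ^+ 2) <= d + 4 * e.
Proof.
move=> c0 r0 hc d0 e0.
have hd4 : 0 <= d + 4 * e by rewrite addr_ge0 ?mulr_ge0.
rewrite -[leRHS](ger0_norm hd4) -(sqrtr_sqr (d + 4 * e)) ler_sqrt ?sqr_ge0 //.
have -> : (c * d + 2 * e) ^+ 2 + (r * d + 2 * e) ^+ 2
   = (c ^+ 2 + r ^+ 2) * d ^+ 2 + (c + r) * (4 * (d * e)) + 8 * e ^+ 2 by ring.
rewrite hc mul1r.
have k1 : c + r <= 2 by have := sqr_ge0 (c - 1); have := sqr_ge0 (r - 1); nra.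
have k2 : 0 <= 4 * (d * e) by rewrite !mulr_ge0.
have : (c + r) * (4 * (d * e)) <= 2 * (4 * (d * e)) by rewrite ler_wpM2r.
have k4 := sqr_ge0 e.
have -> : (d + 4 * e) ^+ 2 = d ^+ 2 + 8 * (d * e) + 16 * e ^+ 2 by ring.
move: ((c + r) * _) k2 k4 => y1; move: (d * e) (e ^+ 2) (d ^+ 2) => y2 y3 y4; lra.
Qed.

(** * Failure of steps, recoveries and trials *)

Section Rules.
Variable R : realType.
Variables w b n : nat.
Local Notation C := R[i].
Local Notation prot := (protocol R w.+1 b n).
Variables (t0 : R) (k : nat) (t0_gt0 : 0 < t0) (kw : (0 < k <= w.+1)%N) (q : 'I_w.+1).
Variables (u u' : 'I_(2 ^ w.+1) -> R).
Variables (H : 'M[C]_(2 ^ n)) (V : 'M[C]_(2 ^ b * 2 ^ n)) (psi : 'cV[C]_(2 ^ n)).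
Variable good : pred R.
Hypotheses (psi1 : nsq psi = 1) (Vu : V \is unitarymx).
Hypotheses (u1 : \sum_j u j * u j = 1) (u1' : \sum_j u' j * u' j = 1).
Hypotheses (uflag : forall j, qubit (flag w) j -> u j = 0)
  (uflag' : forall j, qubit (flag w) j -> u' j = 0).
Variables (eta e : R).
Local Notation W := (heisenberg_op H V t0 k false (Some q) : operator R w.+1 b n).
Local Notation X := (embed b n u).
Local Notation X' := (embed b n u').
Hypothesis hB : nrm (X'^t* *m (W *m (X *m psi)) - (sin eta)%:C *: psi) <= e.
Hypothesis hB' : nrm (X^t* *m (W^t* *m (X' *m psi)) - (sin eta)%:C *: psi) <= e.
Hypotheses (sin_eta : 0 <= sin eta <= 4^-1) (cos_eta : 3 / 4 <= cos eta).

Local Notation N := (failure_norm H V psi good).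

Let ND (p : prot) v v' : N p (v + v') <= N p v + N p v'.
Proof. exact: failure_normD. Qed.
Let NZ (p : prot) c v : N p (c%:C *: v) = `|c| * N p v.
Proof. exact: failure_normZ. Qed.
Let Nle (p : prot) v : N p v <= nrm v.
Proof. exact: failure_norm_le. Qed.
Let N0 (p : prot) v : 0 <= N p v.
Proof. exact: failure_norm_ge0. Qed.

Lemma failure_gate U (p : prot) v : U \is unitarymx ->
  N (gate U p) v = N p (U *m v).
Proof. by rewrite /gate; case: Bool.bool_dec => // h _. Qed.

Let P := embed_proj b n u.
Let P' := W^t* *m embed_proj b n u' *m W.
Let x := X *m psi.
Let y := W^t* *m (X' *m psi).
Definition perp_state := ((cos eta)^-1)%:C *: (y - (sin eta)%:C *: x).
Let z := perp_state.
Let p := P *m y - (sin eta)%:C *: x.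
Let s := P' *m x - (sin eta)%:C *: y.

Let Wu : W \is unitarymx. Proof. exact: heisenberg_op_unitary. Qed.
Let WW : W^t* *m W = 1%:M. Proof. exact/unitaryP_left. Qed.
Let WW' : W *m W^t* = 1%:M. Proof. exact/unitarymxP. Qed.
Let hP : orthoproj P. Proof. exact: embed_orthoproj. Qed.
Let hPc : orthoproj (embed_proj b n u'). Proof. exact: embed_orthoproj. Qed.

Let hP' : orthoproj P'.
Proof.
have [h1 h2] := hPc; move: WW' h1 h2; rewrite /P'; move: W (embed_proj b n u') => U Q.
move=> UU h1 h2; split.
  by rewrite (adjmxM (U^t* *m Q) U) (adjmxM (U^t*) Q) trmxCK h1 mulmxA.
rewrite !mulmxA -(mulmxA (U^t* *m Q) U) UU mulmx1 -(mulmxA (U^t*) Q Q) h2.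
by [].
Qed.

Let Px : P *m x = x.
Proof. by rewrite /P /embed_proj /x mulmxA -(mulmxA X) embed_iso // mulmx1. Qed.

Let Py' : P' *m y = y.
Proof.
rewrite /P' /y /embed_proj; move: WW'; move: W => U UU.
rewrite -!mulmxA (mulmxA U) UU mul1mx (mulmxA (X'^t*)) embed_iso // mul1mx.
by [].
Qed.

Let yE : y = (sin eta)%:C *: x + (cos eta)%:C *: z.
Proof.
have c0 : cos eta != 0 by apply: lt0r_neq0; have h := cos_eta; lra.
rewrite /z /perp_state scalerA -rmorphM divff // rmorph1 scale1r addrC subrK.
by [].
Qed.

Let PyE : P *m y = (sin eta)%:C *: x + p. Proof. by rewrite /p addrC subrK. Qed.
Let Px'E : P' *m x = (sin eta)%:C *: y + s. Proof.
rewrite /s; move: (P' *m x) ((sin eta)%:C *: y) => a c.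
by rewrite addrC subrK.
Qed.

Let hp : nrm p <= e.
Proof.
have -> : p = X *m (X^t* *m (W^t* *m (X' *m psi)) - (sin eta)%:C *: psi).
  by rewrite /p /P /embed_proj /x mulmxBr -scalemxAr /y !mulmxA.
by rewrite nrm_iso // embed_iso.
Qed.

Let hs : nrm s <= e.
Proof.
have -> : s = W^t* *m (X' *m (X'^t* *m (W *m (X *m psi)) - (sin eta)%:C *: psi)).
  rewrite /s /P' /embed_proj /x (mulmxBr X') mulmxBr -!scalemxAr /y.
  by rewrite !mulmxA.
have h : W^t* \is unitarymx by rewrite trmxC_unitary Wu.
by rewrite (nrm_unitary _ h) nrm_iso // embed_iso.
Qed.

Let nx : nsq x = 1.
Proof. by rewrite /x nsq_iso // embed_iso. Qed.

Let ny : nsq y = 1.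
Proof.
have h : W^t* \is unitarymx by rewrite trmxC_unitary Wu.
by rewrite /y (nsq_unitary _ h) nsq_iso // embed_iso.
Qed.

Let e0 : 0 <= e. Proof. exact: le_trans (nrm_ge0 _) hB. Qed.

Local Notation M0 := (meas_proj R b n (flag w) false : operator R w.+1 b n).

Let M0x : M0 *m x = x.
Proof. by rewrite /x mulmxA meas_proj_embed. Qed.

Let M0z : M0 *m z = z.
Proof.
have h : M0 *m y = y.
  rewrite /y heisenberg_select adjmx_select mulmxA meas_proj_select -mulmxA.
  by rewrite (mulmxA M0) meas_proj_embed.
by rewrite /z /perp_state -scalemxAr mulmxBr h -scalemxAr M0x.
Qed.

Let refl_u : 1%:M - 2 *: P \is unitarymx. Proof. exact: reflection_unitary hP. Qed.
Let refl_u' : 2 *: embed_proj b n u' - 1%:M \is unitarymx.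
Proof. by rewrite -opprB; apply: unitarymxN; exact: reflection_unitary hPc. Qed.

Let walkE (v : 'cV[C]_(2 ^ w.+1 * (2 ^ b * 2 ^ n))) :
  (1%:M - 2 *: P) *m (W^t* *m ((2 *: embed_proj b n u' - 1%:M) *m (W *m v)))
  = walk_mx P P' *m v.
Proof.
rewrite /walk_mx /P'.
move: WW; move: W (embed_proj b n u') (1%:M - 2 *: P) => U Q T UU.
rewrite -(mulmxA T _ v); congr (T *m _).
rewrite (mulmxBl _ _ (U *m v)) (mulmxBl _ _ v) !mul1mx mulmxBr.
by rewrite (mulmxA (U^t*) U) UU mul1mx -!scalemxAl -scalemxAr !mulmxA.
Qed.

Lemma failure_walk K (pr : prot) v :
  N (iter K (walk_step t0_gt0 kw q u u') pr) v = N pr (iter K (mulmx (walk_mx P P')) v).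
Proof.
have E1 pr' v' : N (heis t0_gt0 kw q true pr') v' = N pr' (W^t* *m v').
  by rewrite -heisenberg_op_adj.
have E2 pr' v' : N (heis t0_gt0 kw q false pr') v' = N pr' (W *m v') by [].
elim: K v => [|K IH] v //; rewrite iterS iterSr -IH -walkE /walk_step.
by rewrite E2 (failure_gate _ _ refl_u') E1 (failure_gate _ _ refl_u).
Qed.

Let hM0 : orthoproj M0. Proof. exact: meas_proj_orthoproj. Qed.
Let M1E : meas_proj R b n (flag w) true = 1%:M - M0.
Proof. exact: (meas_proj_negb R b n (flag w) false). Qed.
Let FM : flag_flip R w b n *m M0 = meas_proj R b n (flag w) true *m flag_flip R w b n.
Proof. exact: flag_flip_meas. Qed.
Let M0P : M0 *m P = P.
Proof. by rewrite /P /embed_proj mulmxA meas_proj_embed. Qed.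

Let Fu : measure_gate b n u \is unitarymx.
Proof.
exact: (flag_gate_unitary hP (flag_flip_adj R w b n) (flag_flipK R w b n) hM0 M1E FM M0P).
Qed.

Lemma failure_measure_proj (p0 p1 : prot) v : M0 *m v = v ->
  N (measure u p0 p1) v ^+ 2 = N p0 (P *m v) ^+ 2 + N p1 (v - P *m v) ^+ 2.
Proof.
move=> hv; set G := measure_gate b n u.
have g0 : G *m (M0 *m (G *m v)) = P *m v.
  exact: (flag_gate_meas0 hP hM0 M1E FM M0P hv).
have g1 : G *m (meas_proj R b n (flag w) true *m (G *m v)) = v - P *m v.
  exact: (flag_gate_meas1 hP (flag_flipK R w b n) hM0 M1E FM M0P hv).
rewrite -g1 -g0 -(failure_gate p0 _ Fu) -(failure_gate p1 _ Fu).
rewrite /measure (failure_gate _ v Fu) -/G.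
by rewrite !sqr_failure_norm failure_measure.
Qed.

(** Each walk step costs 8 e; the remaining 4 e arise in the measurement, where P z is small but
    need not vanish. *)
Definition step_error K := (8 * K%:R + 4) * e.

(** The invariant form sqrt b + d separates the two kinds of error: b is averaged with the ideal
    probabilities cos^2 and sin^2 of the outcomes, while d merely grows by [step_error K] instead of
    being added up over the branches. *)
Let step_rule K (p0 p1 : prot) phi b0 b1 d : 0 <= b0 -> 0 <= b1 -> 0 <= d ->
  N p0 x <= Num.sqrt b0 + d -> N p1 z <= Num.sqrt b1 + d ->
  N (step t0_gt0 kw q u u' K p0 p1) (plane_vec x z phi) <=
    Num.sqrt (cos (phi + K%:R * (2 * eta)) ^+ 2 * b0
              + sin (phi + K%:R * (2 * eta)) ^+ 2 * b1) + (d + step_error K).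
Proof.
move=> hb0 hb1 hd h0 h1; rewrite /step failure_walk.
have hw := iter_walk_plane_vec hP hP' Px Py' yE PyE Px'E hp hs sin_eta cos_eta K phi.
set t := phi + _ in hw *; set v := iter _ _ _ in hw *.
have -> : v = plane_vec x z t + (v - plane_vec x z t) by rewrite addrC subrK.
apply: le_trans (ND _ _ _) _.
set rhs := Num.sqrt _.
have -> : rhs + (d + step_error K) = rhs + (d + 4 * e) + K%:R * (8 * e).
  by rewrite /step_error; move: rhs (K%:R : R) => a c; ring.
apply: lerD; last exact: le_trans (Nle _ _) hw.
rewrite {}/rhs.
have hz := nrm_proj_perp Px yE PyE hp cos_eta.
have M0v : M0 *m plane_vec x z t = plane_vec x z t.
  by rewrite mul_plane_vec M0x M0z.
have Pv : P *m plane_vec x z t = (cos t)%:C *: x + (sin t)%:C *: (P *m z).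
  by rewrite mul_plane_vec; congr (_ *: _ + _); exact: Px.
have n0 : N p0 (P *m plane_vec x z t) <= `|cos t| * Num.sqrt b0 + (`|cos t| * d + 2 * e).
  rewrite Pv; apply: le_trans (ND _ _ _) _.
  rewrite !NZ addrA -mulrDr; apply: lerD; first by rewrite ler_wpM2l.
  have h3 := le_trans (Nle p0 (P *m z)) hz.
  apply: le_trans _ h3; rewrite ler_piMl ?N0 //; exact: sin_max.
have n1 : N p1 (plane_vec x z t - P *m plane_vec x z t)
    <= `|sin t| * Num.sqrt b1 + (`|sin t| * d + 2 * e).
  have -> : plane_vec x z t - P *m plane_vec x z t
     = (sin t)%:C *: z + (sin t)%:C *: (- (P *m z)).
    by rewrite Pv /plane_vec opprD addrACA subrr add0r scalerN.
  apply: le_trans (ND _ _ _) _.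
  rewrite (NZ p1 (sin t) z) (NZ p1 (sin t)) [leRHS]addrA -[X in _ <= X + _]mulrDr.
  apply: lerD; first by rewrite ler_wpM2l.
  have h3 : N p1 (- (P *m z)) <= 2 * e.
    by apply: le_trans (Nle _ _) _; rewrite nrmN.
  apply: le_trans _ h3; rewrite ler_piMl ?N0 //; exact: sin_max.
have u0 := e0.
rewrite -(ger0_norm (N0 (measure _ _ _) _)) -sqrtr_sqr failure_measure_proj //.
have q0 : 0 <= `|cos t| * d + 2 * e by rewrite addr_ge0 ?mulr_ge0.
have q1 : 0 <= `|sin t| * d + 2 * e by rewrite addr_ge0 ?mulr_ge0.
have r0 : 0 <= `|cos t| * Num.sqrt b0 by rewrite mulr_ge0 ?sqrtr_ge0.
have r1 : 0 <= `|sin t| * Num.sqrt b1 by rewrite mulr_ge0 ?sqrtr_ge0.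
(* Minkowski's inequality splits off the ideal mixture of b0 and b1; the rest has the shape of
   [sqrt_mixing]. *)
apply: le_trans (_ : _ <= Num.sqrt
  ((`|cos t| * Num.sqrt b0 + (`|cos t| * d + 2 * e)) ^+ 2
   + (`|sin t| * Num.sqrt b1 + (`|sin t| * d + 2 * e)) ^+ 2)) _.
  rewrite ler_sqrt ?addr_ge0 ?sqr_ge0 //.
  have sq (a c : R) : 0 <= a -> a <= c -> a ^+ 2 <= c ^+ 2.
    by move=> ha hac; rewrite ler_sqr ?nnegrE // (le_trans ha).
  by apply: lerD; apply: sq; [exact: N0 | exact: n0 | exact: N0 | exact: n1].
apply: le_trans (minkowski2 r0 r1 q0 q1) _; apply: lerD.
  by rewrite !exprMn !real_normK ?num_real // !sqr_sqrtr.
have hc := cos2Dsin2 t.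
apply: sqrt_mixing => //.
by rewrite !real_normK ?num_real.
Qed.

Let nz : nrm z <= 1 + e.
Proof. exact: (nrm_plane_perp hP Px yE PyE hp sin_eta cos_eta nx ny). Qed.

Variables (K : nat) (F : R).
Hypothesis FE : F = sin (K%:R * (2 * eta)) ^+ 2.

Let CE : cos (K%:R * (2 * eta)) ^+ 2 = 1 - F.
Proof. by rewrite FE cos2sin2. Qed.

Let F01 : 0 <= F /\ 0 <= 1 - F.
Proof. by rewrite -CE FE; split; exact: sqr_ge0. Qed.

Let step_x (p0 p1 : prot) b0 b1 d : 0 <= b0 -> 0 <= b1 -> 0 <= d ->
  N p0 x <= Num.sqrt b0 + d -> N p1 z <= Num.sqrt b1 + d ->
  N (step t0_gt0 kw q u u' K p0 p1) x
    <= Num.sqrt ((1 - F) * b0 + F * b1) + (d + step_error K).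
Proof.
move=> hb0 hb1 hd h0 h1; have := step_rule K 0 hb0 hb1 hd h0 h1.
by rewrite plane_vec0 add0r -FE CE.
Qed.

(** The partner sits at angle pi / 2, so the same rotation exchanges the roles of cos^2 and sin^2,
    and a flip has probability F again. *)
Let step_z (p0 p1 : prot) b0 b1 d : 0 <= b0 -> 0 <= b1 -> 0 <= d ->
  N p0 x <= Num.sqrt b0 + d -> N p1 z <= Num.sqrt b1 + d ->
  N (step t0_gt0 kw q u u' K p0 p1) z
    <= Num.sqrt (F * b0 + (1 - F) * b1) + (d + step_error K).
Proof.
move=> hb0 hb1 hd h0 h1; have := step_rule K (pi / 2) hb0 hb1 hd h0 h1.
by rewrite plane_vec_pihalf (addrC (pi / 2)) cosDpihalf sinDpihalf sqrrN -FE CE.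
Qed.

Let step_error_ge0 : 0 <= step_error K.
Proof. by rewrite /step_error mulr_ge0 ?addr_ge0 ?mulr_ge0 // e0. Qed.

(** An attempt succeeds with probability F, and the recursion b -> F b0 + (1 - F) b takes b0 + (1 -
    F)^m to b0 + (1 - F)^(m + 1). *)
Let recover_rule m (rest : prot) b0 d : 0 <= b0 -> 0 <= d ->
  N rest x <= Num.sqrt b0 + d ->
  N (recover t0_gt0 kw q u u' K m rest) z
    <= Num.sqrt (b0 + (1 - F) ^+ m) + (d + m%:R * step_error K + e).
Proof.
have [F0 F1] := F01; have u0 := e0; have k0 := step_error_ge0.
have mk i : 0 <= i%:R * step_error K by apply: mulr_ge0 (ler0n _ _) k0.
move=> hb0 hd h; elim: m => [|m IH].
  (* With no attempt left everything counts as failed; the bound 1 + e on the norm of z is the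
     origin of the summand e. *)
  rewrite /recover expr0 mul0r addr0; apply: le_trans (Nle _ _) _.
  apply: le_trans nz _; rewrite lerD //; last by rewrite lerDr.
  have h1 : 1 <= b0 + 1 by rewrite lerDr.
  have : Num.sqrt 1 <= Num.sqrt (b0 + 1) by rewrite ler_sqrt // (le_trans ler01 h1).
  by rewrite sqrtr1.
have pm : 0 <= (1 - F) ^+ m by exact: exprn_ge0.
have hd' : 0 <= d + m%:R * step_error K + e by apply: addr_ge0 u0; exact: addr_ge0.
have h' : N rest x <= Num.sqrt b0 + (d + m%:R * step_error K + e).
  by apply: le_trans h _; rewrite lerD2l -addrA lerDl addr_ge0.
have := step_z hb0 (addr_ge0 hb0 pm) hd' h' IH.
rewrite [F * b0 + _](_ : _ = b0 + (1 - F) ^+ m.+1); last first.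
  by rewrite exprS; move: (_ ^+ m) => y'; ring.
rewrite [_ + step_error K](_ : _ = d + m.+1%:R * step_error K + e) //.
by rewrite -natr1; move: (step_error K) (m%:R : R) => a c; ring.
Qed.

(* [lam] weighs the number of flips exponentially, as in Chernoff's bound. *)
Lemma trials_rule M m (rest : nat -> prot) b0 d Th lam :
  0 <= b0 -> 0 <= d -> 0 <= Th -> 0 <= lam ->
  (forall cnt, N (rest cnt) x <= Num.sqrt (b0 + Th * lam ^+ cnt) + d) ->
  N (trials t0_gt0 kw q u u' K M m rest false 0) x
    <= Num.sqrt (b0 + (1 - F) ^+ M + Th * (1 - F + F * lam) ^+ m)
       + (d + (M + m)%:R * step_error K + e).
Proof.
have [F0 F1] := F01; have u0 := e0; have k0 := step_error_ge0.
have mk i : 0 <= i%:R * step_error K by apply: mulr_ge0 (ler0n _ _) k0.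
move=> hb0 hd hT hl h.
(* Induction on the trials left, from either state and any count: a trial multiplies lam ^+ cnt by 1
   with probability 1 - F and by lam with probability F. *)
suff hg : forall s0 cnt, N (trials t0_gt0 kw q u u' K M m rest s0 cnt) (if s0 then z else x)
    <= Num.sqrt (b0 + (1 - F) ^+ M + Th * lam ^+ cnt * (1 - F + F * lam) ^+ m)
       + (d + (M + m)%:R * step_error K + e).
  by have := hg false 0%N; rewrite expr0 mulr1.
have pM : 0 <= (1 - F) ^+ M by exact: exprn_ge0.
have pl i : 0 <= Th * lam ^+ i by rewrite mulr_ge0 ?exprn_ge0.
have pmu : 0 <= 1 - F + F * lam by rewrite addr_ge0 ?mulr_ge0.
elim: m => [|m IH] s0 cnt.
  rewrite expr0 mulr1 addn0 /=; case: s0.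
    by have := recover_rule M (addr_ge0 hb0 (pl cnt)) hd (h cnt); rewrite addrAC.
  apply: le_trans (h cnt) _; apply: lerD; last first.
    by rewrite -addrA lerDl addr_ge0.
  by rewrite ler_sqrt ?addr_ge0 // lerD2r lerDl.
set B := fun i => b0 + (1 - F) ^+ M + Th * lam ^+ i * (1 - F + F * lam) ^+ m.
have B0 i : 0 <= B i by rewrite !addr_ge0 // mulr_ge0 // exprn_ge0.
have hd' : 0 <= d + (M + m)%:R * step_error K + e by apply: addr_ge0 u0; exact: addr_ge0.
have -> : d + (M + m.+1)%:R * step_error K + e
    = d + (M + m)%:R * step_error K + e + step_error K.
  by rewrite addnS -natr1; move: (step_error K) ((M + m)%:R : R) => a c; ring.
have -> : b0 + (1 - F) ^+ M + Th * lam ^+ cnt * (1 - F + F * lam) ^+ m.+1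
    = (1 - F) * B cnt + F * B cnt.+1.
  rewrite /B !exprS; move: (_ ^+ M) (lam ^+ cnt) (_ ^+ m) => y1 y2 y3; ring.
case: s0 => /=.
  have := step_z (B0 cnt.+1) (B0 cnt) hd' (IH false cnt.+1) (IH true cnt).
  by rewrite addn1 addn0 [(1 - F) * B cnt + _]addrC.
have := step_x (B0 cnt) (B0 cnt.+1) hd' (IH false cnt) (IH true cnt.+1).
by rewrite addn1 addn0.
Qed.

End Rules.

(** * Amplitudes and tail bounds *)

Lemma sum_amp (T : nmodType) k (F : nat -> T) : (0 < k)%N ->
  (forall j, (1 < j < 2 ^ k)%N -> F j = 0) ->
  (forall j, (2 ^ k.+1 <= j)%N -> F j = 0) ->
  \sum_(j < 2 ^ k.+2) F j = F 0%N + F 1%N + \sum_(i < 2 ^ k) F (2 ^ k + i)%N.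
Proof.
move=> k0 h1 h2; rewrite -(big_mkord xpredT F).
have k2 : (2 <= 2 ^ k)%N by rewrite -[X in (X <= _)%N]expn1 leq_exp2l.
have kS : (2 ^ k.+1 = 2 ^ k + 2 ^ k)%N by rewrite expnS mul2n addnn.
rewrite (big_cat_nat (n := 2 ^ k.+1)) ?leq_exp2l //=.
rewrite [X in _ + X]big_nat_cond [X in _ + X]big1 ?addr0; last first.
  by move=> j /andP[/andP[hj _] _]; exact: h2.
rewrite (big_cat_nat (n := 2 ^ k)) ?leq_exp2l //=; congr (_ + _).
  rewrite (big_cat_nat (n := 2)) //= [X in _ + X]big_nat_cond [X in _ + X]big1 ?addr0.
    by rewrite !big_nat_recr //= big_geq // add0r.
  by move=> j /andP[hj _]; exact: h1.
rewrite -{1}[(2 ^ k)%N]add0n big_addn kS addnK big_mkord.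
by apply: eq_bigr => i _; rewrite addnC.
Qed.

Section Amplitudes.
Variable R : realType.
Variables (k : nat) (f : nat -> R).
Hypotheses (k0 : (0 < k)%N) (f0 : forall i, 0 <= f i).

(** The low k bits are the time register, bit k is the control and bit k + 1 the flag. Entries 0 and
    1 have the control off: one carries the shift, the other provides normalization. The block with
    the control on holds square roots, so that products of two such vectors reproduce the filter
    f. *)
Definition amp (a0 a1 a2 : R) (j : nat) : R :=
  if j == 0%N then a0 else if j == 1%N then a1 else
  if (2 ^ k <= j < 2 ^ k.+1)%N then a2 * Num.sqrt (f (j - 2 ^ k)) else 0.

Lemma amp_mid a0 a1 a2 j : (1 < j < 2 ^ k)%N -> amp a0 a1 a2 j = 0.
Proof. by case: j => [|[|j]] // /andP[_ h]; rewrite /amp /= leqNgt h. Qed.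

Lemma amp_hi a0 a1 a2 j : (2 ^ k.+1 <= j)%N -> amp a0 a1 a2 j = 0.
Proof.
move=> h; rewrite /amp ltnNge h andbF.
have h1 : (1 < 2 ^ k.+1)%N by rewrite -[X in (X < _)%N](expn0 2) ltn_exp2l.
by have := leq_trans h1 h; case: j {h} => [|[|j]].
Qed.

Lemma amp_time a0 a1 a2 i : (i < 2 ^ k)%N ->
  amp a0 a1 a2 (2 ^ k + i) = a2 * Num.sqrt (f i).
Proof.
move=> hi; have k2 : (2 <= 2 ^ k)%N by rewrite -[X in (X <= _)%N]expn1 leq_exp2l.
have h : (1 < 2 ^ k + i)%N by rewrite (leq_trans k2) // leq_addr.
rewrite /amp; case: eqP h => [->//|_ h]; case: eqP h => [->//|_ h].
by rewrite leq_addr expnS mul2n -addnn ltn_add2l hi addnC addnK.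
Qed.

Lemma amp_timeM a0 a1 a2 c0 c1 c2 i : (i < 2 ^ k)%N ->
  amp a0 a1 a2 (2 ^ k + i) * amp c0 c1 c2 (2 ^ k + i) = a2 * c2 * f i.
Proof. by move=> h; rewrite !amp_time // mulrACA -expr2 sqr_sqrtr. Qed.

Lemma sum_ampM a0 a1 a2 c0 c1 c2 : \sum_(i < 2 ^ k) f i = 1 ->
  \sum_(j < 2 ^ k.+2) amp a0 a1 a2 j * amp c0 c1 c2 j = a0 * c0 + a1 * c1 + a2 * c2.
Proof.
move=> f1; rewrite (sum_amp (F := fun j => amp a0 a1 a2 j * amp c0 c1 c2 j)) //.
- congr (_ + _); rewrite (eq_bigr (fun i : 'I_(2 ^ k) => a2 * c2 * f i)).
    by rewrite -mulr_sumr f1 mulr1.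
  by move=> i _; exact: amp_timeM.
- by move=> j h; rewrite amp_mid // mul0r.
- by move=> j h; rewrite amp_hi // mul0r.
Qed.

End Amplitudes.

(** * Exponential moments of the number of flips *)

Section Chernoff.
Variable R : realType.

(** From exp (- y) >= 1 - y one gets exp y <= 1 / (1 - y), which is at most 1 + y + 2 y^2 for |y| <=
    1/2. *)
Lemma expR_le_quadratic (y : R) : `|y| <= 2^-1 -> expR y <= 1 + y + 2 * y ^+ 2.
Proof.
rewrite ler_norml => /andP[y1 y2].
have h := expR_ge1Dx (- y); have p := expR_gt0 y.
have : expR y * expR (- y) = 1 by rewrite -expRD subrr expR0.
move: (expR y) (expR (- y)) p h => u v u0 hv huv.
have h1 : u * (1 - y) <= 1 by rewrite -[leRHS]huv; apply: ler_wpM2l => //; exact: ltW u0.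
have h2 : 0 < 1 - y by lra.
have h3 : 1 <= (1 + y + 2 * y ^+ 2) * (1 - y).
  have := sqr_ge0 y; nra.
by rewrite -(ler_pM2r h2) (le_trans h1).
Qed.

(** The moment generating function of a Bernoulli variable of mean F, centered at the threshold tau;
    its second moment about tau is at most 1. *)
Lemma chernoff_factor (F tau h : R) : 0 <= F <= 1 -> 0 <= tau <= 1 -> `|h| <= 2^-1 ->
  expR (- (h * tau)) * (1 - F + F * expR h) <= 1 + h * (F - tau) + 2 * h ^+ 2.
Proof.
move=> /andP[F0 F1] /andP[t0 t1] hh.
have -> : expR (- (h * tau)) * (1 - F + F * expR h)
   = (1 - F) * expR (- (h * tau)) + F * expR (h * (1 - tau)).
  have -> : h * (1 - tau) = - (h * tau) + h by ring.
  by rewrite expRD; move: (expR _) (expR _) => u v; ring.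
have h1 : expR (- (h * tau)) <= 1 + - (h * tau) + 2 * (- (h * tau)) ^+ 2.
  apply: expR_le_quadratic; rewrite normrN normrM; apply: le_trans hh.
  by rewrite ler_piMr // ger0_norm.
have h2 : expR (h * (1 - tau)) <= 1 + h * (1 - tau) + 2 * (h * (1 - tau)) ^+ 2.
  apply: expR_le_quadratic; rewrite normrM; apply: le_trans hh.
  by rewrite ler_piMr // ger0_norm; lra.
have p1 : (1 - F) * expR (- (h * tau)) <= (1 - F) * (1 + - (h * tau) + 2 * (- (h * tau)) ^+ 2).
  by rewrite ler_wpM2l // subr_ge0.
have p2 : F * expR (h * (1 - tau)) <= F * (1 + h * (1 - tau) + 2 * (h * (1 - tau)) ^+ 2).
  by rewrite ler_wpM2l.
apply: le_trans (lerD p1 p2) _.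
have h20 : 0 <= h ^+ 2 := sqr_ge0 h.
have q1 : (1 - F) * tau ^+ 2 + F * (1 - tau) ^+ 2 <= 1 by nra.
have -> : (1 - F) * (1 + - (h * tau) + 2 * (- (h * tau)) ^+ 2)
    + F * (1 + h * (1 - tau) + 2 * (h * (1 - tau)) ^+ 2)
  = 1 + h * (F - tau) + 2 * (h ^+ 2 * ((1 - F) * tau ^+ 2 + F * (1 - tau) ^+ 2)) by ring.
by rewrite lerD2l ler_wpM2l // ler_piMr.
Qed.

(** The minimum over h of 1 - h / 80 + 2 h^2, attained at h = 1/320: the decay per trial when F is
    1/80 away from the threshold. *)
Definition rho : R := 1 - 2^-1 * (160^-1 * 160^-1).

Lemma rho01 : 0 <= rho < 1.
Proof. by rewrite /rho; apply/andP; split; lra. Qed.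

Lemma rho_exp (F : R) M : 0 <= F <= 1 -> 9 / 100 <= F -> (1 - F) ^+ M <= rho ^+ M.
Proof.
move=> /andP[F0 F1] F9; have /andP[r0 _] := rho01.
have h : 1 - F <= rho by rewrite /rho; lra.
by apply: lerXn2r h; rewrite nnegrE // subr_ge0.
Qed.

Lemma failure_step (b0 b1 y1 y2 y3 : R) :
  y1 <= y3 -> y2 <= y3 -> y3 + y3 <= b1 - b0 -> b0 + y1 + y2 <= b1.
Proof. lra. Qed.

(* [Th * lam ^+ cnt] bounds the indicator of the wrong side of the threshold. *)
Lemma chernoff_weights (F tau : R) (M : nat) (high : bool) :
  0 <= F <= 1 -> 0 <= tau <= 1 ->
  (if high then tau + 80^-1 <= F else F <= tau - 80^-1) ->
  exists Th lam : R, [/\ 0 <= Th, 0 <= lam,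
    Th * (1 - F + F * lam) ^+ M <= rho ^+ M &
    forall cnt : nat, (tau * M%:R <= cnt%:R) != high -> 1 <= Th * lam ^+ cnt].
Proof.
move=> hF ht hFt.
(* The sign makes the weight lam ^+ cnt increase towards the wrong side of the threshold. *)
pose h : R := if high then - 320^-1 else 320^-1.
exists (expR (- (h * tau)) ^+ M), (expR h); split.
- by rewrite exprn_ge0 // expR_ge0.
- exact: expR_ge0.
- rewrite -exprMn; apply: lerXn2r; rewrite ?nnegrE.
  + rewrite mulr_ge0 ?expR_ge0 //; case/andP: hF => F0 F1.
    by rewrite addr_ge0 ?subr_ge0 // mulr_ge0 // expR_ge0.
  + by case/andP: rho01.
  + apply: le_trans (chernoff_factor hF ht _) _.
      by rewrite /h; clear h hFt; case: high; rewrite ?normrN ger0_norm; lra.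
    by rewrite /rho /h; clear h; case: high hFt => hFt; lra.
- move=> cnt hc; rewrite -!expRM_natl -expRD -[X in X <= _]expR0 ler_expR.
  have -> : M%:R * - (h * tau) + cnt%:R * h = h * (cnt%:R - tau * M%:R).
    by move: (M%:R : R) (cnt%:R : R) => x y; ring.
  rewrite /h; clear h hFt; case: high hc => /=.
    rewrite eqb_id -ltNge => /ltW hc.
    by rewrite mulNr oppr_ge0 mulr_ge0_le0 ?invr_ge0 // subr_le0.
  by rewrite eqbF_neg negbK => hc; rewrite mulr_ge0 ?invr_ge0 // subr_ge0.
Qed.

End Chernoff.

(** * The matrix element encoded by a Heisenberg call *)

Section BlockState.
Variable R : realType.
Local Notation C := R[i].
Variables (n b k L m : nat) (t0 : R).
Variables (H A : 'M[C]_(2 ^ n)) (V : 'M[C]_(2 ^ b * 2 ^ n)) (E : nat -> R)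
  (psi : nat -> 'cV[C]_(2 ^ n)).
Hypothesis HE : eigendecomposition H E psi.
Hypothesis AH : A^t* = A.
Hypothesis VA : block_encoding V A.
Hypotheses (k0 : (0 < k)%N) (L0 : (0 < L)%N) (Lmk : (L.-1 * m < 2 ^ k)%N).
Hypothesis gap : forall j, (0 < j < 2 ^ n)%N ->
  [/\ 0 < (E j - E 0%N) * t0, (E j - E 0%N) * t0 <= 1
    & 8 <= L%:R * ((E j - E 0%N) * t0)].
Local Notation psi0 := (psi 0%N).

Definition ctrl_qubit : 'I_k.+2 := Ordinal (leqnSn k.+1).

Local Notation W := (heisenberg_op H V t0 k false (Some ctrl_qubit)).

Lemma block_encoding_contract (v : 'cV[C]_(2 ^ n)) : nrm (A *m v) <= nrm v.
Proof.
have [Vu <-] := VA; set J := inject0 R b n; have JJ : J^t* *m J = 1%:M := inject0_gram R b n.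
have hJ x : nrm (J^t* *m x) <= nrm x.
  rewrite -(nrm_iso (J^t* *m x) JJ) mulmxA; apply: nrm_orthoproj; split.
    by rewrite (adjmxM J) trmxCK.
  by rewrite mulmxA -(mulmxA J) JJ mulmx1.
rewrite -!mulmxA; apply: le_trans (hJ _) _.
by rewrite (nrm_unitary _ Vu) (nrm_iso _ JJ).
Qed.

Let psi1 : nsq psi0 = 1. Proof. by apply: eigendecomposition_nsq HE _ _; rewrite expn_gt0. Qed.

Lemma nrm_A_psi0 : nrm (A *m psi0) <= 1.
Proof. by apply: le_trans (block_encoding_contract _) _; rewrite /nrm psi1 sqrtr1. Qed.

Lemma expectation_le1 : `|expectation A psi0| <= 1.
Proof.
have -> : expectation A psi0 = rdot psi0 (A *m psi0) by rewrite /expectation /rdot mulmxA.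
apply: le_trans (rdot_le _ _) _; rewrite {1}/nrm psi1 sqrtr1 mul1r.
exact: nrm_A_psi0.
Qed.

Definition heis_state (j : nat) : 'cV[C]_(2 ^ n) :=
  let t := grid_time t0 k (j %% 2 ^ k) in
  if odd (j %/ 2 ^ k) then evolution H t *m (A *m (evolution H (- t) *m psi0))
  else psi0.

Section Amp.
Variables u u' : 'I_(2 ^ k.+2) -> R.

Let B := \sum_j (u' j * u j)%:C *:
  ((inject0 R b n)^t* *m heis_block H V t0 k ctrl_qubit j *m inject0 R b n).

Let BE : (embed b n u')^t* *m (W *m embed b n u) = B.
Proof. by rewrite heisenberg_select embed_select. Qed.

(** The weights are real and all blocks are Hermitian, so <u'| W |u> and <u| W^* |u'> are the same
    operator and one estimate serves both directions. *)
Let B_adj : B^t* = B.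
Proof.
rewrite /B adjmx_sum; apply: eq_bigr => j _; rewrite adjmxZr; congr (_ *: _).
rewrite (heis_blockE _ _ _ _ VA); case: ifP => _; last exact: adjmx1.
set t := grid_time _ _ _.
by rewrite (adjmxM (evolution H t *m A)) (adjmxM _ A) AH evolutionN trmxCK mulmxA.
Qed.

Let B_psi : B *m psi0 = \sum_j (u' j * u j)%:C *: heis_state j.
Proof.
rewrite /B mulmx_suml; apply: eq_bigr => j _; rewrite -scalemxAl; congr (_ *: _).
rewrite (heis_blockE _ _ _ _ VA) /heis_state /qubit /=.
by case: ifP => _; rewrite ?mul1mx // !mulmxA.
Qed.

Lemma embed_heis_psi :
  (embed b n u')^t* *m (W *m (embed b n u *m psi0)) = \sum_j (u' j * u j)%:C *: heis_state j.
Proof. by rewrite -B_psi -BE !mulmxA. Qed.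

Lemma embed_heis_adj_psi :
  (embed b n u)^t* *m (W^t* *m (embed b n u' *m psi0))
  = \sum_j (u' j * u j)%:C *: heis_state j.
Proof.
rewrite -B_psi -B_adj -BE; move: W => U.
by rewrite (adjmxM _ (U *m _)) (adjmxM U) trmxCK !mulmxA.
Qed.

End Amp.

(** A rational unit vector, completed by [uvec']: the products 3/5 * 5 c / 48 = c / 16 and 4/5 *
    5/64 = 1/16 give the shift and the scale. Entry 1 vanishes here, so the normalizing entry of
    [uvec'] drops out of the overlap. *)
Definition uvec (j : 'I_(2 ^ k.+2)) : R := amp k (filt R L m) (3 / 5) 0 (4 / 5) j.

(* With [uvec] on the right these amplitudes encode [(A - c) / 16]. *)
Definition uvec' (c : R) (j : 'I_(2 ^ k.+2)) : R :=
  amp k (filt R L m) (- (5 * c / 48))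
    (Num.sqrt (1 - (5 * c / 48) ^+ 2 - (5 / 64) ^+ 2)) (5 / 64) j.

Let f0 i : 0 <= filt R L m i. Proof. exact: filt_ge0. Qed.
Let f1 : \sum_(i < 2 ^ k) filt R L m i = 1. Proof. exact: filt_sum. Qed.

Lemma uvec_unit : \sum_j uvec j * uvec j = 1.
Proof. by rewrite (sum_ampM k0 f0 _ _ _ _ _ _ f1); field. Qed.

(** The shifts that occur are l - r, with l >= -1 and r <= 2; on [-3, 3] the radicand is
    positive. *)
Lemma uvec_unit' c : `|c| <= 3 -> \sum_j uvec' c j * uvec' c j = 1.
Proof.
rewrite ler_norml => /andP[c1 c2].
rewrite (sum_ampM k0 f0 _ _ _ _ _ _ f1) -[X in _ + X + _]expr2 sqr_sqrtr; first by ring.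
nra.
Qed.

Lemma uvec_flag j : qubit (flag k.+1) j -> uvec j = 0.
Proof. by rewrite qubit_flag => h; exact: amp_hi. Qed.

Lemma uvec_flag' c j : qubit (flag k.+1) j -> uvec' c j = 0.
Proof. by rewrite qubit_flag => h; exact: amp_hi. Qed.

Lemma sum_heis_state c : \sum_j (uvec' c j * uvec j)%:C *: heis_state j
  = (- (c / 16))%:C *: psi0 + (16^-1)%:C *: \sum_(i < 2 ^ k) (filt R L m i)%:C *:
     (evolution H (t0 * (i%:R - (2 ^ k.-1)%:R)) *m
       (A *m (evolution H (- (t0 * (i%:R - (2 ^ k.-1)%:R))) *m psi0))).
Proof.
pose F (j : nat) := (amp k (filt R L m) (- (5 * c / 48))
    (Num.sqrt (1 - (5 * c / 48) ^+ 2 - (5 / 64) ^+ 2)) (5 / 64) j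
    * amp k (filt R L m) (3 / 5) 0 (4 / 5) j)%:C *: heis_state j.
rewrite (sum_amp (F := F) k0) /F.
- rewrite [X in _ + X + _](_ : _ = 0) ?addr0; last by rewrite /amp /= mulr0 scale0r.
  congr (_ + _).
    by rewrite /amp /= /heis_state div0n /=; congr (_%:C *: _); field.
  rewrite scaler_sumr; apply: eq_bigr => i _.
  rewrite amp_timeM // scalerA -rmorphM; congr (_%:C *: _); first by field.
  have p0 : (0 < 2 ^ k)%N by rewrite expn_gt0.
  have d1 : ((2 ^ k + i) %/ 2 ^ k = 1)%N.
    by rewrite -[X in (X + i)%N]mul1n divnMDl // divn_small.
  have d2 : ((2 ^ k + i) %% 2 ^ k = i)%N by rewrite modnDl modn_small.
  rewrite /heis_state d1 d2 /grid_time; reflexivity.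
- by move=> j h; rewrite amp_mid // mul0r scale0r.
- by move=> j h; rewrite amp_hi // mul0r scale0r.
Qed.

Lemma block_state c :
  nrm (\sum_j (uvec' c j * uvec j)%:C *: heis_state j
       - ((expectation A psi0 - c) / 16)%:C *: psi0) <= 2^-1 ^+ m.
Proof.
rewrite sum_heis_state; set S := \sum_(i < _) _; set a := expectation A psi0.
have hS := filtered_observable HE AH L0 Lmk gap (2 ^ k.-1)%:R.
rewrite -/S -/a in hS.
have -> : (- (c / 16))%:C *: psi0 + (16^-1)%:C *: S - ((a - c) / 16)%:C *: psi0
   = (16^-1)%:C *: (S - a%:C *: psi0).
  have -> : (a - c) / 16 = - (c / 16) + 16^-1 * a by field.
  have gen (x y z : 'cV[C]_(2 ^ n)) : x + y - (x + z) = y - z.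
    by rewrite opprD addrACA subrr add0r.
  by rewrite rmorphD scalerDl rmorphM -scalerA scalerBr gen.
rewrite nrmZ ger0_norm ?invr_ge0 //.
have h1 := nrm_A_psi0; have p0 : 0 <= 2^-1 ^+ m :> R by rewrite exprn_ge0 ?invr_ge0.
have h2 : nrm (S - a%:C *: psi0) <= 2^-1 ^+ m.
  by apply: le_trans hS _; rewrite ler_piMr.
by move: (nrm _) (_ ^+ m) (nrm_ge0 (S - a%:C *: psi0)) h2 p0 => x y x0 xy y0; lra.
Qed.

End BlockState.

(** * Refining the interval *)

(** A stage of M trials and M recovery attempts has 2 M steps and one extra e, and 2 M (8 K + 4) + 1
    <= 25 M K. *)
Lemma error_step (R : realType) (c M K : nat) (e : R) : 0 <= e -> (0 < M)%N -> (0 < K)%N ->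
  25 * c%:R * e + (M + M)%:R * ((8 * K%:R + 4) * e) + e <= 25 * (c + M * K)%:R * e.
Proof.
move=> e0 hM hK; rewrite !natrD natrM.
have m1 : 1 <= M%:R :> R by rewrite ler1n.
have k1 : 1 <= K%:R :> R by rewrite ler1n.
move: (c%:R : R) (M%:R : R) (K%:R : R) m1 k1 => x m k m1 k1.
have h0 : 0 <= m * e by rewrite mulr_ge0 // (le_trans ler01).
have h1 : 0 <= (k - 1) * (m * e) by rewrite mulr_ge0 // subr_ge0.
have h2 : 0 <= (m - 1) * e by rewrite mulr_ge0 // subr_ge0.
have -> : 25 * (x + m * k) * e = 25 * x * e + (m + m) * ((8 * k + 4) * e) + e
  + (9 * ((k - 1) * (m * e)) + (m - 1) * e) by ring.
by rewrite lerDl addr_ge0 // mulr_ge0.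
Qed.

Section Stage.
Variable R : realType.
Local Notation C := R[i].
Variables (n b k L m : nat) (t0 : R) (t0_gt0 : 0 < t0) (k0 : (0 < k)%N).
Variables (C0 Ld : nat) (r0 : R).

Fact time_register_le : (0 < k <= k.+2)%N.
Proof. by rewrite k0 /= -addn2 leq_addr. Qed.

Definition radius i : R := r0 * (3 / 2) ^+ i.
(** C0 is such that C0 trials gain a factor 1/4. The term i makes the failures of the stages
    summable; it grows only linearly, while the length of a step shrinks like (2/3)^i. *)
Definition reps i : nat := (C0 * (Ld + i))%N.
Definition iters i : nat := Num.truncn (4 / radius i).
(** The amplitudes r / 12 and 5 r / 48 belong to a = l + r / 3 and a = l + 2 r / 3, by (a - c) / 16
    with c = l - r. The midpoint stays 1/80 away from the flip probability whenever a is in an outer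
    third. *)
Definition threshold i : R :=
  (flip_prob (iters i)%:R (5 * radius i / 48) + flip_prob (iters i)%:R (radius i / 12)) / 2.

(* With [i] stages to go, the expectation is known to lie in [l, l + radius i]. *)
Fixpoint stage i (l : R) : protocol R k.+2 b n :=
  if i is j.+1 then
    trials t0_gt0 time_register_le (ctrl_qubit k) (uvec R L m)
      (uvec' L m (l - radius i)) (iters i) (reps i) (reps i)
      (fun cnt => stage j (if threshold i * (reps i)%:R <= cnt%:R
                           then l + radius i / 3 else l)) false 0
  else Output _ _ _ (l + r0 / 2).

Fixpoint cost i : nat := if i is j.+1 then (cost j + reps i * iters i)%N else 0.

Lemma calls_stage i l : (calls (stage i l) <= 4 * cost i)%N.
Proof.
elim: i l => [|i IH] l //=.
have e : (4 * (reps i.+1 * iters i.+1) = (reps i.+1 + reps i.+1) * (2 * iters i.+1))%N.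
  by rewrite addnn -mul2n mulnACA.
by rewrite mulnDr e; apply: calls_trials => c; exact: IH.
Qed.

Lemma heisenberg_only_stage T i l : max_time t0 k <= T -> heisenberg_only T (stage i l).
Proof.
by move=> hT; elim: i l => [|i IH] l //=; apply: heisenberg_only_trials.
Qed.

Section Correctness.
Variables (H A : 'M[C]_(2 ^ n)) (V : 'M[C]_(2 ^ b * 2 ^ n)) (E : nat -> R)
  (psi : nat -> 'cV[C]_(2 ^ n)) (eps : R).
Hypothesis HE : eigendecomposition H E psi.
Hypothesis AH : A^t* = A.
Hypothesis VA : block_encoding V A.
Hypotheses (L0 : (0 < L)%N) (Lmk : (L.-1 * m < 2 ^ k)%N).
Hypothesis gap : forall j, (0 < j < 2 ^ n)%N ->
  [/\ 0 < (E j - E 0%N) * t0, (E j - E 0%N) * t0 <= 1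
    & 8 <= L%:R * ((E j - E 0%N) * t0)].
Hypotheses (r0_gt0 : 0 < r0) (r0_eps : r0 / 2 <= eps).
Hypotheses (C0_gt0 : (0 < C0)%N) (Ld_gt0 : (0 < Ld)%N) (rhoC0 : rho R ^+ C0 <= 4^-1).
Local Notation psi0 := (psi 0%N).
Local Notation a := (expectation A psi0).
Local Notation N := (failure_norm H V psi0 (fun y => `|y - a| <= eps)).
Local Notation x := (embed b n (uvec R L m) *m psi0 : 'cV[C]_(2 ^ k.+2 * (2 ^ b * 2 ^ n))).
Local Notation e := (2^-1 ^+ m : R).

Let psi1 : nsq psi0 = 1. Proof. by apply: eigendecomposition_nsq HE _ _; rewrite expn_gt0. Qed.
Let Vu : V \is unitarymx. Proof. by case: VA. Qed.

Lemma radius_gt0 i : 0 < radius i.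
Proof. by rewrite mulr_gt0 // exprn_gt0 // divr_gt0. Qed.

Lemma radiusS i : radius i.+1 = 3 / 2 * radius i.
Proof. by rewrite /radius exprS mulrCA. Qed.

(** As 4 / r >= 2, truncation keeps at least two thirds of it. *)
Lemma iters_bounds i : radius i <= 2 ->
  [/\ 0 < radius i, radius i <= 2, 0 <= (iters i)%:R :> R,
      8 / 3 <= (iters i)%:R * radius i & (iters i)%:R * radius i <= 4].
Proof.
move=> r2; have rp := radius_gt0 i.
have q0 : 0 <= 4 / radius i by rewrite divr_ge0 // ltW.
have q2 : 2 <= 4 / radius i by rewrite ler_pdivlMr //; lra.
have /andP[] := truncn_itv q0; rewrite -/(iters i).
rewrite ler_pdivlMr // ltr_pdivrMr // -[(iters i).+1%:R]natr1 => h1 h2.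
have h3 : (2 <= iters i)%N by rewrite /iters truncn_ge_nat.
have h4 : 2 <= (iters i)%:R :> R by rewrite ler_nat.
split=> //; move: ((iters i)%:R : R) (radius i) h1 h2 h4 rp => t r h1 h2 h4 rp.
have : 0 <= (t - 2) * r by rewrite mulr_ge0 ?subr_ge0 // ltW.
move: h2; rewrite mulrBl mulrDl mul1r; move: (t * r) => y; lra.
Qed.

Lemma iters_gt0 i : radius i <= 2 -> (0 < iters i)%N.
Proof.
move=> /iters_bounds[_ _ _ h _]; rewrite lt0n; apply/eqP => h0.
by move: h; rewrite h0 mul0r; lra.
Qed.

Lemma N_output l : `|l - a| <= eps -> N (Output k.+2 b n l) x = 0.
Proof.
move=> h; rewrite /failure_norm failure_output /leaf_failure h sysproj_embed //.
by rewrite subrr nsq0 sqrtr0.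
Qed.

Lemma N_le1 p : N p x <= 1.
Proof.
apply: le_trans (failure_norm_le _ _ psi1 Vu _ _) _.
by rewrite nrm_iso ?embed_iso ?uvec_unit // /nrm psi1 sqrtr1.
Qed.

(** The partial sums of a budget of 3 * 4^-(Ld + i) for the i-th stage; a stage spends at most two
    terms 4^-(Ld + i), one for the decision and one for the recovery. *)
Definition stage_failure i : R := 4^-1 ^+ Ld * (1 - 4^-1 ^+ i).
Definition stage_error i : R := 25 * (cost i)%:R * e.

Lemma stage_failure_ge0 i : 0 <= stage_failure i.
Proof.
rewrite mulr_ge0 ?exprn_ge0 ?invr_ge0 // subr_ge0 exprn_ile1 ?invr_ge0 //.
by rewrite invf_le1; lra.
Qed.

Lemma rho_reps i : rho R ^+ reps i.+1 + rho R ^+ reps i.+1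
  <= stage_failure i.+1 - stage_failure i.
Proof.
have h : rho R ^+ reps i.+1 <= 4^-1 ^+ (Ld + i.+1).
  rewrite /reps exprM; have /andP[p0 _] := rho01 R.
  by apply: lerXn2r rhoC0; rewrite nnegrE ?exprn_ge0 ?invr_ge0.
rewrite /stage_failure; move: h; rewrite exprD !exprS.
have := exprn_ge0 Ld (_ : 0 <= 4^-1 :> R); rewrite invr_ge0 => /(_ ltac:(by [])).
have := exprn_ge0 i (_ : 0 <= 4^-1 :> R); rewrite invr_ge0 => /(_ ltac:(by [])).
move: (rho R ^+ _) (4^-1 ^+ Ld) (4^-1 ^+ i) => u v w' w0 v0 h; nra.
Qed.

(** If a lies in an outer third, one decision may lose it, and Chernoff weights charge that
    decision. In the middle third either decision is right. *)
Lemma failure_stage i l : radius i <= 2 -> -1 <= l -> l + radius i <= 1 ->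
  l <= a <= l + radius i ->
  N (stage i l) x <= Num.sqrt (stage_failure i) + stage_error i.
Proof.
elim: i l => [|i IH] l r2 l1 l2 /andP[a1 a2].
  rewrite N_output ?addr_ge0 ?sqrtr_ge0 //.
    by rewrite /stage_error mulr0 mul0r.
  move: a2 l2 r2; rewrite /radius expr0 mulr1 => a2 l2 r2.
  by apply: le_trans r0_eps; rewrite ler_norml; apply/andP; split; lra.
have rE := radiusS i; have hr := iters_bounds r2.
have rip := radius_gt0 i; have iK := iters_gt0 r2.
have [r rE0] : exists r, r = radius i.+1 by eexists.
have thE : threshold i.+1 = (flip_prob (iters i.+1)%:R (5 * r / 48)
    + flip_prob (iters i.+1)%:R (r / 12)) / 2 by rewrite rE0.
move: r2 l2 a2 rE hr thE; rewrite -rE0 => r2 l2 a2 rE hr thE.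
have [rp _ K0 K1 K2] := hr.
(* The shift l - r, and not l, keeps the amplitude [bb] at least r / 16: flips then have probability
   at least 9/100, without which recovery could stall. *)
have [c cE] : exists c, c = l - r by eexists.
have [bb bbE] : exists bb, bb = (a - c) / 16 by eexists.
have hb : r / 16 <= bb <= r / 8 by rewrite bbE cE; apply/andP; split; lra.
have hb4 : 0 <= bb <= 4^-1 by case/andP: hb => h1 h2; apply/andP; split; lra.
have c3 : `|c| <= 3 by rewrite cE ler_norml; apply/andP; split; lra.
have [s1 _ s3] := asin_small hb4.
have [F FE] : exists F, F = flip_prob (iters i.+1)%:R bb by eexists.
have e0 : 0 <= e by rewrite exprn_ge0 ?invr_ge0.
have F01 : 0 <= F <= 1 by rewrite FE sqr_ge0 flip_prob_le1.
have F9 : 9 / 100 <= F by rewrite FE; exact: (flip_prob_ge hr hb).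
have gapF := flip_prob_gap hr.
have [p1 p1E] : exists p, p = flip_prob (iters i.+1)%:R (r / 12) by eexists.
have [p2 p2E] : exists p, p = flip_prob (iters i.+1)%:R (5 * r / 48) by eexists.
rewrite -p1E -p2E in gapF thE.
have th01 : 0 <= threshold i.+1 <= 1.
  have q1 : 0 <= p1 by rewrite p1E; exact: sqr_ge0.
  have q2 : 0 <= p2 by rewrite p2E; exact: sqr_ge0.
  have q3 : p1 <= 1 by rewrite p1E; exact: flip_prob_le1.
  have q4 : p2 <= 1 by rewrite p2E; exact: flip_prob_le1.
  by rewrite thE; apply/andP; split; lra.
have Fp1 : a <= l + r / 3 -> F <= p1.
  move=> ha; rewrite FE p1E.
  by apply: (flip_prob_mono hr); rewrite ?bbE ?cE; [case/andP: hb; rewrite bbE cE|lra|lra].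
have Fp2 : l + 2 * r / 3 <= a -> p2 <= F.
  move=> ha; rewrite FE p2E.
  by apply: (flip_prob_mono hr); rewrite ?bbE ?cE; [lra|lra|case/andP: hb; rewrite bbE cE].
set M := reps i.+1.
have err0 : 0 <= stage_error i by rewrite /stage_error !mulr_ge0.
have sf0 := stage_failure_ge0 i.
have [Th [lam [Th0 lam0 hThM hrest]]] : exists Th lam : R, [/\ 0 <= Th, 0 <= lam,
    Th * (1 - F + F * lam) ^+ M <= rho R ^+ M
  & forall cnt : nat, N (stage i (if threshold i.+1 * M%:R <= cnt%:R
                                  then l + r / 3 else l)) x
      <= Num.sqrt (stage_failure i + Th * lam ^+ cnt) + stage_error i].
  have good_side cnt d :
      (if threshold i.+1 * M%:R <= cnt%:R then l + r / 3 <= a else a <= l + 2 * r / 3) ->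
      0 <= d ->
      N (stage i (if threshold i.+1 * M%:R <= cnt%:R then l + r / 3 else l)) x
      <= Num.sqrt (stage_failure i + d) + stage_error i.
    move=> hside hd; apply: (@le_trans _ _ (Num.sqrt (stage_failure i) + stage_error i)).
      by case: ifP hside => _ hside; apply: IH; rewrite ?rE; try apply/andP; try split; lra.
    by rewrite lerD2r ler_sqrt ?addr_ge0 // lerDl.
  (* After a wrong decision nothing is claimed about later stages; a weight of at least 1 pays for
     total failure. *)
  have bad_side cnt d p : 1 <= d ->
      N p x <= Num.sqrt (stage_failure i + d) + stage_error i.
    move=> hd; apply: le_trans (N_le1 p) _; rewrite ler_wpDr //.
    have hd' : 1 <= stage_failure i + d by rewrite ler_wpDl.
    have : Num.sqrt 1 <= Num.sqrt (stage_failure i + d).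
      by rewrite ler_sqrt // (le_trans ler01 hd').
    by rewrite sqrtr1.
  have weights high : (if high then threshold i.+1 + 80^-1 <= F
                       else F <= threshold i.+1 - 80^-1) ->
      (forall cnt : nat, (threshold i.+1 * M%:R <= cnt%:R) = high ->
        if threshold i.+1 * M%:R <= cnt%:R then l + r / 3 <= a else a <= l + 2 * r / 3) ->
      exists Th lam : R, [/\ 0 <= Th, 0 <= lam,
        Th * (1 - F + F * lam) ^+ M <= rho R ^+ M
      & forall cnt : nat, N (stage i (if threshold i.+1 * M%:R <= cnt%:R
                                  then l + r / 3 else l)) x
          <= Num.sqrt (stage_failure i + Th * lam ^+ cnt) + stage_error i].
    move=> hF hs; have [Th [lam [h1 h2 h3 h4]]] := chernoff_weights M F01 th01 hF.
    exists Th, lam; split=> // cnt.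
    have [hc|hc] := eqVneq (threshold i.+1 * M%:R <= cnt%:R) high.
      by apply: good_side; [exact: hs | rewrite mulr_ge0 ?exprn_ge0].
    exact/bad_side/h4.
  have [ha1|ha1] := leP a (l + r / 3).
    apply: (weights false); first by have := Fp1 ha1; rewrite thE; lra.
    by move=> cnt ->; apply: (le_trans ha1); rewrite lerD2l; lra.
  have [ha2|ha2] := leP a (l + 2 * r / 3); last first.
    apply: (weights true); first by have := Fp2 (ltW ha2); rewrite thE; lra.
    by move=> cnt ->; exact: ltW ha1.
  (* Both subintervals contain a, so no decision is charged. *)
  exists 0, 1; split=> //; first by rewrite mul0r exprn_ge0 //; case/andP: (rho01 R).
  move=> cnt; rewrite mul0r; apply: good_side => //.
  by case: ifP => _ //; exact: ltW.
have hB : nrm ((embed b n (uvec' L m c))^t* *m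
   (heisenberg_op H V t0 k false (Some (ctrl_qubit k)) *m x) - (sin (asin bb))%:C *: psi0) <= e.
  rewrite (embed_heis_psi _ _ _ VA) s1 bbE.
  exact: block_state HE AH VA k0 L0 Lmk gap c.
have hB' : nrm ((embed b n (uvec R L m))^t* *m
   ((heisenberg_op H V t0 k false (Some (ctrl_qubit k)))^t* *m (embed b n (uvec' L m c) *m psi0))
   - (sin (asin bb))%:C *: psi0) <= e.
  rewrite (embed_heis_adj_psi _ _ _ AH VA) s1 bbE.
  exact: block_state HE AH VA k0 L0 Lmk gap c.
subst c r.
have sb : 0 <= sin (asin bb) <= 4^-1 by rewrite s1.
have := trials_rule t0_gt0 time_register_le psi1 Vu (uvec_unit R k0 L0 Lmk)
  (uvec_unit' k0 L0 Lmk c3) (@uvec_flag R k L m) (@uvec_flag' R k L m _) hB hB' sb s3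
  FE M M sf0 err0 Th0 lam0 hrest.
move=> /le_trans; apply; apply: lerD.
  rewrite ler_sqrt ?stage_failure_ge0 //.
  have hF1 : (1 - F) ^+ M <= rho R ^+ M.
    exact: rho_exp F01 F9.
  have := rho_reps i; rewrite -/M.
  by move=> h3; exact: failure_step hF1 hThM h3.
rewrite /stage_error /step_error /= -/M.
by apply: error_step => //; rewrite /M /reps muln_gt0 C0_gt0 addn_gt0 Ld_gt0.
Qed.

End Correctness.
End Stage.

(** * Choice of parameters *)

Section Preparation.
Variable R : realType.
Local Notation C := R[i].
Variables w b n : nat.
Variables u u0 : 'I_(2 ^ w) -> R.
Hypotheses (u1 : \sum_j u j * u j = 1) (u01 : \sum_j u0 j * u0 j = 1).
Hypothesis uu0 : \sum_j u j * u0 j = 3 / 5.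

Let d j := u j - u0 j.

(** The Householder reflection that takes u0 to u; 5/4 is the inverse of |u - u0|^2 = 2 - 2 *
    3/5. *)
Definition prepare_gate : operator R w b n := 1%:M - 2 *: ((5 / 4)%:C *: embed_proj b n d).

Let dd : \sum_j d j * d j = 4 / 5.
Proof.
have -> : \sum_j d j * d j
    = \sum_j u j * u j + \sum_j u0 j * u0 j - 2 * \sum_j u j * u0 j.
  rewrite mulr_sumr -big_split -sumrB /=; apply: eq_bigr => j _; rewrite /d; ring.
by rewrite u1 u01 uu0; lra.
Qed.

Let du0 : \sum_j d j * u0 j = - (2 / 5).
Proof.
have -> : \sum_j d j * u0 j = \sum_j u j * u0 j - \sum_j u0 j * u0 j.
  by rewrite -sumrB /=; apply: eq_bigr => j _; rewrite /d mulrBl.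
by rewrite u01 uu0; lra.
Qed.

Lemma prepare_gate_unitary : prepare_gate \is unitarymx.
Proof.
apply: reflection_unitary; split.
  by rewrite adjmxZr /embed_proj (adjmxM (embed b n d)) trmxCK.
rewrite -scalemxAl -scalemxAr scalerA /embed_proj mulmxA -(mulmxA (embed b n d)).
rewrite embed_gram dd mul_mx_scalar -scalemxAl scalerA -!rmorphM.
by congr (_%:C *: _); field.
Qed.

Lemma prepare_gateP (psi : 'cV[C]_(2 ^ n)) :
  prepare_gate *m (embed b n u0 *m psi) = embed b n u *m psi.
Proof.
have hd : embed b n d = embed b n u - embed b n u0.
  apply: sliceP => k; rewrite sliceB !stackK /d rmorphB.
  by rewrite scalerBl.
rewrite /prepare_gate mulmxBl mul1mx -!scalemxAl /embed_proj -mulmxA.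
rewrite (mulmxA ((embed b n d)^t*)) embed_gram du0 mul_scalar_mx -scalemxAr !scalerA.
have -> : 2 * (5 / 4)%:C * (- (2 / 5))%:C = -1 :> C.
  rewrite -[2](rmorph_nat (real_complex R)) -!rmorphM -(rmorphN1 (real_complex R)).
  by congr (_%:C); field.
by rewrite scaleN1r opprK hd mulmxBl addrC subrK.
Qed.

End Preparation.

(** * Powers, logarithms and the sum of the costs *)

Section ParameterChoice.
Variable R : realType.
Implicit Types r y : R.

Lemma exists_pow_le r y : 0 <= r < 1 -> 0 < y -> exists j, r ^+ j <= y.
Proof.
move=> /andP[r0 r1] y0; pose x := (1 - r) * y.
have x0 : 0 < x by rewrite mulr_gt0 // subr_gt0.
exists (Num.truncn x^-1).+1; set j := _.+1.
have hj : 1 < j%:R * x.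
  by rewrite -ltr_pdivrMr // mul1r; exact: truncnS_gt.
have h1 : r <= expR (- (1 - r)) by have := expR_ge1Dx (- (1 - r)); lra.
apply: (@le_trans _ _ (expR (- (1 - r)) ^+ j)).
  by apply: lerXn2r h1; rewrite nnegrE // expR_ge0.
rewrite -expRM_natl mulrN expRN -[y]invrK lef_pV2 ?posrE ?expR_gt0 ?invr_gt0 //.
apply: le_trans (expR_ge1Dx _); rewrite -[X in X <= _]mul1r ler_pdivrMr //.
rewrite mulrDl mul1r -mulrA -/x; lra.
Qed.

Lemma exists_rho : exists2 C0 : nat, (0 < C0)%N & rho R ^+ C0 <= 4^-1.
Proof.
have [|j hj] := exists_pow_le (rho01 R) (_ : 0 < 4^-1); first by rewrite invr_gt0.
exists j => //; rewrite lt0n; apply/eqP => j0; move: hj; rewrite j0 expr0.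
by lra.
Qed.

(** J is the least exponent that reaches eps; minimality gives the upper bound, which prevents the
    cost from exceeding order 1/eps. *)
Lemma exists_radius (eps : R) : 0 < eps <= 2^-1 ->
  exists J, (2 / 3) ^+ J <= eps <= 3 / 2 * (2 / 3) ^+ J.
Proof.
move=> /andP[e0 e1].
have h : exists j, (2 / 3) ^+ j <= eps by apply: exists_pow_le => //; apply/andP; split; lra.
exists (ex_minn h); case: ex_minnP => -[|j] hj hmin.
  by move: hj; rewrite expr0; lra.
rewrite hj /= exprS mulrA [3 / 2 * _](_ : _ = 1); last by field.
rewrite mul1r leNgt; apply/negP => /ltW /hmin; by rewrite ltnn.
Qed.

Lemma ln2_ge : 2^-1 <= ln (2 : R).
Proof.
have h : expR (2^-1 : R) <= 2.
  apply: le_trans (expR_le_quadratic _) _; first by rewrite ger0_norm ?invr_ge0.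
  by lra.
by rewrite -[leLHS]expRK ler_ln ?posrE ?expR_gt0.
Qed.

(** Since ln 2 >= 1/2, an exponent of at least 2 ln y suffices. *)
Lemma exists_pow2 y : 1 <= y -> exists p : nat, [/\ (0 < p)%N, y <= 2 ^+ p & p%:R <= 2 * ln y + 1].
Proof.
move=> y1; have y0 : 0 < y by lra.
have l0 : 0 <= 2 * ln y by rewrite mulr_ge0 // ln_ge0.
exists (Num.truncn (2 * ln y)).+1; split=> //; last by rewrite -natr1 lerD2r truncn_le.
set p := (Num.truncn _).+1.
have hp : 2 * ln y <= p%:R by apply/ltW; exact: truncnS_gt.
have -> : 2 ^+ p = expR (p%:R * ln 2) :> R by rewrite expRM_natl lnK // posrE.
rewrite -[leLHS](lnK (_ : y \is Num.pos)) ?posrE // ler_expR.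
have h2 := ln2_ge; have : p%:R * 2^-1 <= p%:R * ln 2 :> R by rewrite ler_wpM2l.
lra.
Qed.

Lemma cost_le (C0 Ld : nat) (r0 : R) i : 0 < r0 -> (0 < Ld)%N ->
  (cost C0 Ld r0 i)%:R * r0 <= 32 * C0%:R * Ld%:R.
Proof.
move=> r00 hL.
(* The right side is 4 C0 times the closed form of the sum of (Ld + j) (2/3)^j for j from 1 to i. *)
suff h : (cost C0 Ld r0 i)%:R * r0 <= 4 * C0%:R *
    (2 * Ld%:R + 6 - (2 * Ld%:R + 2 * i%:R + 6) * (2 / 3) ^+ i).
  apply: le_trans h _; have -> : 32 * C0%:R * Ld%:R = 4 * C0%:R * (8 * Ld%:R) :> R by ring.
  rewrite ler_wpM2l ?mulr_ge0 //.
  have l1 : 1 <= Ld%:R :> R by rewrite ler1n.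
  have p0 : 0 <= (2 * Ld%:R + 2 * i%:R + 6) * (2 / 3 : R) ^+ i.
    by rewrite mulr_ge0 ?exprn_ge0 ?divr_ge0 // !addr_ge0 ?mulr_ge0.
  move: (Ld%:R : R) l1 p0 => x l1; move: ((_ + _ + _) * _) => y p0; lra.
elim: i => [|i IH].
  by rewrite mul0r expr0 mulr1 mulr0 addr0 subrr mulr0.
rewrite /= natrD mulrDl.
have hi : (reps C0 Ld i.+1 * iters r0 i.+1)%:R * r0
    <= 4 * C0%:R * ((Ld%:R + i.+1%:R) * (2 / 3) ^+ i.+1).
  have rp : 0 < radius r0 i.+1 by rewrite mulr_gt0 // exprn_gt0 // divr_gt0.
  have hk : (iters r0 i.+1)%:R * radius r0 i.+1 <= 4.
    rewrite -ler_pdivlMr //.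
    have q0 : 0 <= 4 / radius r0 i.+1 by rewrite divr_ge0 // ltW.
    by have /andP[] := truncn_itv q0.
  have hr : r0 = radius r0 i.+1 * (2 / 3) ^+ i.+1.
    rewrite /radius -mulrA -exprMn [3 / 2 * _](_ : _ = 1); last by field.
    by rewrite expr1n mulr1.
  rewrite {2}hr /reps !natrM natrD.
  have q0 : 0 <= C0%:R * (Ld%:R + i.+1%:R) * (2 / 3) ^+ i.+1 :> R.
    by rewrite !mulr_ge0 ?addr_ge0 ?exprn_ge0 ?divr_ge0.
  have := ler_wpM2l q0 hk.
  move: (C0%:R : R) (Ld%:R + i.+1%:R : R) ((2 / 3) ^+ i.+1 : R) (radius _ _) ((iters _ _)%:R : R).
  move=> x1 x2 x3 x4 x5 h.
  have -> : x1 * x2 * x5 * (x4 * x3) = x1 * x2 * x3 * (x5 * x4) by ring.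
  by have -> : 4 * x1 * (x2 * x3) = x1 * x2 * x3 * 4 by ring.
apply: le_trans (lerD IH hi) _.
rewrite -mulrDr exprS -[i.+1%:R]natr1 le_eqVlt; apply/orP; left; apply/eqP; congr (_ * _).
by move: (Ld%:R : R) (i%:R : R) ((2 / 3) ^+ i : R) => x y z; field.
Qed.

Lemma max_time_le (t0 : R) k : 0 <= t0 -> (0 < k)%N ->
  max_time t0 k <= t0 * (2 ^ k.-1)%:R.
Proof.
move=> t00 k0; rewrite /max_time.
apply: (big_ind (fun z => z <= t0 * (2 ^ k.-1)%:R)).
- by rewrite mulr_ge0.
- by move=> x y hx hy; rewrite ge_max hx hy.
- move=> i _; rewrite /grid_time normrM (ger0_norm t00) ler_wpM2l //.
  have hi : i%:R <= (2 ^ k.-1)%:R + (2 ^ k.-1)%:R :> R.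
    rewrite -natrD ler_nat addnn -mul2n -expnS prednK //; exact: ltnW.
  by rewrite ler_norml; apply/andP; split; have := ler0n R i; move: (i%:R : R) hi => y h1 h2; lra.
Qed.

End ParameterChoice.

(** * The complete circuit *)

Section Estimate.
Variable R : realType.
Local Notation C := R[i].
Variables (n b k L m : nat) (t0 : R) (t0_gt0 : 0 < t0) (k0 : (0 < k)%N).
Variables (C0 Ld : nat) (r0 : R).
Hypotheses (L0 : (0 < L)%N) (Lmk : (L.-1 * m < 2 ^ k)%N).

Let u0 (j : 'I_(2 ^ k.+2)) : R := (j == 0%N :> nat)%:R.

Definition estimate i : protocol R k.+2 b n :=
  gate (prepare_gate b n (uvec R L m) u0) (stage n b L m t0_gt0 k0 C0 Ld r0 i (-1)).

Lemma calls_estimate i : (calls (estimate i) <= 4 * cost C0 Ld r0 i)%N.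
Proof. by rewrite calls_gate calls_stage. Qed.

Lemma evolution_time_estimate T i : max_time t0 k <= T -> 0 <= T ->
  evolution_time (estimate i) <= (calls (estimate i))%:R * (2 * T).
Proof.
move=> hT T0; apply: evolution_time_le => //; apply/heisenberg_only_gate.
exact: heisenberg_only_stage.
Qed.

Let sum_u0 (F : 'I_(2 ^ k.+2) -> R) : exists2 j : 'I_(2 ^ k.+2), j = 0%N :> nat &
  \sum_j F j * u0 j = F j.
Proof.
have h0 : (0 < 2 ^ k.+2)%N by rewrite expn_gt0.
exists (Ordinal h0) => //; rewrite (bigD1 (Ordinal h0)) //= big1 ?addr0.
  by rewrite /u0 eqxx mulr1.
by move=> j; rewrite -val_eqE /= /u0 => /negPf ->; rewrite mulr0.
Qed.

Let u01 : \sum_j u0 j * u0 j = 1.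
Proof. by have [j j0 ->] := sum_u0 u0; rewrite /u0 j0. Qed.

Let uu0 : \sum_j uvec R L m j * u0 j = 3 / 5.
Proof. by have [j j0 ->] := sum_u0 (uvec R L m); rewrite /uvec /amp j0. Qed.

Variables (H A : 'M[C]_(2 ^ n)) (V : 'M[C]_(2 ^ b * 2 ^ n)) (E : nat -> R)
  (psi : nat -> 'cV[C]_(2 ^ n)) (eps delta : R).
Hypothesis HE : eigendecomposition H E psi.
Hypothesis AH : A^t* = A.
Hypothesis VA : block_encoding V A.
Hypothesis gap : forall j, (0 < j < 2 ^ n)%N ->
  [/\ 0 < (E j - E 0%N) * t0, (E j - E 0%N) * t0 <= 1
    & 8 <= L%:R * ((E j - E 0%N) * t0)].
Hypotheses (r0_gt0 : 0 < r0) (r0_eps : r0 / 2 <= eps).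
Hypotheses (C0_gt0 : (0 < C0)%N) (Ld_gt0 : (0 < Ld)%N) (rhoC0 : rho R ^+ C0 <= 4^-1).

(** The search starts from [-1, 1]. A failure norm of delta / 2 means an error probability of at
    most delta^2 / 4 and a trace distance of at most delta^2 / 4 + delta / 2. *)
Lemma estimate_correct J : radius r0 J = 2 -> 0 <= delta <= 1 ->
  Num.sqrt (stage_failure R Ld J) + stage_error m C0 Ld r0 J <= delta / 2 ->
  1 - delta <= output_probability H V (estimate J) (psi 0%N)
                 (fun a => `|a - expectation A (psi 0%N)| <= eps) /\
  trace_distance (system_state H V (estimate J) (psi 0%N)) (pure (psi 0%N)) <= delta.
Proof.
move=> rJ /andP[d0 d1] hd.
have psi1 : nsq (psi 0%N) = 1 by apply: eigendecomposition_nsq HE _ _; rewrite expn_gt0.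
have Vu : V \is unitarymx by case: VA.
set good := fun a => _.
have [x xE] : exists x, x = ket0 R k.+2 *t (ket0 R b *t psi 0%N) by eexists.
have x1 : nsq x = 1.
  by rewrite xE -embed_ket0 (nsq_iso _ (embed_iso _ _ _)).
have hN : failure_norm H V (psi 0%N) good (estimate J) x <= delta / 2.
  rewrite (failure_gate _ _ _ _ _ _ (prepare_gate_unitary b n (uvec_unit R k0 L0 Lmk) u01 uu0)).
  rewrite xE -embed_ket0 (prepare_gateP b u01 uu0).
  apply: le_trans hd; apply: (failure_stage _ _ HE AH VA) => //; rewrite ?rJ //; first by lra.
  have := expectation_le1 HE VA; rewrite ler_norml => /andP[h1 h2].
  by apply/andP; split; lra.
split.
  have := output_probability_ge H (psi 0%N) good Vu (estimate J) x1.
  rewrite /output_probability /outcomes -xE; apply: le_trans.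
  rewrite lerB // -sqr_failure_norm.
  have := failure_norm_ge0 H V (psi 0%N) good (estimate J) x.
  by move: (failure_norm _ _ _ _ _ _) hN => y h1 h2; nra.
have d2 : 0 <= delta / 2 by rewrite divr_ge0.
have := trace_distance_run psi1 Vu x1 d2 hN.
rewrite /system_state /outcomes -xE => /le_trans; apply.
by rewrite expr2; nra.
Qed.

End Estimate.

(** * Balancing accuracy against cost *)

Section Costs.
Variable R : realType.
Implicit Types eps delta Delta : R.

(** t0 is small enough for the bandwidth 2 Lambda, but the longest time is below t0 L m, and t0 L <=
    8 / Delta + t0 <= 9 / Delta. Hence Lambda cancels from the bound. *)
Lemma exists_register Delta (Lambda : R) m : 0 < Delta -> (0 < m)%N ->
  exists (t0 : R) (L k : nat),
    [/\ 0 < t0, (0 < k)%N, (0 < L)%N & (L.-1 * m < 2 ^ k)%N] /\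
    [/\ 2 * Lambda * t0 <= 1, 8 <= L%:R * (Delta * t0)
      & max_time t0 k <= 9 * m%:R / Delta].
Proof.
move=> D0 m0; pose X := 2 * `|Lambda| + Delta + 1; pose t0 := X^-1.
have X0 : 0 < X by have := normr_ge0 Lambda; rewrite /X; lra.
have t00 : 0 < t0 by rewrite invr_gt0.
have tX : X * t0 = 1 by rewrite divff // gt_eqF.
have Dt0 : 0 < Delta * t0 by rewrite mulr_gt0.
have q0 : 0 <= 8 / (Delta * t0) by rewrite divr_ge0 // ltW.
pose L := (Num.truncn (8 / (Delta * t0))).+1; pose k := up_log 2 (L * m).
have /andP[hL1 hL2] := truncn_itv q0.
rewrite -/L ltr_pdivrMr // in hL2.
have Dt1 : Delta * t0 <= 1.
  rewrite -tX ler_wpM2r ?(ltW t00) // /X; have := normr_ge0 Lambda; lra.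
have hL8 : (8 <= L)%N.
  rewrite -(ler_nat R); apply: (le_trans (ltW hL2)).
  by rewrite ler_piMr.
have Lm1 : (1 < L * m)%N by rewrite (leq_trans (_ : 2 <= L)%N) ?leq_pmulr // (leq_trans _ hL8).
have k0 : (0 < k)%N by rewrite up_log_gt0.
have hk : (L * m <= 2 ^ k)%N by apply: up_logP.
have hk1 : (2 ^ k.-1 < L * m)%N by apply: up_log_gtn.
exists t0, L, k; split; split=> //.
- by apply: leq_trans hk; rewrite ltn_pmul2r.
- rewrite -[leRHS]tX ler_wpM2r ?(ltW t00) // /X; have := ler_norm Lambda; lra.
- exact: ltW.
- apply: le_trans (max_time_le (ltW t00) k0) _.
  apply: (@le_trans _ _ (t0 * (L%:R * m%:R))).
    by rewrite ler_wpM2l ?(ltW t00) // -natrM ler_nat ltnW.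
  rewrite mulrA [9 * _ / _]mulrAC ler_wpM2r // ler_pdivlMr //.
  rewrite /L -natr1; move: hL1; rewrite ler_pdivlMr //.
  by move: ((Num.truncn _)%:R : R) => y hy; nra.
Qed.

Lemma ln_inv_ge delta : 0 < delta <= 2^-1 -> 2^-1 <= ln delta^-1.
Proof.
move=> /andP[d0 d1]; apply: le_trans (ln2_ge R) _.
by rewrite ler_ln ?posrE ?invr_gt0 // -[2]invrK lef_pV2 ?posrE ?invr_gt0.
Qed.

(** Chosen so that 25 * cost * 2^-m <= delta / 4 for cost <= 192 C0 ln (1/delta) / eps and 2^-m <=
    delta^2 eps / (192 * 100 * C0); one factor delta absorbs the logarithm, by delta ln (1/delta) <=
    1. *)
Definition precision_constant (C0 : nat) : R := 192 * 100 * C0%:R.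

Lemma exists_accuracy (C0 : nat) eps delta : (0 < C0)%N ->
  0 < eps <= 2^-1 -> 0 < delta <= 2^-1 ->
  exists (Ld m J : nat) (r0 : R),
    [/\ (0 < Ld)%N, (0 < m)%N, 0 < r0, r0 / 2 <= eps & radius r0 J = 2] /\
    [/\ Num.sqrt (stage_failure R Ld J) + stage_error m C0 Ld r0 J <= delta / 2,
        (cost C0 Ld r0 J)%:R <= 192 * C0%:R * (ln delta^-1 / eps)
      & m%:R <= (4 * ln (precision_constant C0) + 6) * (ln delta^-1 + ln eps^-1)].
Proof.
move=> hC he hd; have /andP[e0 e1] := he; have /andP[d0 d1] := hd.
have ld := ln_inv_ge hd; have le := ln_inv_ge he.
have ldd : ln delta^-1 * delta <= 1.
  have v0 : 0 < delta^-1 by rewrite invr_gt0.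
  by rewrite -ler_pdivlMr // div1r; have := ln_sublinear v0; exact: ltW.
have c1 : 1 <= C0%:R :> R by rewrite ler1n.
have K1 : 1 <= precision_constant C0 by rewrite /precision_constant; lra.
have K0 : 0 < precision_constant C0 by lra.
have lnK : 0 <= ln (precision_constant C0) by rewrite ln_ge0.
have v1 : 1 <= delta^-1 by rewrite invf_ge1 //; lra.
have w1 : 1 <= eps^-1 by rewrite invf_ge1 //; lra.
(* The failure norm is a square root, so the budget 4^-Ld contributes 2^-Ld <= delta / 4. *)
have [Ld [Ld0 hLd1 hLd2]] : exists p : nat,
    [/\ (0 < p)%N, 4 * delta^-1 <= 2 ^+ p & p%:R <= 2 * ln (4 * delta^-1) + 1].
  by apply: exists_pow2; lra.
have vv : 1 <= delta^-1 * delta^-1 * eps^-1 by rewrite !mulr_ege1.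
have [m [m0 hm1 hm2]] : exists p : nat, [/\ (0 < p)%N,
    precision_constant C0 * (delta^-1 * delta^-1 * eps^-1) <= 2 ^+ p
  & p%:R <= 2 * ln (precision_constant C0 * (delta^-1 * delta^-1 * eps^-1)) + 1].
  by apply: exists_pow2; rewrite mulr_ege1.
have [J /andP[J1 J2]] := exists_radius he.
pose r0 : R := 2 * (2 / 3) ^+ J.
have r00 : 0 < r0 by rewrite mulr_gt0 // exprn_gt0 // divr_gt0.
have ln2_le : ln 2 <= ln delta^-1.
  by rewrite ler_ln ?posrE ?invr_gt0 // -[2]invrK lef_pV2 ?posrE ?invr_gt0.
have Ld8 : Ld%:R <= 8 * ln delta^-1.
  move: hLd2; rewrite lnM ?posrE ?invr_gt0 // (_ : 4 = 2 * 2); last by ring.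
  by rewrite lnM ?posrE //; move: (ln 2) (ln delta^-1) (Ld%:R : R) ld ln2_le => x y z; lra.
(* From r0 >= 4 eps / 3 and Ld <= 8 ln (1/delta): 32 * 8 * 3/4 = 192. *)
have hcost : (cost C0 Ld r0 J)%:R <= 192 * C0%:R * (ln delta^-1 / eps).
  have hr : 4 / 3 * eps <= r0 by rewrite /r0; move: J2; move: (_ ^+ J) => q; lra.
  have h1 := cost_le C0 J r00 Ld0.
  have h2 := ler_wpM2l (ler0n R (cost C0 Ld r0 J)) hr.
  have h3 : C0%:R * Ld%:R <= C0%:R * (8 * ln delta^-1) by rewrite ler_wpM2l.
  rewrite mulrA ler_pdivlMr //; clear r00 hr; move: h1 h2 h3.
  move: ((cost C0 Ld r0 J)%:R : R) (ln delta^-1) (C0%:R : R) (Ld%:R : R) => x l c y.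
  move: r0 => z.
  rewrite -(mulrA 32) (mulrCA c) (mulrCA x) -(mulrA 192) => h1 h2 h3.
  by move: (c * l) (x * eps) (c * y) (x * z) h1 h2 h3 => p q s t; lra.
exists Ld, m, J, r0; split; split=> //.
- by move: J1; rewrite /r0; move: (_ ^+ J) => q; lra.
- rewrite /radius /r0 -mulrA -exprMn [2 / 3 * _](_ : _ = 1); last by field.
  by rewrite expr1n mulr1.
- rewrite [leRHS](_ : _ = delta / 4 + delta / 4); last by field.
  apply: lerD.
    apply: (@le_trans _ _ (2^-1 ^+ Ld)).
      have q0 : 0 <= 2^-1 ^+ Ld :> R by rewrite exprn_ge0 ?invr_ge0.
      rewrite -[leRHS](ger0_norm q0) -sqrtr_sqr ler_sqrt ?sqr_ge0 //.
      rewrite /stage_failure -exprM mulnC exprM (_ : 2^-1 ^+ 2 = 4^-1); last by field.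
      by rewrite ler_piMr ?exprn_ge0 ?invr_ge0 // lerBlDr lerDl exprn_ge0 ?invr_ge0.
    by rewrite exprVn -[delta / 4]invrK lef_pV2 ?posrE ?invr_gt0 ?exprn_gt0 ?divr_gt0 // invf_div.
  rewrite /stage_error.
  have P0 : 0 <= 2^-1 ^+ m :> R by rewrite exprn_ge0 ?invr_ge0.
  have hP : 2^-1 ^+ m * (precision_constant C0 * (delta^-1 * delta^-1 * eps^-1)) <= 1 :> R.
    by rewrite exprVn mulrC ler_pdivrMr ?exprn_gt0 // mul1r.
  have hP' : 2^-1 ^+ m * (precision_constant C0 * eps^-1) <= delta * delta.
    have := ler_wpM2r (_ : 0 <= delta * delta) hP; rewrite mulr_ge0 ?(ltW d0) // => /(_ ltac:(by [])).
    rewrite mul1r; apply: le_trans; rewrite le_eqVlt; apply/orP; left; apply/eqP.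
    by field; rewrite !gt_eqF.
  have l0 : 0 <= ln delta^-1 by lra.
  have h1 := ler_wpM2r P0 hcost.
  have h2 := ler_wpM2l l0 hP'.
  have h3 := ler_wpM2r (ltW d0) ldd.
  move: h1 h2 h3; rewrite /precision_constant.
  move: (2^-1 ^+ m) (ln delta^-1) ((cost C0 Ld r0 J)%:R : R) (C0%:R : R) eps^-1 => P l x c w.
  rewrite mul1r -!mulrA => h1 h2 h3.
  have e2 : l * (P * (192 * (100 * (c * w)))) = 100 * (192 * (c * (l * (w * P)))) by ring.
  rewrite e2 in h2; move: (c * (l * (w * P))) h1 h2 => y h1 h2.
  move: (x * P) (l * (delta * delta)) h1 h2 h3 => z t; lra.
- have v0 : 0 < delta^-1 by rewrite invr_gt0.
  have w0 : 0 < eps^-1 by rewrite invr_gt0.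
  apply: le_trans hm2 _; move: (precision_constant C0) K0 lnK => K K0 lnK.
  rewrite !lnM ?posrE ?mulr_gt0 //; move: (ln K) (ln delta^-1) (ln eps^-1) lnK ld le => x y z x0 y0 z0.
  have : 0 <= x * (y + z - 2^-1) by rewrite mulr_ge0 //; lra.
  lra.
Qed.

End Costs.

Theorem mainTheorem1 (R : realType) :
  exists Cst : R, 0 < Cst /\
  forall (n b : nat) (Delta eps delta Lambda : R),
    (1 <= n)%N -> 0 < Delta ->
    0 < eps <= 2^-1 -> 0 < delta <= 2^-1 ->
  exists (w : nat) (p : protocol R w b n),
    [/\ evolution_time p
          <= Cst * (ln delta^-1 * (ln delta^-1 + ln eps^-1) / (Delta * eps)),
        (calls p)%:R <= Cst * (ln delta^-1 / eps)
      & forall (H A : 'M[R[i]]_(2 ^ n)) (V : 'M[R[i]]_(2 ^ b * 2 ^ n))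
          (psi0 : 'cV[R[i]]_(2 ^ n)),
        gapped Delta H psi0 -> opnorm H <= Lambda ->
        A \is hermsymmx -> opnorm A <= 1 -> block_encoding V A ->
        1 - delta <= output_probability H V p psi0
                       (fun a => `|a - expectation A psi0| <= eps) /\
        trace_distance (system_state H V p psi0) (pure psi0) <= delta].
Proof.
have [C0 C0_gt0 rhoC0] := exists_rho R.
have K1 : 1 <= precision_constant R C0.
  by have : 1 <= C0%:R :> R; [rewrite ler1n | rewrite /precision_constant; lra].
have [B BE] : exists B : R, B = 4 * ln (precision_constant R C0) + 6 by eexists.
have B6 : 6 <= B by have := ln_ge0 K1; rewrite BE; lra.
have c0 : 0 < 192 * C0%:R :> R by rewrite mulr_gt0 // ltr0n.
(* 72 = 4 * 2 * 9: four calls per unit of cost, two evolutions per call, each of time at most 9 m /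
   Delta; B bounds m by the logarithms. *)
exists (72 * B * (192 * C0%:R)); split; first by rewrite !mulr_gt0 //; lra.
move=> n b Delta eps delta Lambda n1 D0 he hd.
have [Ld [m [J [r0 [[Ld0 m0 r00 r0e rJ] [herr hcost]]]]]] := exists_accuracy C0_gt0 he hd.
rewrite -BE => hm.
have [t0 [L [k [[t00 k0 L0 Lmk] [hLam h8 hT]]]]] := exists_register Lambda D0 m0.
have [e0 _] := andP he; have [d0 d1] := andP hd.
have hcalls := calls_estimate n b L m t00 k0 C0 Ld r0 J.
rewrite -(ler_nat R) natrM in hcalls.
have q0 : 0 <= ln delta^-1 / eps.
  by rewrite divr_ge0 ?(ltW e0) // (le_trans _ (ln_inv_ge hd)) // invr_ge0.
exists k.+2, (estimate n b L m t00 k0 C0 Ld r0 J); split.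
- have T0 : 0 <= 9 * m%:R / Delta by rewrite !mulr_ge0 ?invr_ge0 // ltW.
  apply: (le_trans (evolution_time_estimate n b L m t00 k0 C0 Ld r0 J hT T0)).
  have hc : (calls (estimate n b L m t00 k0 C0 Ld r0 J))%:R
      <= 4 * (192 * C0%:R * (ln delta^-1 / eps)).
    by apply: (le_trans hcalls); rewrite ler_wpM2l.
  have hm' : 9 * m%:R / Delta <= 9 * (B * (ln delta^-1 + ln eps^-1)) / Delta.
    by rewrite ler_wpM2r ?invr_ge0 ?(ltW D0) // ler_wpM2l.
  have hT' := ler_wpM2l (ler0n R 2) hm'.
  apply: (le_trans (ler_pM (ler0n _ _) _ hc hT')); first by rewrite mulr_ge0.
  move: (ln delta^-1) (ln eps^-1) (C0%:R : R) => x y c.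
  by rewrite le_eqVlt; apply/orP; left; apply/eqP; field; rewrite !gt_eqF.
- apply: (le_trans hcalls); apply: (@le_trans _ _ (4 * (192 * C0%:R * (ln delta^-1 / eps)))).
    by rewrite ler_wpM2l.
  rewrite -(mulrA (72 * B)); apply: ler_wpM2r; first by rewrite (mulr_ge0 (ltW c0)).
  by lra.
- move=> H A V psi0 [E [psi [HE <- E1 gap]]] HL AH _ VA.
  have AH' : A^t* = A by rewrite [RHS](is_hermitianmxP _ _ _ AH) expr0 scale1r.
  apply: (estimate_correct t00 k0 L0 Lmk HE AH' VA) => //; last by lra.
  move=> j /andP[j0 jn].
  have hE i : (i < 2 ^ n)%N -> `|E i| <= Lambda.
    by move=> hi; apply: le_trans (energy_le_opnorm HE hi) HL.
  have [_ mono _] := HE.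
  have h1 := mono 1%N j j0 jn.
  have := hE 0%N ltac:(by rewrite expn_gt0); have := hE j jn.
  rewrite !ler_norml => /andP[_ a1] /andP[a2 _].
  have g1 : Delta <= E j - E 0%N by lra.
  have g2 : E j - E 0%N <= 2 * Lambda by lra.
  split; first by rewrite mulr_gt0 //; lra.
    by apply: le_trans hLam; rewrite ler_wpM2r // ltW.
  by apply: (le_trans h8); rewrite ler_wpM2l // ler_wpM2r // ltW.
Qed.
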